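(* Fix $k\ge2$, $\eta\in[0,1)$ and $b>0$ with $(k-1)b^{k-1}(1-\eta)<1$. Let $G_n=(V_n,E_n)$ be a sequence of asymptotically tree-like and approximately regular $k$-uniform hypergraphs with maximum degree $\Delta=\Delta(n)$, and let $m\sim b|V_n|\Delta^{-\frac1{k-1}}$. Let $\mathbf S$ be a uniformly random $m$-subset of $V_n$ and $\mathbf X=|\{e\in E_n:e\subseteq\mathbf S\}|$. Then $$\lim_{n\to\infty}\Delta^{\frac1{k-1}}|V_n|^{-1}\log\mathbb{P}_m(\mathbf X\le\eta\,\mathbb{E}_m\mathbf X)=-\frac{b^k(1-\eta+\eta\log\eta)}{k}$$ (with $0\log0=0$). In particular if $b<(k-1)^{-\frac1{k-1}}$ then $\lim_{n\to\infty}\Delta^{\frac1{k-1}}|V_n|^{-1}\log\mathbb{P}_m(\mathbf X=0)=-\frac{b^k}k$.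
   Context: Hypergraphs are simple. For a hypergraph $G$ and $S\subseteq V(G)$, $d_G(S)=|\{e\in E(G):S\subseteq e\}|$, $\Delta_\ell(G)=\max_{|S|=\ell}d_G(S)$, $\Delta(G)=\Delta_1(G)$ the maximum degree, $\delta(G)$ the minimum degree, and $\Gamma(G)$ is the maximum over distinct $v,v'$ of the number of $(k-1)$-sets $S$ with $S\cup\{v\},S\cup\{v'\}\in E(G)$. A sequence $(G_n)$ of $k$-uniform hypergraphs is asymptotically tree-like if, with $G=G_n$, $\Delta=\Delta(G)$, as $n\to\infty$: (1) $\Delta\to\infty$; (2) $\Delta_\ell(G)=o(\Delta^{\frac{k-\ell}{k-1}})$ for each $\ell\in\{2,\dots,k-1\}$; (3) $\Gamma(G)=o(\Delta)$; (4) $|E(G)|/|V(G)|=\Omega(\Delta)$. It is approximately regular if also $\delta(G)=(1-o(1))\Delta(G)$. $\mathbb{P}_m,\mathbb{E}_m$ refer to the uniform random $m$-subset model. *)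

(* Defs.v *)
From HB Require Import structures.
From mathcomp Require Import all_boot all_order all_algebra.
From mathcomp Require Import all_classical all_reals all_analysis.
Set Implicit Arguments. Unset Strict Implicit. Unset Printing Implicit Defensive.
Import Order.TTheory GRing.Theory Num.Theory.
Import numFieldNormedType.Exports.
Local Open Scope classical_set_scope.
Local Open Scope ring_scope.

Section Hyper.
Variable N : nat.
Implicit Types (E : {set {set 'I_N}}) (S : {set 'I_N}).

Definition kuniform (k : nat) E := forall e, e \in E -> #|e| = k.

Definition hdeg E S : nat := #|[set e in E | S \subset e]|.

Definition maxdeg_l E (l : nat) : nat :=
  (\max_(S : {set 'I_N} | #|S| == l) hdeg E S)%N.

Definition maxdeg E : nat := (\max_(v : 'I_N) hdeg E [set v])%N.
Definition mindeg E : nat := \big[minn/maxdeg E]_(v : 'I_N) hdeg E [set v].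

Definition codegGamma (k : nat) E : nat :=
  (\max_(v : 'I_N) \max_(v' : 'I_N | v' != v)
     #|[set S : {set 'I_N} | [&& #|S| == k.-1, S :|: [set v] \in E
                                & S :|: [set v'] \in E]]|)%N.

Definition edges_in E S : nat := #|[set e in E | e \subset S]|.

Definition msets (m : nat) : {set {set 'I_N}} := [set S : {set 'I_N} | #|S| == m].

Definition Pm {R : realType} (m : nat) (A : pred {set 'I_N}) : R :=
  (#|[set S in msets m | A S]|)%:R / (#|msets m|)%:R.

Definition Em {R : realType} (m : nat) (X : {set 'I_N} -> nat) : R :=
  (\sum_(S in msets m) (X S)%:R) / (#|msets m|)%:R.

End Hyper.

Definition asymp_tree_like (R : realType) (k : nat) (N : nat -> nat)
  (E : forall n, {set {set 'I_(N n)}}) : Prop :=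
  [/\ (forall n, kuniform k (E n)),
      ((fun n => ((maxdeg (E n))%:R : R)) @ \oo --> +oo),
      (forall l : nat, (2 <= l <= k.-1)%N ->
         (fun n => ((maxdeg_l (E n) l)%:R : R) /
                   ((maxdeg (E n))%:R `^ ((k%:R - l%:R) / (k%:R - 1))))
           @ \oo --> (0 : R)),
      ((fun n => ((codegGamma k (E n))%:R : R) / (maxdeg (E n))%:R) @ \oo --> (0 : R)) &
      (exists c : R, 0 < c /\
         \forall n \near \oo,
           c * (maxdeg (E n))%:R <= (#|E n|)%:R / (N n)%:R)].

Definition approx_regular (R : realType) (N : nat -> nat)
  (E : forall n, {set {set 'I_(N n)}}) : Prop :=
  (fun n => ((mindeg (E n))%:R : R) / (maxdeg (E n))%:R) @ \oo --> (1 : R).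

Definition xlogx (R : realType) (x : R) : R := if x == 0 then 0 else x * ln x.

(* Main.v *)
(** Weight a vertex set S by lam^|S| q^X(S) and write tau = Delta^(-1/(k-1)),
    M = |V| tau.  The ratio between "u in S" and "u not in S" is lam times the
    mean of q^d(u), d(u) being the number of edges at u completed by S.  Adding
    the edges at u one at a time turns this mean into a product of factors
    1 - (1-q) P(e \ u in S), and each probability is a product of occupation
    probabilities in an instance of the same kind, where boundedly many vertices
    are pinned and edges meeting them may have been deleted.  The tree-like
    conditions say that only o(Delta) of these factors are atypical.  With
    lam = l tau this is the recursion x -> l exp(-(1-q) x^(k-1)), whose fixed
    point x is attracting as soon as (k-1)(1-q) x^(k-1) < 1; iterating a bounded
    number of times gives E|S| ~ M x, uniformly in x.  Integrating in x yields
    the log-partition function, and concentration of |S| transfers it to sets of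
    size m ~ b M: log E_m q^X ~ - M (1-q) b^k / k for every q with
    (k-1)(1-q) b^(k-1) < 1.  The case q = 0 is P(X = 0); for eta > 0 the lower
    tail follows from Cramer's argument with q close to eta, since the condition
    on q is open. *)

Require Import Defs.
From HB Require Import structures.
From mathcomp Require Import all_boot all_order all_algebra.
From mathcomp Require Import all_classical all_reals all_analysis.
From mathcomp Require Import fintype finset.
From mathcomp Require Import ring lra zify.
Set Implicit Arguments. Unset Strict Implicit. Unset Printing Implicit Defensive.
Import Order.TTheory GRing.Theory Num.Theory.
Import numFieldNormedType.Exports.
Local Open Scope ring_scope.

(** * Partition functions with pinned vertices *)

(** What is propagated is a pair of bounds valid for every instance of the class at once, because
    the probability of completing an edge at [u] is taken after other edges have already been added.
    A round of the recursion costs [k] further pinned vertices, but the number of rounds depends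
    only on the desired precision, so the counts of atypical edges may carry constants such as
    [2 ^ K]. The propagation starts from the trivial bracket [0, 1], so local attraction of the
    fixed point would not suffice: a contraction valid on the whole bracket is needed, up to the
    critical density, and it comes from one elementary inequality for exp. Errors are kept relative
    to the density [x] all the way down to [x = 0], since the log-partition function is integrated
    from there. The passage to size [m] needs no local limit theorem: the mean of q^X over [m]-sets
    is nonincreasing in [m], so it is enough that |S| falls with probability at least 1/2 into a
    short interval on one side of [m]. *)

Section Partition.
Variables (R : realFieldType) (N : nat).
Implicit Types (D E : {set {set 'I_N}}) (S T A e : {set 'I_N}) (u w : 'I_N).

Definition avoid D u : {set {set 'I_N}} := [set e in D | u \notin e].

(** T is conditioned to lie in S.  Conditioning a vertex u to be absent needs no
    separate notion: up to a factor lam it amounts to pinning u and deleting the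
    edges at u, see [Zc_marginal]. *)
Definition Zc (lam q : R) D T : R :=
  \sum_(S : {set 'I_N} | T \subset S) lam ^+ #|S| * q ^+ edges_in D S.

Lemma edges_in_sub D1 D2 S1 S2 :
  D1 \subset D2 -> S1 \subset S2 -> (edges_in D1 S1 <= edges_in D2 S2)%N.
Proof.
move=> sD sS; apply/subset_leq_card/subsetP => e; rewrite !inE => /andP[eD eS].
by rewrite (subsetP sD) //= (subset_trans eS).
Qed.

Lemma edges_in0P D S : reflect (forall e, e \in D -> ~~ (e \subset S)) (edges_in D S == 0%N).
Proof.
rewrite /edges_in cards_eq0; apply: (iffP eqP) => [D0 e eD|H].
  by apply/negP => eS; have := in_set0 e; rewrite -D0 !inE eD eS.
by apply/setP => e; rewrite !inE; apply/negbTE; rewrite negb_and; case: (boolP (e \in D)) => // /H.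
Qed.

Lemma edges_inU1 D e S : e \notin D -> edges_in (e |: D) S = ((e \subset S) + edges_in D S)%N.
Proof.
move=> eD; rewrite /edges_in; case: (boolP (e \subset S)) => eS; last first.
  by rewrite add0n; apply: eq_card => f; rewrite !inE; case: eqP => //= ->; rewrite (negbTE eS) (negbTE eD).
rewrite [RHS](_ : _ = #|e |: [set f in D | f \subset S]|).
  by apply: eq_card => f; rewrite !inE; case: eqP => //= ->.
by rewrite cardsU1 !inE (negbTE eD).
Qed.

Variables (lam q : R).
Hypotheses (lam0 : 0 < lam) (q0 : 0 <= q) (q1 : q <= 1).

Lemma Zc_ge0 D T : 0 <= Zc lam q D T.
Proof. by apply: sumr_ge0 => S _; rewrite mulr_ge0 ?exprn_ge0 // ltW. Qed.

Lemma Zc_gt0 D T : edges_in D T = 0%N -> 0 < Zc lam q D T.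
Proof.
move=> T0; rewrite /Zc (bigD1 T) //= T0 expr0 mulr1 ltr_wpDr ?exprn_gt0 //.
by apply: sumr_ge0 => S _; rewrite mulr_ge0 ?exprn_ge0 // ltW.
Qed.

Lemma Zc_anti D1 D2 T : D1 \subset D2 -> Zc lam q D2 T <= Zc lam q D1 T.
Proof.
move=> sD; apply: ler_sum => S _; rewrite ler_wpM2l ?exprn_ge0 ?(ltW lam0)//.
by rewrite ler_wiXn2l // edges_in_sub.
Qed.

(** A set containing [e] is charged the extra factor [q = 1 - (1 - q)], and the sets that are
    charged are those with [e] pinned. *)
Lemma Zc_add_edge D e T : e \notin D ->
  Zc lam q (e |: D) T = Zc lam q D T - (1 - q) * Zc lam q D (T :|: e).
Proof.
move=> eD; rewrite /Zc (bigID (fun S => e \subset S)) /= [X in _ = X - _](bigID (fun S => e \subset S)) /=.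
rewrite [X in _ = _ - _ * X](eq_bigl (fun S => (T \subset S) && (e \subset S))); last first.
  by move=> S; rewrite subUset.
rewrite (eq_bigr (fun S => q * (lam ^+ #|S| * q ^+ edges_in D S))); last first.
  by move=> S /andP[_ eS]; rewrite edges_inU1 // eS exprS mulrCA.
rewrite -mulr_sumr [X in _ + X = _](eq_bigr (fun S => lam ^+ #|S| * q ^+ edges_in D S)); last first.
  by move=> S /andP[_ eS]; rewrite edges_inU1 // (negbTE eS).
ring.
Qed.

(** Sets missing [u] are matched with sets containing [u] by adding [u]: the size grows by one,
    whence the factor [lam], and edges completed by [u] must not be counted, whence [avoid D u]. *)
Lemma Zc_marginal D T u : u \notin T ->
  lam * Zc lam q D T = lam * Zc lam q D (u |: T) + Zc lam q (avoid D u) (u |: T).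
Proof.
move=> uT; rewrite /Zc [in LHS](bigID (fun S => u \in S)) /= mulrDr; congr (_ * _ + _).
  by apply: eq_bigl => S; rewrite subUset sub1set andbC.
rewrite [RHS](reindex_onto (fun S => u |: S) (fun S => S :\ u)) /=; last first.
  by move=> S; rewrite subUset sub1set => /andP[uS _]; rewrite setD1K.
rewrite mulr_sumr; apply: eq_big => [S|S /andP[TS uS]].
  rewrite subUset sub1set setU11 /=; case: (boolP (u \in S)) => uS /=.
    rewrite andbF; apply/esym/negbTE; rewrite negb_and orbC; apply/orP; left.
    by apply/eqP => /setP/(_ u); rewrite !inE eqxx uS.
  rewrite setU1K // eqxx !andbT; apply/idP/idP => [TS|]; first exact: subset_trans TS (subsetUr _ _).
  by move/subsetP => TS; apply/subsetP => w wT; have := TS w wT; rewrite !inE; case: eqP => // wu; rewrite -wu wT in uT.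
rewrite cardsU1 uS exprS mulrA; congr (_ * _ ^+ _).
rewrite /edges_in; apply: eq_card => e; rewrite !inE.
case: (e \in D) => //=; case: (boolP (u \in e)) => ue /=.
  by apply/negbTE/negP => /subsetP/(_ u ue); apply/negP.
apply/idP/idP => [eS|]; first exact: subset_trans eS (subsetUr _ _).
by move/subsetP => eS; apply/subsetP => w we; have := eS w we; rewrite !inE; case: eqP => // wu; rewrite -wu we in ue.
Qed.

Lemma avoid_sub D u : avoid D u \subset D.
Proof. by apply/subsetP => e; rewrite inE => /andP[]. Qed.

(** The odds of occupation are at most [lam], because deleting the edges at [u] can only increase
    the weight; a probability is at most its odds. *)
Lemma Zc_pin_le D T u : u \notin T -> Zc lam q D (u |: T) <= lam * Zc lam q D T.
Proof.
move=> uT; rewrite (Zc_marginal D uT) (le_trans (Zc_anti _ (avoid_sub D u))) //.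
by rewrite lerDr mulr_ge0 ?Zc_ge0 // ltW.
Qed.

Lemma Zc_pin_ub D T u b : u \notin T ->
  Zc lam q D (u |: T) <= b * Zc lam q (avoid D u) (u |: T) -> 0 <= b ->
  Zc lam q D (u |: T) <= lam * b * Zc lam q D T.
Proof.
move=> uT Hb b0; apply: (le_trans Hb); rewrite mulrAC (Zc_marginal D uT) [X in _ <= X]mulrC ler_wpM2l //.
by rewrite lerDr mulr_ge0 ?Zc_ge0 // ltW.
Qed.

(** From odds back to a probability: the normalization, [lam] times the pinned weight plus the
    weight with edges at [u] deleted, is at most [1 + lam] times the latter. The loss is harmless
    since [lam] is of order [tau]. *)
Lemma Zc_pin_lb D T u a : u \notin T -> 0 <= a ->
  a * Zc lam q (avoid D u) (u |: T) <= Zc lam q D (u |: T) ->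
  lam * a / (1 + lam) * Zc lam q D T <= Zc lam q D (u |: T).
Proof.
move=> uT a0 Ha; have l1 : 0 < 1 + lam by rewrite ltr_wpDl.
rewrite mulrAC ler_pdivrMr // mulrAC (Zc_marginal D uT).
have H := Zc_anti (u |: T) (avoid_sub D u).
have HZ := Zc_ge0 D (u |: T).
set W := Zc _ _ (avoid _ _) _ in Ha H *; set Z := Zc _ _ _ _ in Ha H HZ *.
apply: (@le_trans _ _ ((lam * W + W) * a)); first by rewrite ler_wpM2r // lerD2r ler_wpM2l // ltW.
rewrite (_ : (lam * W + W) * a = (a * W) * (1 + lam)); last ring.
by rewrite ler_wpM2r // ltW.
Qed.

(** Chain rule for conditional probabilities: the vertices of [A] are pinned one after the other, so
    bounds are required given every partial set [A']. *)
Lemma Zc_pin_set (a b : R) D T A : 0 <= a -> 0 <= b -> [disjoint A & T] ->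
  (forall A' w, A' \subset A -> w \in A -> w \notin A' ->
     a * Zc lam q D (T :|: A') <= Zc lam q D (w |: (T :|: A')) <= b * Zc lam q D (T :|: A')) ->
  a ^+ #|A| * Zc lam q D T <= Zc lam q D (T :|: A) <= b ^+ #|A| * Zc lam q D T.
Proof.
move=> a0 b0; move En: #|A| => n; elim: n A En => [|n IH] A En dAT H.
  by move/eqP: En; rewrite cards_eq0 => /eqP ->; rewrite setU0 !expr0 !mul1r lexx.
have [w wA] : exists w, w \in A by apply/set0Pn; rewrite -card_gt0 En.
have sA : A :\ w \subset A by rewrite subD1set.
have En' : #|A :\ w| = n by have := cardsD1 w A; rewrite wA En => -[].
have /andP[IHa IHb] := IH (A :\ w) En' (disjointWl sA dAT)
  (fun A' v sA' vA vA' => H A' v (subset_trans sA' sA) (subsetP sA v vA) vA').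
have /andP[Ha Hb] := H (A :\ w) w sA wA (negbT (setD11 _ _)).
have EU : w |: (T :|: A :\ w) = T :|: A by rewrite setUCA setD1K.
rewrite EU in Ha Hb; rewrite !exprS -!mulrA; apply/andP; split.
  by apply: le_trans Ha; rewrite ler_wpM2l.
by apply: (le_trans Hb); rewrite ler_wpM2l.
Qed.

Lemma Zc_pin_set_le D T A : [disjoint A & T] ->
  Zc lam q D (T :|: A) <= lam ^+ #|A| * Zc lam q D T.
Proof.
move=> dAT; have l0 := ltW lam0.
move En: #|A| => n; elim: n A En dAT => [|n IH] A En dAT.
  by move/eqP: En; rewrite cards_eq0 => /eqP ->; rewrite setU0 expr0 mul1r lexx.
have [w wA] : exists w, w \in A by apply/set0Pn; rewrite -card_gt0 En.
have sA : A :\ w \subset A by rewrite subD1set.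
have En' : #|A :\ w| = n by have := cardsD1 w A; rewrite wA En => -[].
have EU : w |: (T :|: A :\ w) = T :|: A by rewrite setUCA setD1K.
rewrite -EU exprS -mulrA; apply: le_trans (Zc_pin_le _ _) _.
  by rewrite !inE eqxx orbF (disjointFr dAT).
by rewrite ler_wpM2l // IH // (disjointWl sA).
Qed.

End Partition.

(** * One step of the recursion *)

Section Step.
Variables (R : realFieldType) (N : nat).
Implicit Types (D E X Y : {set {set 'I_N}}) (S T A e : {set 'I_N}) (u w : 'I_N).
Variables (lam q : R).
Hypotheses (lam0 : 0 < lam) (lam1 : lam <= 1) (q0 : 0 <= q) (q1 : q <= 1).

(** Telescopes [Zc_add_edge]. The hypothesis ranges over all partial sets [Y] since [e] is tested
    after the edges of [Y] are in place. Upper bounds on these probabilities give the lower bound on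
    the weight, and conversely. *)
Lemma Zc_add_edges D X T (al be : {set 'I_N} -> R) : [disjoint X & D] ->
  (forall e, 0 <= al e <= 1) -> (forall e, 0 <= be e <= 1) ->
  (forall Y e, Y \subset X -> e \in X -> e \notin Y ->
     al e * Zc lam q (Y :|: D) T <= Zc lam q (Y :|: D) (T :|: e)
       <= be e * Zc lam q (Y :|: D) T) ->
  (\prod_(e in X) (1 - (1 - q) * be e)) * Zc lam q D T <= Zc lam q (X :|: D) T
     <= (\prod_(e in X) (1 - (1 - q) * al e)) * Zc lam q D T.
Proof.
move=> + al01 be01; move En: #|X| => n; elim: n X En => [|n IH] X En dXD H.
  by move/eqP: En; rewrite cards_eq0 => /eqP ->; rewrite !big_set0 set0U !mul1r lexx.
have [e eX] : exists e, e \in X by apply/set0Pn; rewrite -card_gt0 En.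
have sX : X :\ e \subset X by rewrite subD1set.
have En' : #|X :\ e| = n by have := cardsD1 e X; rewrite eX En => -[].
have /andP[IHa IHb] := IH (X :\ e) En' (disjointWl sX dXD)
  (fun Y f sY fX fY => H Y f (subset_trans sY sX) (subsetP sX f fX) fY).
have /andP[Ha Hb] := H (X :\ e) e sX eX (negbT (setD11 _ _)).
have eD : e \notin (X :\ e) :|: D by rewrite !inE eqxx /= (disjointFr dXD eX).
have EX : X :|: D = e |: ((X :\ e) :|: D) by rewrite setUA setD1K.
rewrite EX (Zc_add_edge _ _ _ eD) !(big_setD1 e eX) /=.
have c0 : 0 <= 1 - q by rewrite subr_ge0.
have F (g : {set 'I_N} -> R) : (forall e, 0 <= g e <= 1) -> 0 <= 1 - (1 - q) * g e.
  move=> g01; rewrite subr_ge0; have /andP[g0 g1] := g01 e.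
  by rewrite mulr_ile1 // gerBl.
rewrite -!mulrA; apply/andP; split.
  apply: (@le_trans _ _ ((1 - (1 - q) * be e) * Zc lam q ((X :\ e) :|: D) T)).
    by rewrite ler_wpM2l // F.
  by rewrite [X in X <= _]mulrBl mul1r lerB // -mulrA ler_wpM2l.
apply: (@le_trans _ _ ((1 - (1 - q) * al e) * Zc lam q ((X :\ e) :|: D) T)).
  by rewrite [X in _ <= X]mulrBl mul1r lerB // -mulrA ler_wpM2l.
by rewrite ler_wpM2l // F.
Qed.

(** Meant for edges without a uniform estimate of their completion probability. Every term may be
    taken before any edge of [X] is added, because adding edges only decreases weights. *)
Lemma Zc_union_bound D X T : [disjoint X & D] ->
  Zc lam q D T - (1 - q) * (\sum_(e in X) Zc lam q D (T :|: e)) <= Zc lam q (X :|: D) T.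
Proof.
move En: #|X| => n; elim: n X En => [|n IH] X En dXD.
  by move/eqP: En; rewrite cards_eq0 => /eqP ->; rewrite !big_set0 set0U mulr0 subr0.
have [e eX] : exists e, e \in X by apply/set0Pn; rewrite -card_gt0 En.
have sX : X :\ e \subset X by rewrite subD1set.
have En' : #|X :\ e| = n by have := cardsD1 e X; rewrite eX En => -[].
have IHX := IH _ En' (disjointWl sX dXD).
have eD : e \notin (X :\ e) :|: D by rewrite !inE eqxx /= (disjointFr dXD eX).
have EX : X :|: D = e |: ((X :\ e) :|: D) by rewrite setUA setD1K.
rewrite EX (Zc_add_edge _ _ _ eD) (big_setD1 e eX) /= mulrDr opprD addrCA addrC.
apply: lerB => //; rewrite ler_wpM2l ?subr_ge0 //.
by apply: Zc_anti => //; rewrite subsetUr.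
Qed.

Variables (k : nat) (E : {set {set 'I_N}}).
Hypotheses (kE : kuniform k E).

(** Uniform bounds for the mean of q^d(u) over all instances (D, T) with at most
    K pinned vertices.  Edges of E meeting T may be missing from D, so the class
    is closed under deleting edges at a pinned vertex. *)
Definition ratio_bound (K : nat) (a b : R) := forall D T u,
  D \subset E -> (forall e, e \in E -> [disjoint e & T] -> e \in D) -> (#|T| <= K)%N ->
  u \notin T -> edges_in D (u |: T) = 0%N ->
  a * Zc lam q (avoid D u) (u |: T) <= Zc lam q D (u |: T)
    <= b * Zc lam q (avoid D u) (u |: T).

Lemma ratio_bound01 K : ratio_bound K 0 1.
Proof.
move=> D T u _ _ _ _ _; rewrite mul0r mul1r Zc_ge0 //=.
by apply: Zc_anti => //; exact: avoid_sub.
Qed.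

Lemma disjointD1U1 T u e : [disjoint e & T] -> [disjoint e :\ u & u |: T].
Proof.
rewrite -!setI_eq0 => /eqP/setP H; apply/eqP/setP => w; have := H w; rewrite !inE.
by case: eqP.
Qed.

Lemma setU_setD T e : T :|: e = T :|: (e :\: T).
Proof. by apply/setP => w; rewrite !inE; case: (w \in T). Qed.

Lemma disjoint_setD T e : [disjoint e :\: T & T].
Proof. by rewrite -setI_eq0; apply/eqP/setP => w; rewrite !inE; case: (w \in T); rewrite /= ?andbF. Qed.

Definition free_star T u := [set e in E | (u \in e) && [disjoint e & T]].

(** For e outside this set, the vertices of e can be pinned one after the other
    without ever completing an edge other than e, which is what [ratio_bound]
    requires. *)
Definition bad_star T u := [set e in free_star T u |
  [exists f in E, [&& u \notin f, f \subset T :|: e & ~~ (f \subset T)]]].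

(** The edges at [u] that an admissible [D] may or may not contain. Those inside [u |: T] are left
    out, as [edges_in D (u |: T) = 0] already excludes them from [D]. *)
Definition touching T u :=
  [set e in E | [&& u \in e, ~~ [disjoint e & T] & ~~ (e \subset u |: T)]].

Lemma free_star_sub T u : free_star T u \subset E.
Proof. by apply/subsetP => e; rewrite inE => /andP[]. Qed.

(** The [k - 1] vertices of [e :\ u] are pinned in turn. On top of [T] at most [u] and these
    vertices are pinned, so the bounds for [K + k] apply at each stage, and [e] not being bad
    guarantees that no edge is completed on the way. *)
Lemma ratio_bound_edge K a b D T u Y e : 0 <= a -> 0 <= b -> ratio_bound (K + k) a b ->
  D \subset E -> (forall e, e \in E -> [disjoint e & T] -> e \in D) -> (#|T| <= K)%N ->
  u \notin T -> edges_in D (u |: T) = 0%N ->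
  Y \subset free_star T u -> e \in free_star T u -> e \notin Y -> e \notin bad_star T u ->
  (lam * a / (1 + lam)) ^+ k.-1 * Zc lam q (Y :|: avoid D u) (u |: T) <=
    Zc lam q (Y :|: avoid D u) ((u |: T) :|: e) <=
  (lam * b) ^+ k.-1 * Zc lam q (Y :|: avoid D u) (u |: T).
Proof.
move=> a0 b0 IH DE DT TK uT indep sY eS eY eB; set D' := Y :|: _.
move: (eS); rewrite inE => /and3P[eE ue dis].
have EU : (u |: T) :|: e = (u |: T) :|: (e :\ u).
  by apply/setP => w; rewrite !inE; case: eqP => //= ->; rewrite ue.
have Ck : #|e :\ u| = k.-1 by rewrite -(kE eE) (cardsD1 u e) ue.
have sD'E : D' \subset E.
  by rewrite subUset (subset_trans sY (free_star_sub _ _)) (subset_trans (avoid_sub _ _)).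
(* A completed edge [f] taken from [Y] contains [u] and misses [T], so it lies in [e] and equals it
   by uniformity, although [e] is not in [Y]. A completed edge avoiding [u] lies in [T], as [e] is
   not bad, against [indep]. *)
have indep' S : S \subset T :|: e -> edges_in D' S = 0%N.
  move=> sS; apply/eqP/edges_in0P => f fD'; apply/negP => fS.
  have fTe := subset_trans fS sS.
  have fE := subsetP sD'E f fD'.
  move: fD'; rewrite inE => /orP[fY|].
    have := subsetP sY f fY; rewrite inE => /and3P[_ uf df].
    have fe : f \subset e.
      apply/subsetP => w wf; have := subsetP fTe w wf; rewrite inE => /orP[wT|//].
      by have := disjointFr df wf; rewrite wT.
    have /eqP fe' : f == e by rewrite eqEcard fe (kE fE) (kE eE) leqnn.
    by rewrite -fe' fY in eY.
  rewrite inE => /andP[fD uf].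
  move: eB; rewrite inE eS /= => /negP; apply; apply/exists_inP; exists f => //.
  rewrite uf fTe /=; apply/negP => fT.
  move/eqP/edges_in0P: indep => /(_ f fD); rewrite (subset_trans fT) //.
  exact: subsetUr.
have H : forall A' w, A' \subset e :\ u -> w \in e :\ u -> w \notin A' ->
   [/\ w \notin (u |: T) :|: A', 
     a * Zc lam q (avoid D' w) (w |: ((u |: T) :|: A')) <= Zc lam q D' (w |: ((u |: T) :|: A'))
   & Zc lam q D' (w |: ((u |: T) :|: A')) <= b * Zc lam q (avoid D' w) (w |: ((u |: T) :|: A'))].
  move=> A' w sA' wA wA'.
  have [wu we] : w != u /\ w \in e by move: wA; rewrite !inE => /andP[].
  have wT : w \notin T by apply/negP => wT; have := disjointFr dis we; rewrite wT.
  have w3 : w \notin (u |: T) :|: A' by rewrite !inE (negbTE wu) (negbTE wT) (negbTE wA').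
  have sA'e : A' \subset e by apply: subset_trans sA' _; rewrite subD1set.
  have h1 f : f \in E -> [disjoint f & (u |: T) :|: A'] -> f \in D'.
    move=> fE df; rewrite /D' inE; apply/orP; right; rewrite inE.
    rewrite DT //=; last by apply: disjointWr df; rewrite -setUA setUCA subsetUl.
    by apply/negP => uf; have := disjointFr df uf; rewrite !inE eqxx.
  have h2 : (#|(u |: T) :|: A'| <= K + k)%N.
    rewrite (leq_trans (leq_card_setU _ _)) //.
    have k0 : (0 < k)%N by rewrite -(kE eE) card_gt0; apply/set0Pn; exists u.
    rewrite cardsU1 uT -[k in (_ <= _ + k)%N](prednK k0) addnS -addSn leq_add ?ltnS //.
    by rewrite -Ck subset_leq_card.
  have h3 : edges_in D' (w |: ((u |: T) :|: A')) = 0%N.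
    apply: indep'; rewrite subUset sub1set !inE we orbT /= !subUset sub1set !inE ue orbT /=.
    by rewrite subsetUl (subset_trans sA'e) // subsetUr.
  by have /andP[] := IH D' ((u |: T) :|: A') w sD'E h1 h2 w3 h3.
rewrite EU -Ck; apply: Zc_pin_set.
- by rewrite divr_ge0 ?mulr_ge0 ?addr_ge0 ?ler01 // ltW.
- by rewrite mulr_ge0 // ltW.
- exact: disjointD1U1.
- move=> A' w sA' wA wA'; have [w1 w2 w3] := H A' w sA' wA wA'.
  by rewrite Zc_pin_lb // Zc_pin_ub.
Qed.

(** Three classes of edges at [u]: good free edges obey the inductive bounds; for bad free edges
    only the trivial bounds 0 and [lam ^+ k.-1] are used; touching edges enter the lower bound by a
    union bound and are dropped in the upper one. *)
Lemma ratio_bound_step K a b D T u : 0 <= a -> 0 <= b -> b <= 1 -> ratio_bound (K + k) a b ->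
  D \subset E -> (forall e, e \in E -> [disjoint e & T] -> e \in D) -> (#|T| <= K)%N ->
  u \notin T -> edges_in D (u |: T) = 0%N -> a <= 1 ->
  (1 - (1 - q) * (\sum_(e in touching T u) lam ^+ #|e :\: (u |: T)|)) *
  ((1 - (1 - q) * (lam * b) ^+ k.-1) ^+ #|free_star T u :\: bad_star T u| *
   (1 - (1 - q) * lam ^+ k.-1) ^+ #|bad_star T u|) * Zc lam q (avoid D u) (u |: T)
  <= Zc lam q D (u |: T) <=
  (1 - (1 - q) * (lam * a / (1 + lam)) ^+ k.-1) ^+ #|free_star T u :\: bad_star T u|
   * Zc lam q (avoid D u) (u |: T).
Proof.
move=> a0 b0 b1 IH DE DT TK uT indep a1.
set T' := u |: T; set D0 := avoid D u; set F := free_star T u; set B := bad_star T u.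
have l0 := ltW lam0.
have c01 : 0 <= 1 - q <= 1 by rewrite subr_ge0 q1 gerBl.
have /andP[c0 c1] := c01.
have sBF : B \subset F by apply/subsetP => e; rewrite inE => /andP[].
pose al e : R := if e \in B then 0 else (lam * a / (1 + lam)) ^+ k.-1.
pose be e : R := if e \in B then lam ^+ k.-1 else (lam * b) ^+ k.-1.
have a01 : 0 <= lam * a / (1 + lam) <= 1.
  have H1 : 0 < 1 + lam by rewrite ltr_wpDr.
  rewrite divr_ge0 ?mulr_ge0 // ?(ltW H1) //= ler_pdivrMr // mul1r.
  by rewrite (le_trans (y := lam)) ?lerDr // ler_piMr.
have b01 : 0 <= lam * b <= 1 by rewrite mulr_ge0 // mulr_ile1.
have al01 e : 0 <= al e <= 1.
  rewrite /al; case: ifP => _; first by rewrite lexx ler01.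
  by have /andP[H1 H2] := a01; rewrite exprn_ge0 // exprn_ile1.
have be01 e : 0 <= be e <= 1.
  rewrite /be; case: ifP => _; first by rewrite exprn_ge0 // exprn_ile1.
  by have /andP[H1 H2] := b01; rewrite exprn_ge0 // exprn_ile1.
have dFD0 : [disjoint F & D0].
  rewrite -setI_eq0; apply/eqP/setP => e; rewrite !inE.
  by case: (u \in e); rewrite /= ?andbF.
have HF : forall Y e, Y \subset F -> e \in F -> e \notin Y ->
     al e * Zc lam q (Y :|: D0) T' <= Zc lam q (Y :|: D0) (T' :|: e)
       <= be e * Zc lam q (Y :|: D0) T'.
  move=> Y e sY eF eY; rewrite /al /be; case: (boolP (e \in B)) => eB.
    rewrite mul0r Zc_ge0 //=.
    move: (eF); rewrite inE => /and3P[eE ue dis].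
    have EU : (u |: T) :|: e = (u |: T) :|: (e :\ u).
      by apply/setP => w; rewrite !inE; case: eqP => //= ->; rewrite ue.
    have Ck : #|e :\ u| = k.-1 by rewrite -(kE eE) (cardsD1 u e) ue.
    rewrite /T' EU -Ck Zc_pin_set_le //.
    exact: disjointD1U1.
  exact: (ratio_bound_edge a0 b0 IH).
have /andP[LB UB] := Zc_add_edges dFD0 al01 be01 HF.
have EP (g : {set 'I_N} -> R) x y : (forall e, g e = if e \in B then x else y) ->
   \prod_(e in F) (1 - (1 - q) * g e) = (1 - (1 - q) * y) ^+ #|F :\: B| * (1 - (1 - q) * x) ^+ #|B|.
  move=> Hg; rewrite (big_setID B) /= mulrC (setIidPr sBF); congr (_ * _).
    rewrite (eq_bigr (fun=> 1 - (1 - q) * y)) ?prodr_const // => e.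
    by rewrite inE Hg => /andP[/negbTE ->].
  by rewrite (eq_bigr (fun=> 1 - (1 - q) * x)) ?prodr_const // => e; rewrite Hg => ->.
rewrite (EP be (lam ^+ k.-1) ((lam * b) ^+ k.-1)) // in LB.
rewrite (EP al 0 ((lam * a / (1 + lam)) ^+ k.-1)) // mulr0 subr0 expr1n mulr1 in UB.
set X := [set e in D | (u \in e) && ~~ [disjoint e & T]].
(* That [F] is contained in [D] is where the hypothesis on edges disjoint from [T] enters. *)
have ED : D = X :|: (F :|: D0).
  apply/setP => e; rewrite !inE; case: (boolP (e \in D)) => eD /=.
    rewrite (subsetP DE e eD); case: (u \in e) => //=; case: [disjoint e & T] => //.
  rewrite orbF; apply/esym/negbTE/negP => /and3P[eE _ /(DT e eE)]; exact: negP.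
have dX : [disjoint X & F :|: D0].
  rewrite -setI_eq0; apply/eqP/setP => e; rewrite !inE.
  by case: (u \in e); case: [disjoint e & T]; rewrite /= ?andbF.
have sXT : X \subset touching T u.
  apply/subsetP => e; rewrite !inE => /and3P[eD ue dis].
  rewrite (subsetP DE e eD) ue dis /=.
  by move/eqP/edges_in0P: indep => /(_ e eD).
apply/andP; split; last first.
  by apply: le_trans UB; apply: Zc_anti => //; rewrite [in X in _ \subset X]ED subsetUr.
have UBd := Zc_union_bound T' dX; rewrite -ED in UBd.
set xi := \sum_(e in _) _; set W := Zc _ _ _ _ in LB *; set Z1 := Zc _ _ _ _ in LB *.
set P := _ * _ ^+ #|B| in LB *.
have Z1ge : 0 <= Z1 by apply: Zc_ge0.
have HS : \sum_(e in X) Zc lam q (F :|: D0) (T' :|: e) <= xi * Z1.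
  rewrite mulr_suml; apply: (@le_trans _ _ (\sum_(e in X) lam ^+ #|e :\: T'| * Z1)).
    apply: ler_sum => e eX.
    have -> : T' :|: e = T' :|: (e :\: T') by exact: setU_setD.
    apply: Zc_pin_set_le => //.
    exact: disjoint_setD.
  rewrite [X in _ <= X](big_setID X) /= (setIidPr sXT) lerDl.
  by apply: sumr_ge0 => e _; rewrite mulr_ge0 ?exprn_ge0.
(* If the union bound exceeds 1, the claimed lower bound is at most 0 and holds trivially. *)
case: (lerP 0 (1 - (1 - q) * xi)) => H.
  apply: le_trans UBd; rewrite -/Z1.
  rewrite -mulrA; apply: (@le_trans _ _ ((1 - (1 - q) * xi) * Z1)).
    by rewrite ler_wpM2l.
  by rewrite [X in X <= _]mulrBl mul1r lerB // -mulrA ler_wpM2l.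
have P0 : 0 <= P.
  have [lb0 lb1] := andP b01.
  by rewrite mulr_ge0 // exprn_ge0 // subr_ge0 mulr_ile1 ?exprn_ge0 ?exprn_ile1.
have W0 : 0 <= W by apply: Zc_ge0.
apply: (@le_trans _ _ 0); last exact: Zc_ge0.
by rewrite mulr_le0_ge0 // mulr_le0_ge0 // ltW.
Qed.
End Step.

(** * Atypical edges *)

Lemma leq_card_bigcup (I T : finType) (P : pred I) (F : I -> {set T}) :
  (#|\bigcup_(i | P i) F i| <= \sum_(i | P i) #|F i|)%N.
Proof.
elim/big_rec2: _ => [|i n X _ H]; first by rewrite cards0.
by rewrite (leq_trans (leq_card_setU _ _)) // leq_add2l.
Qed.

(** A quantitative form, at precision eps, of the hypotheses on one hypergraph;
    tau stands for Delta^(-1/(k-1)). *)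
Definition tree_like (R : realFieldType) (N k : nat) (eps tau : R) (E : {set {set 'I_N}}) :=
  [/\ kuniform k E, 0 < tau <= eps,
    forall l, (2 <= l <= k.-1)%N -> (maxdeg_l E l)%:R * tau ^+ (k - l) <= eps,
    (codegGamma k E)%:R * tau ^+ k.-1 <= eps &
    forall v, 1 - eps <= (hdeg E [set v])%:R * tau ^+ k.-1 <= 1].

Lemma predn_split j k : (1 < j < k)%N -> k.-1 = (k - j + (j - 1))%N.
Proof. lia. Qed.

Lemma subn_subS j k : (1 < j < k)%N -> (k - (k - j).+1 = j - 1)%N.
Proof. lia. Qed.

Lemma subn_range j k : (1 < j < k)%N -> (2 <= (k - j).+1 <= k.-1)%N.
Proof. lia. Qed.

Lemma range_pred j k : (1 < j < k)%N -> (2 <= j <= k.-1)%N.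
Proof. lia. Qed.

Section Count.
Variables (R : realFieldType) (N k : nat) (eps tau : R) (E : {set {set 'I_N}}).
Hypotheses (k2 : (2 <= k)%N) (eps1 : eps <= 1) (HE : tree_like k eps tau E).
Implicit Types (T S e f : {set 'I_N}) (u v t : 'I_N).

Let kE : kuniform k E. Proof. by case: HE. Qed.
Let tau0 : 0 < tau. Proof. by case: HE => _ /andP[]. Qed.
Let tau_le : tau <= eps. Proof. by case: HE => _ /andP[]. Qed.
Let eps0 : 0 < eps. Proof. exact: lt_le_trans tau_le. Qed.
Let tau1 : tau <= 1. Proof. exact: le_trans eps1. Qed.

Lemma hdeg_le_maxdeg_l S : (hdeg E S <= maxdeg_l E #|S|)%N.
Proof. by rewrite /maxdeg_l; apply: (@leq_bigmax_cond _ (fun S' : {set 'I_N} => #|S'| == #|S|)). Qed.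

Lemma hdeg_scaled S : (2 <= #|S| <= k.-1)%N -> (hdeg E S)%:R * tau ^+ (k - #|S|) <= eps.
Proof.
move=> HS; case: HE => _ _ /(_ _ HS) H _ _; apply: le_trans H.
by rewrite ler_wpM2r ?exprn_ge0 ?(ltW tau0) // ler_nat hdeg_le_maxdeg_l.
Qed.

(** For [k >= 3] this is the tree-like condition at [l = 2], with a factor [tau] to spare. For
    [k = 2] that condition is void, but a pair then lies in at most one edge and [tau <= eps]. *)
Lemma hdeg_pair_scaled u t : u != t -> (hdeg E [set u; t])%:R * tau ^+ k.-1 <= eps.
Proof.
move=> ut; have C2 : #|[set u; t]| = 2%N by rewrite cards2 ut.
have [k3|k3] := leqP 3 k.
  have := @hdeg_scaled [set u; t]; rewrite C2 => /(_ ltac:(lia)).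
  apply: le_trans; rewrite ler_wpM2l //.
  have -> : k.-1 = (k - 2).+1 by lia.
  by rewrite exprS ler_piMl // exprn_ge0 // ltW.
have Ek : k = 2%N by lia.
have : (hdeg E [set u; t] <= 1)%N.
  rewrite /hdeg -(cards1 [set u; t]); apply/subset_leq_card/subsetP => e.
  rewrite !inE => /andP[eE ue]; rewrite eq_sym eqEcard ue C2 (kE eE); lia.
rewrite Ek expr1 -(ler_nat R) => H; apply: le_trans tau_le.
by rewrite ler_piMl // ltW.
Qed.

(** Every edge at [u] that meets [T] is counted by the degree of a pair [{u, t}] with [t] in [T]. *)
Lemma card_free_star T u : u \notin T ->
  1 - eps - #|T|%:R * eps <= #|free_star E T u|%:R * tau ^+ k.-1.
Proof.
move=> uT; case: HE => _ _ _ _ /(_ u) /andP[H _].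
have tk : 0 <= tau ^+ k.-1 by rewrite exprn_ge0 // ltW.
have : (hdeg E [set u] <= #|free_star E T u| + \sum_(t in T) hdeg E [set u; t])%N.
  apply: (@leq_trans #|free_star E T u :|: \bigcup_(t in T) [set e in E | [set u; t] \subset e]|).
    apply/subset_leq_card/subsetP => e; rewrite !inE sub1set => /andP[eE ue].
    rewrite eE ue /=; case: (boolP [disjoint e & T]) => //=.
    rewrite -setI_eq0 => /set0Pn[t]; rewrite inE => /andP[te tT].
    by apply/bigcupP; exists t => //; rewrite inE eE subUset !sub1set ue.
  rewrite (leq_trans (leq_card_setU _ _)) // leq_add2l.
  exact: leq_card_bigcup.
rewrite -(ler_nat R) natrD natr_sum => H2.
have := ler_wpM2r tk H2; rewrite mulrDl mulr_suml => H3.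
have : \sum_(t in T) (hdeg E [set u; t])%:R * tau ^+ k.-1 <= \sum_(t in T) eps.
  apply: ler_sum => t tT; apply: hdeg_pair_scaled.
  by apply/eqP => ut; rewrite ut tT in uT.
rewrite sumr_const -[X in _ <= X]mulr_natl; lra.
Qed.

Lemma card_free_star_le T u : #|free_star E T u|%:R * tau ^+ k.-1 <= 1.
Proof.
case: HE => _ _ _ _ /(_ u) /andP[_]; apply: le_trans.
rewrite ler_wpM2r ?exprn_ge0 ?(ltW tau0) // ler_nat.
by apply/subset_leq_card/subsetP => e; rewrite !inE sub1set => /and3P[-> ->].
Qed.

(** Edges are grouped by their trace [T'] on [T], which accounts for the factor [2 ^ #|T|]. Those
    with trace [T'] contain a set of size [#|T'| + 1] and have [k - #|T'| - 1] vertices left,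
    exactly the power of [tau] that the tree-like condition balances against the degree. *)
Lemma sum_touching T u (L lam : R) : u \notin T -> 1 <= L -> 0 <= lam <= L * tau ->
  \sum_(e in touching E T u) lam ^+ #|e :\: (u |: T)| <= (2 ^ #|T|)%:R * (L ^+ k * eps).
Proof.
move=> uT L1 /andP[l0 lL].
have L0 : 0 <= L by apply: le_trans L1.
rewrite (partition_big (fun e => e :&: T) (fun T' => T' \in powerset T)) /=; last first.
  by move=> e _; rewrite powersetE subsetIr.
rewrite -card_powerset -sum1_card natr_sum mulr_suml.
apply: ler_sum => T'; rewrite powersetE mul1r => sT'.
(* Extreme traces do not occur: an empty one means that [e] misses [T], and one with [k - 1] or more
   vertices puts [e] inside [u |: T]. *)
case: (boolP (0 < #|T'| < k.-1)%N) => HT; last first.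
  rewrite big1 ?mulr_ge0 ?exprn_ge0 ?(ltW eps0) // => e /andP[].
  rewrite inE => /and4P[eE ue dis sub] /eqP eT'; exfalso; move: HT; rewrite -eT'.
  rewrite -setI_eq0 -card_gt0 in dis; rewrite dis /=; apply/negP; rewrite negbK.
  have Ce := kE eE; rewrite ltnNge; apply/negP => HC.
  move/negP: sub; apply.
  have : (e :\ u) :&: T == e :\ u.
    rewrite eqEcard subsetIl /=.
    have -> : #|e :\ u| = k.-1 by rewrite -Ce (cardsD1 u e) ue.
    rewrite (leq_trans HC) // subset_leq_card //.
    apply/subsetP => w; rewrite !inE => /andP[-> wT]; rewrite wT !andbT.
    by apply/eqP => wu; rewrite wu (negbTE uT) in wT.
  move/eqP => /setIidPl; rewrite subDset; exact.
have Cu : #|u |: T'| = #|T'|.+1.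
  by rewrite cardsU1; case: (boolP (u \in T')) => // /(subsetP sT'); rewrite (negbTE uT).
apply: (@le_trans _ _ (\sum_(e in E | u |: T' \subset e) (L * tau) ^+ (k - #|T'|.+1))).
  rewrite big_mkcond [X in _ <= X]big_mkcond /=; apply: ler_sum => e _.
  case: ifP; last by move=> _; case: ifP => // _; rewrite exprn_ge0 // mulr_ge0 // ltW.
  case/andP; rewrite inE => /and4P[eE ue dis sub] /eqP eT'.
  rewrite eE subUset sub1set ue -eT' subsetIl /=.
  have -> : (k - #|e :&: T|.+1 = #|e :\: (u |: T)|)%N.
    rewrite cardsD (kE eE); congr (_ - _)%N.
    have -> : e :&: (u |: T) = u |: (e :&: T).
      by apply/setP => w; rewrite !inE; case: eqP => [->|]; rewrite ?ue.
    by rewrite cardsU1 !inE (negbTE uT) andbF.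
  by rewrite lerXn2r // nnegrE mulr_ge0 // ltW.
rewrite sumr_const.
have -> : #|[pred e in E | u |: T' \subset e]| = hdeg E (u |: T').
  by apply: eq_card => e; rewrite !inE.
rewrite -mulr_natl exprMn mulrCA ler_pM ?exprn_ge0 //.
- by rewrite mulr_ge0 ?exprn_ge0 // ltW.
- by apply: ler_weXn2l => //; exact: leq_subr.
- by rewrite -Cu; apply: hdeg_scaled; rewrite Cu.
Qed.

Lemma codeg_scaled u t : u != t ->
  #|[set S : {set 'I_N} | [&& #|S| == k.-1, S :|: [set u] \in E & S :|: [set t] \in E]]|%:R
    * tau ^+ k.-1 <= eps.
Proof.
move=> ut; case: HE => _ _ _ + _; apply: le_trans.
rewrite ler_wpM2r ?exprn_ge0 ?(ltW tau0) // ler_nat.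
rewrite /codegGamma (bigD1 u) //= leq_max; apply/orP; left.
have tu : t != u by rewrite eq_sym.
rewrite (bigD1 t tu) /= leq_max; apply/orP; left.
apply: eq_leq; apply: eq_card => S; rewrite inE; apply/idP/idP => [H|].
  exact: classical_sets.mem_set.
by move/classical_sets.set_mem.
Qed.

(** Sort by the trace [T'] on [T] of an edge [f] witnessing that [e] is bad. If it is empty, then
    [f = e], impossible since [u] is not in [f]. If it is [{t}], then [f :\ t = e :\ u], and the
    codegree of [u] and [t] counts the choices. If it has [j >= 2] vertices, choose [f] above [T']
    and then [e] above [u] and [f :\: T']: a degree of order [j] times one of order [k - j + 1]. *)
Lemma card_bad_star T u : u \notin T ->
  #|bad_star E T u|%:R * tau ^+ k.-1 <= (2 ^ #|T|)%:R * eps.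
Proof.
move=> uT; have tk n : 0 <= tau ^+ n by rewrite exprn_ge0 // ltW.
pose B T' := [set e in free_star E T u |
  [exists f in E, [&& u \notin f, f \subset T :|: e, ~~ (f \subset T) & f :&: T == T']]].
have : (#|bad_star E T u| <= \sum_(T' in powerset T) #|B T'|)%N.
  apply: leq_trans (leq_card_bigcup _ _); apply/subset_leq_card/subsetP => e.
  rewrite inE => /andP[eS /exists_inP[f fE /and3P[uf fTe fT]]].
  apply/bigcupP; exists (f :&: T); first by rewrite powersetE subsetIr.
  by rewrite inE eS; apply/exists_inP; exists f => //; rewrite uf fTe fT eqxx.
rewrite -(ler_nat R) natr_sum => H; apply: le_trans (ler_wpM2r (tk _) H) _.
rewrite -card_powerset -sum1_card natr_sum !mulr_suml.
apply: ler_sum => T'; rewrite powersetE mul1r => sT'.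
have uT' : u \notin T' by apply: contra uT; apply: (subsetP sT').
have [HT|HT] := leqP 2 #|T'|; last first.
  have [/cards1P[t Et]|T'0] : #|T'| == 1%N \/ #|T'| = 0%N by case: (#|T'|) HT => [|[]]; auto.
    have tT : t \in T by rewrite -sub1set -Et.
    have ut : u != t by apply/eqP => ut; rewrite ut tT in uT.
    apply: le_trans (codeg_scaled ut); rewrite ler_wpM2r // ler_nat.
    have inj : {in B T' &, injective (fun e => e :\ u)}.
      move=> e e'; rewrite !inE => /andP[/and3P[_ ue _] _] /andP[/and3P[_ ue' _] _] EQ.
      by rewrite -(setD1K ue) EQ setD1K.
    rewrite -(card_in_imset inj); apply/subset_leq_card/subsetP => S /imsetP[e + ->].
    rewrite inE => /andP[]; rewrite inE => /and3P[eE ue dis].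
    case/exists_inP=> f fE /and4P[uf fTe fT /eqP fT']; rewrite inE setUC setD1K // eE /=.
    have Ck : #|e :\ u| = k.-1 by rewrite -(kE eE) (cardsD1 u e) ue.
    rewrite Ck eqxx /= setUC.
    suff -> : t |: (e :\ u) = f by [].
    have tf : t \in f by have := set11 t; rewrite -Et -fT' inE => /andP[].
    have sub : f :\ t \subset e :\ u.
      apply/subsetP => w; rewrite !inE => /andP[wt wf].
      have wu : w != u by apply/eqP => wu; rewrite -wu wf in uf.
      rewrite wu /=; have := subsetP fTe w wf; rewrite inE => /orP[wT|//].
      have : w \in f :&: T by rewrite inE wf.
      by rewrite fT' Et inE (negbTE wt).
    have /eqP <- : f :\ t == e :\ u.
      by rewrite eqEcard sub Ck -(kE fE) (cardsD1 t f) tf /= leqnn.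
    by rewrite setD1K.
  have -> : B T' = set0.
    apply/setP => e; rewrite !inE; apply/negbTE/negP => /andP[/and3P[eE ue dis]].
    case/exists_inP=> f fE /and4P[uf fTe fT /eqP fT'].
    have fe : f \subset e.
      apply/subsetP => w wf; have := subsetP fTe w wf; rewrite inE => /orP[wT|//].
      have wfT : w \in f :&: T by rewrite inE wf.
      by rewrite fT' (cards0_eq T'0) inE in wfT.
    have /eqP fe' : f == e by rewrite eqEcard fe (kE fE) (kE eE) leqnn.
    by rewrite fe' ue in uf.
  by rewrite cards0 mul0r ltW.
set j := #|T'| in HT *.
have [jk|jk] := ltnP j k; last first.
  have -> : B T' = set0.
    apply/setP => e; rewrite !inE; apply/negbTE/negP => /andP[_].
    case/exists_inP=> f fE /and4P[uf fTe fT /eqP fT'].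
    move/negP: fT; apply; apply/setIidPl/eqP; rewrite eqEcard subsetIl (kE fE) fT' //.
  by rewrite cards0 mul0r ltW.
have : (#|B T'| <= \sum_(f in E | [&& T' \subset f & u \notin f]) hdeg E (u |: (f :\: T')))%N.
  apply: leq_trans (leq_card_bigcup _ _); apply/subset_leq_card/subsetP => e.
  rewrite inE => /andP[]; rewrite inE => /and3P[eE ue dis].
  case/exists_inP=> f fE /and4P[uf fTe fT /eqP fT'].
  apply/bigcupP; exists f; first by rewrite fE uf -fT' subsetIl.
  rewrite inE eE subUset sub1set ue /=; apply/subsetP => w; rewrite inE => /andP[wT' wf].
  have := subsetP fTe w wf; rewrite inE => /orP[wT|//].
  by move: wT'; rewrite -fT' inE wf wT.
rewrite -(ler_nat R) natr_sum => H1; apply: le_trans (ler_wpM2r (tk _) H1) _.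
have jr : (1 < j < k)%N by rewrite HT.
(* The powers [k - j] and [j - 1] scale the degrees of sets of size [j] and [k - j + 1], and they
   add up to [k - 1]. *)
rewrite (predn_split jr).
rewrite exprD mulrA mulrAC mulr_suml.
apply: (@le_trans _ _ ((\sum_(f in E | [&& T' \subset f & u \notin f]) eps) * tau ^+ (k - j))).
  rewrite ler_wpM2r //; apply: ler_sum => f /and3P[fE sT'f uf].
  have C : #|u |: (f :\: T')| = (k - j).+1.
    by rewrite cardsU1 !inE (negbTE uf) andbF cardsD (kE fE) (setIidPr sT'f).
  have := @hdeg_scaled (u |: (f :\: T')); rewrite C (subn_subS jr).
  by apply; exact: subn_range.
rewrite sumr_const -mulr_natl mulrAC; apply: (@le_trans _ _ (eps * eps)); last first.
  by rewrite ler_piMl // ltW.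
rewrite ler_wpM2r //; first exact: ltW.
apply: le_trans (@hdeg_scaled T' _); last exact: range_pred.
rewrite ler_wpM2r // ler_nat; apply/subset_leq_card/subsetP => f.
by rewrite !inE => /and3P[-> ->].
Qed.

End Count.

(** * The recursion step in exponential form *)

Lemma expR_le_subr (R : realType) (d y : R) : 0 <= d -> 0 <= y -> (1 + d) * y <= d ->
  expR (- ((1 + d) * y)) <= 1 - y.
Proof.
move=> d0 y0 yd; have := expR_ge1Dx ((1 + d) * y) => H.
have E0 := expR_gt0 ((1 + d) * y).
rewrite expRN -[X in X <= _]mul1r ler_pdivrMr //.
have y1 : 0 <= 1 - y.
  rewrite subr_ge0 leNgt; apply/negP => y1; have : 0 <= d * y by rewrite mulr_ge0.
  by nra.
apply: (@le_trans _ _ ((1 - y) * (1 + (1 + d) * y))); first by nra.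
by rewrite ler_wpM2l.
Qed.

Lemma exprn_onem_le (R : realType) (y : R) n : 0 <= y <= 1 -> (1 - y) ^+ n <= expR (- (n%:R * y)).
Proof.
move=> /andP[y0 y1]; rewrite -mulrN expRM_natl.
by rewrite lerXn2r ?nnegrE ?subr_ge0 ?expR_ge0 ?expR_ge1Dx.
Qed.

Lemma exprn_onem_ge (R : realType) (d y : R) n : 0 <= d -> 0 <= y -> (1 + d) * y <= d ->
  expR (- (n%:R * ((1 + d) * y))) <= (1 - y) ^+ n.
Proof.
move=> d0 y0 yd; have H := expR_le_subr d0 y0 yd.
rewrite -mulrN expRM_natl lerXn2r ?nnegrE ?expR_ge0 //.
exact: le_trans (expR_ge0 _) H.
Qed.

Lemma bernoulli_ge (R : realFieldType) (x : R) n : 0 <= x <= 1 -> 1 - n%:R * x <= (1 - x) ^+ n.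
Proof.
move=> /andP[x0 x1]; elim: n => [|n IH]; first by rewrite mul0r subr0 expr0.
rewrite exprS; apply: (@le_trans _ _ ((1 - x) * (1 - n%:R * x))); last first.
  by rewrite ler_wpM2l // subr_ge0.
rewrite -natr1; have : 0 <= n%:R :> R by []. 
move: (n%:R) => m m0; nra.
Qed.

(** Error budget of one step. Touching and bad edges contribute [2 * L ^+ k] each and the deficit of
    good free edges contributes 3, all times the number of traces; [k%:R * L] pays for the [k - 1]
    factors [1 + lam], and [2 * L] makes [2 * lam <= d]. *)
Definition step_cst (R : realFieldType) (k : nat) (L : R) (K : nat) : R := (2 ^ K)%:R * (4 * L ^+ k + 3) + k%:R * L + 2 * L.

Lemma step_cst_ge0 (R : realFieldType) k (L : R) K : 1 <= L -> 0 <= step_cst k L K.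
Proof.
move=> L1; have L0 : 0 <= L by apply: le_trans L1.
by rewrite /step_cst !addr_ge0 ?mulr_ge0 ?addr_ge0 ?mulr_ge0 ?exprn_ge0.
Qed.

Lemma step_cst_mono (R : realFieldType) k (L : R) K K' : 1 <= L -> (K <= K')%N ->
  step_cst k L K <= step_cst k L K'.
Proof.
move=> L1 KK'; have L0 : 0 <= L by apply: le_trans L1.
rewrite /step_cst !lerD2r ler_wpM2r ?addr_ge0 ?mulr_ge0 ?exprn_ge0 //.
by rewrite ler_nat leq_exp2l.
Qed.

(** The number of good free edges times [tau ^+ k.-1] is nearly 1, so the product over these edges
    is nearly an exponential; [d] absorbs all errors. The step map is decreasing, hence the old
    upper bound feeds the new lower one and vice versa. *)
Lemma ratio_bound_exp (R : realType) (N k : nat) (eps tau L q : R) (E : {set {set 'I_N}})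
    (l : R) K a b d :
  (2 <= k)%N -> 1 <= L -> 0 <= q -> q <= 1 -> tree_like k eps tau E -> 0 < l -> l <= L ->
  0 <= a <= 1 -> 0 <= b <= 1 -> 0 < d <= 1 ->
  eps * step_cst k L K <= d ->
  ratio_bound (l * tau) q E (K + k) a b ->
  ratio_bound (l * tau) q E K
    (expR (- (d + (1 + d) * ((1 - q) * l ^+ k.-1 * b ^+ k.-1))))
    (expR (- ((1 - d) * ((1 - q) * l ^+ k.-1 * a ^+ k.-1)))).
Proof.
move=> k2 L1 q0 q1 HE l0 lL /andP[a0 a1] /andP[b0 b1] /andP[d0 d1] Heps IH D T u DE DT TK uT indep.
have [kE /andP[tau0 tau_le] _ _ _] := HE.
have eps0 : 0 < eps by apply: lt_le_trans tau_le.
have L0 : 0 < L by apply: lt_le_trans L1.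
set P : R := (2 ^ K)%:R.
have P1 : 1 <= P by rewrite /P (ler_nat _ 1) expn_gt0.
have KP : K%:R <= P by rewrite /P ler_nat ltnW // ltn_expl.
have Lk1 : 1 <= L ^+ k by rewrite exprn_ege1.
have c01 : 0 <= 1 - q <= 1 by rewrite subr_ge0 q1 gerBl.
have /andP[c0 c1] := c01.
have HC1 : eps * (P * (4 * L ^+ k)) + eps * (3 * P) + eps * (k%:R * L) + eps * (2 * L) <= d.
  by apply: le_trans Heps; rewrite /step_cst -/P; clear -L; lra.
have h1 : 0 <= eps * (P * (4 * L ^+ k)) by rewrite !mulr_ge0 ?exprn_ge0 // ltW.
have h2 : 0 <= eps * (3 * P) by rewrite !mulr_ge0 // ltW.
have h3 : 0 <= eps * (k%:R * L) by rewrite !mulr_ge0 // ltW.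
have h4 : 0 <= eps * (2 * L) by rewrite !mulr_ge0 // ltW.
have eps1 : eps <= 1.
  apply: (@le_trans _ _ (eps * (2 * L))); last by apply: le_trans d1; clear -HC1 h1 h2 h3; lra.
  rewrite ler_peMr //; first exact: ltW.
  by apply: (le_trans L1); clear -L0; lra.
set lam := l * tau in IH *.
have lam0 : 0 < lam by rewrite mulr_gt0.
have lam_le : lam <= L * eps by rewrite ler_pM // ltW.
have lam1 : lam <= 1 by apply: (le_trans lam_le); clear -HC1 h1 h2 h3 h4 d1; lra.
have /andP[LB UB] := ratio_bound_step lam0 lam1 q0 q1 kE a0 b0 b1 IH DE DT TK uT indep a1.
have W0 : 0 <= Zc lam q (avoid D u) (u |: T) by apply: Zc_ge0.
have tk : 0 < tau ^+ k.-1 by rewrite exprn_gt0.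
have T2 : (2 ^ #|T|)%:R <= P by rewrite /P ler_nat leq_exp2l.
have TKr : #|T|%:R <= P by apply: le_trans KP; rewrite ler_nat.
have Fge := card_free_star k2 eps1 HE uT.
have Fle := card_free_star_le HE T u.
have Bcard : #|bad_star E T u|%:R * tau ^+ k.-1 <= P * eps.
  by apply: le_trans (card_bad_star eps1 HE uT) _; rewrite ler_wpM2r // ltW.
have lamL : 0 <= lam <= L * tau by rewrite ltW //= ler_wpM2r // ltW.
have xi_le : \sum_(e in touching E T u) lam ^+ #|e :\: (u |: T)| <= P * (L ^+ k * eps).
  apply: le_trans (sum_touching HE uT L1 lamL) _.
  by rewrite ler_wpM2r // mulr_ge0 ?exprn_ge0 // ltW.
set xi := \sum_(e in _) _ in LB xi_le.
have xi0 : 0 <= xi by apply: sumr_ge0 => e _; rewrite exprn_ge0 // ltW.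
set n := #|free_star E T u :\: bad_star E T u| in LB UB.
set nb := #|bad_star E T u| in LB Bcard.
have sBF : bad_star E T u \subset free_star E T u by apply/fintype.subsetP => e; rewrite inE => /andP[].
have En : #|free_star E T u|%:R = n%:R + nb%:R :> R.
  by rewrite -(cardsID (bad_star E T u) (free_star E T u)) (finset.setIidPr sBF) addnC natrD.
rewrite En in Fge Fle.
have n_ge : 1 - eps * (3 * P) <= n%:R * tau ^+ k.-1.
  rewrite mulrDl in Fge.
  have A : #|T|%:R * eps <= P * eps by rewrite ler_wpM2r // ltW.
  have B : eps <= eps * P by rewrite ler_peMr // ltW.
  by clear -A B Fge Bcard; lra.
have n_le : n%:R * tau ^+ k.-1 <= 1.
  by apply: le_trans Fle; rewrite ler_wpM2r ?(ltW tk) // lerDl.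
have lk0 : 0 <= l ^+ k.-1 by rewrite exprn_ge0 // ltW.
have lk_le : l ^+ k.-1 <= L ^+ k.
  apply: (@le_trans _ _ (L ^+ k.-1)); first by rewrite lerXn2r // nnegrE ltW.
  by rewrite ler_weXn2l // leq_pred.
have lamk : lam ^+ k.-1 = l ^+ k.-1 * tau ^+ k.-1 by rewrite exprMn.
have lamk0 : 0 <= lam ^+ k.-1 by rewrite exprn_ge0 // ltW.
have lamk_le : lam ^+ k.-1 <= lam.
  by rewrite -[X in _ <= X]expr1 ler_wiXn2l // ?ltW //; case: (k) k2 => [|[]].
have small y : 0 <= y <= 1 -> (1 + d) * ((1 - q) * (lam * y) ^+ k.-1) <= d.
  move=> /andP[y0 y1].
  apply: (@le_trans _ _ (2 * lam)); last by apply: le_trans HC1; clear -lam_le h1 h2 h3; lra.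
  have X0 : 0 <= (1 - q) * (lam * y) ^+ k.-1 by rewrite mulr_ge0 // exprn_ge0 // mulr_ge0 // ltW.
  apply: ler_pM => //; [clear -d0; lra|clear -d1; lra|].
  apply: le_trans lamk_le; rewrite exprMn.
  by rewrite mulrCA ler_piMr // mulr_ile1 ?exprn_ge0 ?exprn_ile1.
apply/andP; split.
- apply: le_trans LB; rewrite ler_wpM2r //.
  have E1 : expR (- ((1 + 1) * xi)) <= 1 - (1 - q) * xi.
    apply: (@le_trans _ _ (1 - xi)); last by rewrite lerB // ler_piMl.
    by apply: expR_le_subr => //; clear -xi_le HC1 h1 h2 h3 h4 d1; lra.
  have E2 := exprn_onem_ge n (ltW d0) (mulr_ge0 c0 _) (small b _).
  have E3 := exprn_onem_ge nb (ltW d0) (mulr_ge0 c0 _) (small 1 _).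
  rewrite mulr1 in E3.
  apply: (@le_trans _ _ (expR (- ((1 + 1) * xi)) *
     (expR (- (n%:R * ((1 + d) * ((1 - q) * (lam * b) ^+ k.-1)))) *
      expR (- (nb%:R * ((1 + d) * ((1 - q) * lam ^+ k.-1))))))); last first.
    apply: ler_pM; rewrite ?mulr_ge0 ?expR_ge0 //.
    apply: ler_pM; rewrite ?mulr_ge0 ?expR_ge0 //.
      by apply: E2; rewrite ?b0 ?b1 // exprn_ge0 // mulr_ge0 // ltW.
    by apply: E3; rewrite ?ler01 ?lexx.
  rewrite -!expRD ler_expR.
  have H1 : n%:R * ((1 - q) * (lam * b) ^+ k.-1) <= (1 - q) * l ^+ k.-1 * b ^+ k.-1.
    rewrite exprMn lamk.
    rewrite (_ : n%:R * _ = (n%:R * tau ^+ k.-1) * ((1 - q) * l ^+ k.-1 * b ^+ k.-1)); last by ring.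
    by rewrite ler_piMl // !mulr_ge0 // exprn_ge0.
  have H2 : nb%:R * ((1 - q) * lam ^+ k.-1) <= P * eps * L ^+ k.
    rewrite lamk (_ : nb%:R * _ = (1 - q) * ((nb%:R * tau ^+ k.-1) * l ^+ k.-1)); last by ring.
    rewrite -[X in _ <= X]mul1r; apply: ler_pM => //.
      by rewrite !mulr_ge0 // ltW.
    by apply: ler_pM => //; rewrite mulr_ge0 // ltW.
  have X0 : 0 <= nb%:R * ((1 - q) * lam ^+ k.-1) by rewrite !mulr_ge0.
  have X1 : 0 <= P * eps * L ^+ k by rewrite !mulr_ge0 ?exprn_ge0 // ltW.
  have H3 : (1 + d) * (nb%:R * ((1 - q) * lam ^+ k.-1)) <= 2 * (P * eps * L ^+ k).
    by apply: ler_pM => //; clear -d0 d1; lra.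
  have H4 : (1 + d) * (n%:R * ((1 - q) * (lam * b) ^+ k.-1)) <= (1 + d) * ((1 - q) * l ^+ k.-1 * b ^+ k.-1).
    by rewrite ler_wpM2l //; clear -d0; lra.
  rewrite (mulrCA n%:R) (mulrCA nb%:R); clear -H3 H4 xi_le HC1 h2 h3 h4; lra.
- apply: le_trans UB _; rewrite ler_wpM2r //.
  have l1 : 0 < 1 + lam by rewrite ltr_wpDr // ltW.
  have la0 : 0 <= lam * a / (1 + lam) by rewrite divr_ge0 ?(ltW l1) // mulr_ge0 // ltW.
  have la1 : lam * a / (1 + lam) <= 1.
    by rewrite ler_pdivrMr // mul1r (@le_trans _ _ lam) ?lerDr // ler_piMr // ltW.
  apply: le_trans (exprn_onem_le n _) _.
    by rewrite mulr_ge0 ?exprn_ge0 //= mulr_ile1 ?exprn_ge0 ?exprn_ile1.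
  rewrite ler_expR lerN2.
  have V : 1 - k%:R * lam <= ((1 + lam)^-1) ^+ k.-1.
    have V1 : 1 - lam <= (1 + lam)^-1.
      by rewrite -[X in _ <= X]mul1r ler_pdivlMr //; clear -lam lam0 lam1; nra.
    apply: (@le_trans _ _ ((1 - lam) ^+ k.-1)).
      apply: le_trans (bernoulli_ge _ _); last by rewrite (ltW lam0).
      by rewrite lerB // ler_wpM2r ?(ltW lam0) // ler_nat leq_pred.
    by rewrite lerXn2r // nnegrE ?subr_ge0 // invr_ge0 ltW.
  rewrite [(lam * a / _) ^+ _]exprMn [(lam * a) ^+ _]exprMn lamk.
  set z := (1 - q) * l ^+ k.-1 * a ^+ k.-1.
  have z0 : 0 <= z by rewrite !mulr_ge0 // exprn_ge0.
  rewrite (_ : n%:R * _ = (n%:R * tau ^+ k.-1) * ((1 + lam)^-1 ^+ k.-1) * z); last by rewrite /z; ring.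
  rewrite ler_wpM2r //.
  set v := _ ^+ k.-1 in V *.
  have v1 : v <= 1 by rewrite exprn_ile1 // ?invr_ge0 ?invf_le1 ?lerDl ?(ltW l1) ?(ltW lam0).
  have v0 : 0 <= v by rewrite exprn_ge0 // invr_ge0 ltW.
  set w := n%:R * _ in n_ge n_le *.
  have klam : k%:R * lam <= eps * (k%:R * L) by rewrite (mulrCA eps) (mulrC eps) ler_wpM2l.
  have w0 : 0 <= w by rewrite mulr_ge0 // ltW.
  clear -n_ge n_le V v1 v0 klam w0 HC1 h1 h2 h3 h4; nra.
Qed.

(** * Contraction of the recursion *)

Lemma is_derive_ler (R : realType) (f df : R -> R) (a b : R) : a <= b ->
  (forall x, a <= x <= b -> is_derive x (1 : R) f (df x)) ->
  (forall x, a < x < b -> 0 <= df x) -> f a <= f b.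
Proof.
rewrite le_eqVlt => /predU1P[-> //|ab] fdf df0.
have cont : {within `[a, b]%classic, continuous f}%classic.
  apply: derivable_within_continuous => x; rewrite in_itv /= => xab.
  by have [] := fdf x xab.
have [|c] := MVT ab _ cont (df := df).
  by move=> x; rewrite in_itv /= => /andP[ax xb]; apply: fdf; rewrite !ltW.
rewrite in_itv /= => cab E; rewrite -subr_ge0 E mulr_ge0 ?subr_ge0 ?(ltW ab) //.
exact: df0.
Qed.

(** Derivative behind exp(x - x^2/2) <= 1 + x, which gives the map
    y -> s exp((s^2 - y^2)/2) the exact one-sided Lipschitz constant s at its
    fixed point s. *)
Lemma is_derive_onepx_expR (R : realType) (x : R) :
  is_derive x (1 : R) (fun x : R => (1 + x) * expR (x ^+ 2 / 2 - x)) (expR (x ^+ 2 / 2 - x) * x ^+ 2).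
Proof.
have H : is_derive x (1:R) (fun x : R => x ^+ 2 / 2 - x) (x - 1).
  rewrite (_ : (fun x : R => _) = ((2^-1) \*: ((@id R) ^+ 2) - id)); last first.
    by apply/funext => y /=; rewrite /GRing.scale /= mulrC !fctE.
  apply: is_derive_eq; rewrite /GRing.scale /= expr1; by field.
rewrite [X in is_derive _ _ X _](_ : _ = (cst 1 + id) * (expR \o (fun x : R => x ^+ 2 / 2 - x))); last first.
  by apply/funext => y; rewrite !fctE.
apply: is_derive_eq; rewrite /GRing.scale /= !fctE /=.
ring.
Qed.

Lemma expR_sub_sqr_le (R : realType) (x : R) : 0 <= x -> expR (x - x ^+ 2 / 2) <= 1 + x.
Proof.
move=> x0; have := @is_derive_ler R _ _ 0 x x0 (fun y _ => is_derive_onepx_expR y).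
rewrite /= addr0 expr0n /= mul0r subrr expR0 mulr1 => H.
rewrite -opprB expRN -[X in X <= _]mul1r ler_pdivrMr ?expR_gt0 //.
by apply: H => y _; rewrite mulr_ge0 ?expR_ge0 // sqr_ge0.
Qed.

Lemma expR_sub_sqr_ge (R : realType) (x : R) : 0 <= x -> 1 - x <= expR (- x - x ^+ 2 / 2).
Proof.
move=> x0; have Nx0 : - x <= 0 by rewrite oppr_le0.
have := @is_derive_ler R _ _ (- x) 0 Nx0 (fun y _ => is_derive_onepx_expR y).
rewrite /= addr0 expr0n /= mul0r subrr expR0 mulr1 sqrrN opprK => H.
rewrite -opprD expRN -[X in _ <= X]mul1r ler_pdivlMr ?expR_gt0 // addrC [X in expR X]addrC addrC.
by apply: H => y _; rewrite mulr_ge0 ?expR_ge0 // sqr_ge0.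
Qed.

Section Contraction.
Variables (R : realType) (k : nat) (d s sm : R).
Hypotheses (k2 : (2 <= k)%N) (d01 : 0 < d <= 1) (s01 : 0 <= s <= sm) (sm1 : sm < 1).

Let g : R := s ^+ 2 * expR (s ^+ 2) / k.-1%:R.

(** In the coordinate s = sqrt((k-1) g' Q^(k-1)) the recursion becomes
    y -> s exp((s^2 - y^2)/2), which contracts for s < 1; d is the relative error
    committed at each step. *)
Fixpoint recursion_bounds (g' : R) (t : nat) : R * R :=
  if t is t'.+1 then
    let ab := recursion_bounds g' t' in
    (expR (- (d + (1 + d) * (g' * ab.2 ^+ k.-1))), expR (- ((1 - d) * (g' * ab.1 ^+ k.-1))))
  else (0, 1).

Lemma recursion_bounds01 g' t : 0 <= g' ->
  0 <= (recursion_bounds g' t).1 <= 1 /\ 0 <= (recursion_bounds g' t).2 <= 1.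
Proof.
move=> g0; elim: t => [|t [/andP[a0 a1] /andP[b0 b1]]] /=; first by rewrite !lexx ler01.
have /andP[d0 d1] := d01.
have h n (y : R) : 0 <= y -> 0 <= g' * y ^+ n by move=> y0; rewrite mulr_ge0 // exprn_ge0.
rewrite !expR_ge0 !expR_le1 !oppr_le0 /=; split.
  by rewrite addr_ge0 ?(ltW d0) // mulr_ge0 ?h // addr_ge0 // ltW.
by rewrite mulr_ge0 ?h // subr_ge0.
Qed.

(** Distance from [s] after [t] rounds, in the coordinate in which the recursion contracts. The
    multiple [k + 2] is a safe one: the additive [d] in the exponent costs at most [(k - 1) * d],
    the factor [1 + d] at most [2 * d]. *)
Fixpoint iter_radius (t : nat) : R := if t is t'.+1 then sm * iter_radius t' + k.+2%:R * d else 1.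

Lemma iter_radius_le t : k.+2%:R * d <= 1 - sm -> 0 <= iter_radius t <= 1.
Proof.
move=> H; have /andP[d0 _] := d01; have sm0 : 0 <= sm by have /andP[] := s01; apply: le_trans.
elim: t => [|t /andP[r0 r1]] /=; first by rewrite ler01 lexx.
rewrite addr_ge0 ?mulr_ge0 ?(ltW d0) //=.
have : sm * iter_radius t <= sm by rewrite ler_piMr.
by move: H; set w := _ * d; lra.
Qed.

Lemma iter_radius_bound t : iter_radius t <= sm ^+ t + k.+2%:R * d / (1 - sm).
Proof.
have sm0 : 0 <= sm by have /andP[] := s01; apply: le_trans.
have sm1' : 0 < 1 - sm by rewrite subr_gt0.
have /andP[d0 _] := d01.
elim: t => [|t IH] /=.
  by rewrite expr0 lerDl divr_ge0 ?mulr_ge0 // ltW.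
have := ler_wpM2l sm0 IH; rewrite mulrDr -exprS => H.
have -> : k.+2%:R * d / (1 - sm) = sm * (k.+2%:R * d / (1 - sm)) + k.+2%:R * d.
  by field; rewrite gt_eqF.
by rewrite addrA lerD2r.
Qed.

(** Only the outward deviation of each bound is tracked, as that is all the opposite bound needs in
    the next round. With [y = s - h] or [y = s + h], the exponent [(s^2 - y^2)/2] is [s h - h^2/2]
    or [- s h - h^2/2]; for [s <= 1] the exponential is then at most [1 + h], or at least [1 - h],
    and the prefactor [s] yields the contraction. *)
Lemma recursion_bounds_near t : k.+2%:R * d <= 1 - sm ->
  exists al be : R, [/\ 0 <= al, 0 <= be,
    g * (recursion_bounds g t).1 ^+ k.-1 = al ^+ 2 / k.-1%:R,
    g * (recursion_bounds g t).2 ^+ k.-1 = be ^+ 2 / k.-1%:R &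
    s - iter_radius t <= al /\ be <= s + iter_radius t].
Proof.
move=> Hd; have /andP[d0 d1] := d01; have /andP[s0 ssm] := s01.
have s1 : s <= 1 by rewrite (le_trans ssm) // ltW.
have K0 : 0 < k.-1%:R :> R by rewrite ltr0n; case: (k) k2 => [|[]].
have E2 (x : R) : expR x = expR (x / 2) ^+ 2 by rewrite -expRM_natl; congr expR; field.
have Ek (x : R) : expR x ^+ k.-1 = expR (k.-1%:R * x) by rewrite expRM_natl.
elim: t => [|t [al [be [al0 be0 Ea Eb [Ra Rb]]]]].
  (* The bound 1 corresponds to [s * expR (s ^+ 2 / 2)], which is at most [s * (1 + s)]; hence
     radius 1 is a valid start. *)
  exists 0, (s * expR (s ^+ 2 / 2)); split => //=.
  - by rewrite mulr_ge0 // expR_ge0.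
  - have -> : 0 ^+ k.-1 = 0 :> R by rewrite expr0n; case: (k) k2 => [|[]].
    by rewrite mulr0 expr0n /= mul0r.
  - by rewrite expr1n mulr1 /g exprMn -E2.
  split; first by lra.
  have H : expR (s ^+ 2 / 2) <= 1 + s.
    apply: le_trans (expR_sub_sqr_le s0); rewrite ler_expR; nra.
  have := ler_wpM2l s0 H; nra.
have /andP[r0 r1] := iter_radius_le t Hd.
set r := iter_radius t in Ra Rb r0 r1 *.
exists (s * expR ((s ^+ 2 - k.-1%:R * d - (1 + d) * be ^+ 2) / 2)), (s * expR ((s ^+ 2 - (1 - d) * al ^+ 2) / 2)).
rewrite /= -/r Ea Eb; split.
- by rewrite mulr_ge0 // expR_ge0.
- by rewrite mulr_ge0 // expR_ge0.
- rewrite Ek [(s * _) ^+ 2]exprMn -E2 /g mulrAC -[_ * expR _ * expR _]mulrA -expRD.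
  by congr (_ * expR _ / _); field; exact: lt0r_neq0.
- rewrite Ek [(s * _) ^+ 2]exprMn -E2 /g mulrAC -[_ * expR _ * expR _]mulrA -expRD.
  by congr (_ * expR _ / _); field; exact: lt0r_neq0.
split.
(* Chosen so that [s + eta = (1 + d) * (s + r)]: the relative error becomes a displacement of the
   argument. *)
- set eta := r + d * (s + r).
  have eta0 : 0 <= eta by rewrite addr_ge0 // mulr_ge0 ?addr_ge0 // ltW.
  have H1 : expR ((- eta - eta ^+ 2 / 2) + (- (k.-1%:R * d / 2))) <=
            expR ((s ^+ 2 - k.-1%:R * d - (1 + d) * be ^+ 2) / 2).
    rewrite ler_expR.
    have B2 : (1 + d) * be ^+ 2 <= (s + eta) ^+ 2.
      have -> : s + eta = (1 + d) * (s + r) by rewrite /eta; ring.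
      rewrite exprMn; apply: ler_pM; rewrite ?sqr_ge0 //; [lra | nra |].
      by rewrite lerXn2r // nnegrE addr_ge0.
    have : s * eta <= eta by rewrite ler_piMl.
    nra.
  have H2 := expR_sub_sqr_ge eta0.
  have H3 := expR_ge1Dx (- (k.-1%:R * d / 2)).
  rewrite expRD in H1.
  set w := k.-1%:R * d / 2 in H1 H3 *.
  have w0 : 0 <= w by rewrite /w divr_ge0 ?mulr_ge0 // ltW.
  have H4 : 1 - eta - w <= expR ((s ^+ 2 - k.-1%:R * d - (1 + d) * be ^+ 2) / 2).
    apply: le_trans H1.
    have [E0 E1] := (expR_ge0 (- eta - eta ^+ 2 / 2), expR_ge0 (- w)).
    have [h|h] := lerP 0 (1 - eta - w); last by rewrite (le_trans (ltW h)) // mulr_ge0.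
    apply: (@le_trans _ _ ((1 - eta) * (1 - w))); first by nra.
    by apply: ler_pM => //; lra.
  have := ler_wpM2l s0 H4; set X := s * expR _ => HX.
  apply: le_trans HX; rewrite mulrBr mulrBr mulr1.
  have K1 : k.+2%:R = k.-1%:R + 3 :> R.
    by rewrite -natrD; congr (_%:R); case: (k) k2 => // k' _; rewrite addn3.
  have h1 : s * r <= sm * r by rewrite ler_wpM2r.
  have h2 : s * (d * (s + r)) <= 2 * d.
    apply: (@le_trans _ _ (d * (s + r))); last by nra.
    by rewrite ler_piMl // mulr_ge0 ?addr_ge0 // ltW.
  have h3 : s * w <= k.-1%:R * d.
    apply: (@le_trans _ _ w); first by rewrite ler_piMl.
    by rewrite /w; have : 0 <= k.-1%:R * d by [rewrite mulr_ge0 // ltW]; lra.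
  rewrite K1 /eta; nra.
(* Truncation at 0 covers the case [r > s], in which [s - r <= al] carries no information. *)
- set y := (1 - d) * Num.max (s - r) 0.
  have m0 : 0 <= Num.max (s - r) 0 by rewrite le_max lexx orbT.
  have mal : Num.max (s - r) 0 <= al by rewrite ge_max Ra al0.
  have ms : Num.max (s - r) 0 <= s by rewrite ge_max s0 gerBl r0.
  have mr : s - r <= Num.max (s - r) 0 by rewrite le_max lexx.
  set m := Num.max _ _ in y m0 mal ms mr *.
  have d1' : 0 <= 1 - d by lra.
  have y0 : 0 <= y by rewrite mulr_ge0.
  have ym : y <= m by rewrite ler_piMl //; lra.
  have ys : 0 <= s - y by lra.
  have H1 : expR ((s ^+ 2 - (1 - d) * al ^+ 2) / 2) <= 1 + (s - y).
    apply: le_trans (expR_sub_sqr_le ys); rewrite ler_expR.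
    have B2 : y ^+ 2 <= (1 - d) * al ^+ 2.
      rewrite /y exprMn; apply: ler_pM; rewrite ?sqr_ge0 //; first by nra.
      by rewrite lerXn2r // nnegrE.
    nra.
  have := ler_wpM2l s0 H1 => /le_trans; apply.
  have h1 : s - y <= r + d.
    have -> : s - y = s - m + d * m by rewrite /y; ring.
    have : d * m <= d by rewrite ler_piMr ?(ltW d0) //; lra.
    lra.
  have h2 : s * (s - y) <= sm * (r + d) by apply: ler_pM.
  have K1 : 1 <= k.+2%:R :> R by rewrite (ler_nat _ 1).
  have h3 : sm * d <= d by rewrite ler_piMl ?(ltW d0) ?(ltW sm1).
  have h4 : d <= k.+2%:R * d by rewrite ler_peMl ?(ltW d0).
  lra.
Qed.

(** These are the exponents of one further round, now compared with their value at the fixed point;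
    for [s ^+ 2 = (k - 1) (1 - q) x^(k-1)] that value is [- (1 - q) x^(k-1)]. *)
Lemma recursion_bounds_final t : k.+2%:R * d <= 1 - sm ->
  - (s ^+ 2 / k.-1%:R) - (3 * iter_radius t + 5 * d) <= - (d + (1 + d) * (g * (recursion_bounds g t).2 ^+ k.-1)) /\
  - ((1 - d) * (g * (recursion_bounds g t).1 ^+ k.-1)) <= - (s ^+ 2 / k.-1%:R) + (3 * iter_radius t + 5 * d).
Proof.
move=> Hd; have [al [be [al0 be0 Ea Eb [Ra Rb]]]] := recursion_bounds_near t Hd.
have /andP[r0 r1] := iter_radius_le t Hd.
have /andP[d0 d1] := d01; have /andP[s0 ssm] := s01.
have s1 : s <= 1 by rewrite (le_trans ssm) // ltW.
have K1 : 1 <= k.-1%:R :> R by rewrite (ler_nat _ 1); case: (k) k2 => [|[]].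
have K0 : 0 < k.-1%:R :> R by apply: lt_le_trans K1.
rewrite Ea Eb; set r := iter_radius t in Ra Rb r0 r1 *.
have I0 : 0 <= (k.-1%:R : R)^-1 by rewrite invr_ge0 ltW.
have I1 : (k.-1%:R : R)^-1 <= 1 by rewrite invf_le1.
set i := k.-1%:R^-1 in I0 I1 *.
split.
- have h1 : be ^+ 2 <= s ^+ 2 + 3 * r.
    apply: (@le_trans _ _ ((s + r) ^+ 2)); first by rewrite lerXn2r // nnegrE addr_ge0.
    nra.
  have h2 : be ^+ 2 * i <= s ^+ 2 * i + 3 * r.
    apply: (@le_trans _ _ ((s ^+ 2 + 3 * r) * i)); first by rewrite ler_wpM2r.
    by rewrite mulrDl lerD2l ler_piMr // mulr_ge0.
  have h3 : be ^+ 2 * i <= 4.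
    apply: (le_trans h2); have : s ^+ 2 * i <= 1 by rewrite mulr_ile1 ?sqr_ge0 // expr_le1.
    lra.
  nra.
- have h1 : s ^+ 2 - 2 * r <= al ^+ 2.
    have [h|h] := lerP 0 (s - r); last by have := sqr_ge0 al; nra.
    apply: (@le_trans _ _ ((s - r) ^+ 2)); first nra.
    by rewrite lerXn2r // nnegrE.
  have [h|h] := lerP 0 (s ^+ 2 - 2 * r); last first.
    have : 0 <= al ^+ 2 * i by rewrite mulr_ge0 // sqr_ge0.
    have : (s ^+ 2 - 2 * r) * i <= 0 by rewrite mulr_le0_ge0 // ltW.
    have : r * i <= r by rewrite ler_piMr.
    nra.
  have h2 : (s ^+ 2 - 2 * r) * i <= al ^+ 2 * i by rewrite ler_wpM2r.
  have h3 : r * i <= r by rewrite ler_piMr.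
  have h4 : (1 - d) * ((s ^+ 2 - 2 * r) * i) <= (1 - d) * (al ^+ 2 * i) by rewrite ler_wpM2l //; lra.
  have h5 : d * ((s ^+ 2 - 2 * r) * i) <= d.
    rewrite ler_piMr ?(ltW d0) // mulr_ile1 //.
    by have : s ^+ 2 <= 1 by [rewrite expr_le1]; lra.
  nra.
Qed.

End Contraction.

(** * Occupation ratios and mean size *)

Lemma tree_like_le (R : realFieldType) N k (eps eps' tau : R) (E : {set {set 'I_N}}) :
  eps <= eps' -> tree_like k eps tau E -> tree_like k eps' tau E.
Proof.
move=> ee [kE /andP[t0 te] H1 H2 H3]; split=> //.
- by rewrite t0 (le_trans te).
- by move=> l Hl; apply: le_trans (H1 l Hl) ee.
- exact: le_trans H2 ee.
- by move=> v; have /andP[h ->] := H3 v; rewrite andbT (le_trans _ h) // lerB.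
Qed.

(** Induction on the number of rounds with [K] general: each round calls the previous bounds with
    [k] more pinned vertices, so the trivial bracket is reached at [K + t * k]. *)
Lemma ratio_bound_iter (R : realType) (N k : nat) (eps tau L q : R) (E : {set {set 'I_N}})
    (l : R) d t K :
  (2 <= k)%N -> 1 <= L -> 0 <= q -> q <= 1 -> tree_like k eps tau E -> 0 < l -> l <= L ->
  0 < d <= 1 -> eps * step_cst k L (K + t * k) <= d -> l * tau <= 1 ->
  ratio_bound (l * tau) q E K (recursion_bounds k d ((1 - q) * l ^+ k.-1) t).1
                              (recursion_bounds k d ((1 - q) * l ^+ k.-1) t).2.
Proof.
move=> k2 L1 q0 q1 HE l0 lL d01 + lt1.
have [kE /andP[tau0 tau_le] _ _ _] := HE.
have eps0 : 0 <= eps by apply: ltW; apply: lt_le_trans tau_le.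
have g0 : 0 <= (1 - q) * l ^+ k.-1 by rewrite mulr_ge0 ?subr_ge0 // exprn_ge0 // ltW.
elim: t K => [|t IH] K Heps.
  by apply: ratio_bound01 => //; rewrite mulr_gt0.
have [ha hb] := recursion_bounds01 k d01 t g0.
apply: (ratio_bound_exp k2 L1 q0 q1 HE l0 lL ha hb d01).
  by apply: le_trans Heps; rewrite ler_wpM2l // step_cst_mono // leq_addr.
by apply: IH; rewrite -addnA -mulSn.
Qed.

Lemma exists_expr_le (R : realType) (x e : R) : 0 <= x < 1 -> 0 < e -> exists n, x ^+ n <= e.
Proof.
move=> /andP[x0 x1] e0.
have : `|x| < 1 by rewrite ger0_norm.
move=> /cvg_expr/cvgrPdist_le/(_ e e0)[n _ Hn]; exists n.
have := Hn n (leqnn n); rewrite /= sub0r normrN ger0_norm // exprn_ge0 //.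
Qed.

(** The activity, in units of tau, whose fixed-point density is x. *)
Definition fugacity (R : realType) (k : nat) (q x : R) : R := x * expR ((1 - q) * x ^+ k.-1).

(** One [eps] serves all densities up to [xm]: the contraction constant [S x] is largest at [xm],
    and [L] dominates all fugacities. It is chosen after [t] and [d], since [step_cst] grows with
    the number of rounds. *)
Lemma vertex_ratio (R : realType) (k : nat) (q xm e : R) :
  (2 <= k)%N -> 0 <= q -> q <= 1 -> 0 < xm -> k.-1%:R * (1 - q) * xm ^+ k.-1 < 1 -> 0 < e ->
  exists2 eps : R, 0 < eps & forall N (tau : R) (E : {set {set 'I_N}}), tree_like k eps tau E ->
   forall x, 0 < x <= xm -> forall u : 'I_N,
   let lam := fugacity k q x * tau in
   [/\ lam <= e,
     expR (- ((1 - q) * x ^+ k.-1) - e) * Zc lam q (avoid E u) [set u] <= Zc lam q E [set u] &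
     Zc lam q E [set u] <= expR (- ((1 - q) * x ^+ k.-1) + e) * Zc lam q (avoid E u) [set u]].
Proof.
move=> k2 q0 q1 xm0 Hx e0.
have K1 : 1 <= k.-1%:R :> R by rewrite (ler_nat _ 1); case: (k) k2 => [|[]].
have K0 : 0 < k.-1%:R :> R by apply: lt_le_trans K1.
have c0 : 0 <= 1 - q by rewrite subr_ge0.
pose S x := Num.sqrt (k.-1%:R * (1 - q) * x ^+ k.-1).
have S2 x : 0 <= x -> S x ^+ 2 = k.-1%:R * (1 - q) * x ^+ k.-1.
  by move=> x0; rewrite sqr_sqrtr // !mulr_ge0 // exprn_ge0.
have S0 x : 0 <= S x by rewrite sqrtr_ge0.
have Smono x : 0 <= x <= xm -> S x <= S xm.
  move=> /andP[x0 xxm]; rewrite ler_sqrt ?ler_wpM2l ?mulr_ge0 ?exprn_ge0 ?(ltW xm0) ?(ltW K0) //.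
  by rewrite lerXn2r // nnegrE ltW.
have Sm1 : S xm < 1.
  by rewrite -(@ltr_pXn2r _ 2) ?nnegrE // S2 ?expr1n // ltW.
set sm := S xm in Smono Sm1.
have sm0 : 0 <= sm by apply: S0.
pose e1 := Num.min 1 e.
have e10 : 0 < e1 by rewrite lt_min ltr01 e0.
have e11 : e1 <= 1 by rewrite ge_min lexx.
have e1e : e1 <= e by rewrite ge_min lexx orbT.
(* Final budget in units of [e1]: the radius is at most [1/12 + 1/12] and [d] at most [1/48], so
   three radii and [5 * d] stay below 1. *)
have [t Ht] : exists t, sm ^+ t <= e1 / 12.
  by apply: exists_expr_le; rewrite ?sm0 ?divr_gt0.
have k20 : 0 < k.+2%:R :> R by rewrite ltr0n.
pose d := (1 - sm) * e1 / (12 * k.+2%:R).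
have sm1' : 0 < 1 - sm by rewrite subr_gt0.
have d0 : 0 < d by rewrite divr_gt0 ?mulr_gt0.
have kd : k.+2%:R * d = (1 - sm) * e1 / 12 by rewrite /d; field; rewrite ?gt_eqF.
have kd1 : k.+2%:R * d <= 1 - sm by rewrite kd; clear -sm1' e10 e11; nra.
have kd2 : k.+2%:R * d / (1 - sm) = e1 / 12 by rewrite kd; field; rewrite ?gt_eqF.
have k4 : 4 <= k.+2%:R :> R by rewrite (ler_nat _ 4); case: (k) k2 => [|[]].
have d48 : 48 * d <= e1.
  have : 4 * d <= k.+2%:R * d by rewrite ler_wpM2r // ltW.
  rewrite kd; clear -sm1' e10 sm0; nra.
have d1 : d <= 1 by clear -d48 e11 d0; lra.
have d01 : 0 < d <= 1 by rewrite d0 d1.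
pose L := 1 + fugacity k q xm.
have f0 x : 0 <= x -> 0 <= fugacity k q x by move=> x0; rewrite mulr_ge0 ?expR_ge0.
have L1 : 1 <= L by rewrite lerDl f0 // ltW.
have L0 : 0 < L by apply: lt_le_trans L1.
have fL x : 0 <= x <= xm -> fugacity k q x <= L.
  move=> /andP[x0 xxm]; apply: (@le_trans _ _ (fugacity k q xm)); last by rewrite lerDr.
  apply: ler_pM; rewrite ?expR_ge0 // ler_expR ler_wpM2l // lerXn2r // nnegrE.
  exact: ltW.
have C0 := step_cst_ge0 k (t.+1 * k) L1.
pose eps := e1 * d / (L + step_cst k L (t.+1 * k)).
have D0 : 0 < L + step_cst k L (t.+1 * k) by rewrite ltr_wpDr.
exists eps; first by rewrite divr_gt0 // mulr_gt0.
move=> N tau E HE x /andP[x0 xxm] u lam.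
have x0' := ltW x0.
have [kE /andP[tau0 tau_le] _ _ _] := HE.
have HepsC : eps * step_cst k L (0 + t.+1 * k) <= d.
  rewrite add0n /eps mulrAC ler_pdivrMr //.
  rewrite (_ : e1 * d * step_cst k L (t.+1 * k) = d * (e1 * step_cst k L (t.+1 * k))); last first.
    by rewrite [e1 * d]mulrC -mulrA.
  rewrite ler_wpM2l ?(ltW d0) //.
  apply: (@le_trans _ _ (step_cst k L (t.+1 * k))); last by rewrite lerDr ltW.
  by rewrite ler_piMl.
have HepsL : eps * L <= e1.
  rewrite /eps mulrAC ler_pdivrMr // -mulrA; apply: ler_wpM2l; first exact: ltW.
  by apply: (@le_trans _ _ L); [rewrite ler_piMl // ltW | rewrite lerDl].
have xx : 0 <= x <= xm by rewrite ltW.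
have lam_le : lam <= e1.
  apply: le_trans HepsL; rewrite /lam mulrC; apply: ler_pM => //; [exact: ltW | exact: f0 | exact: fL].
have l0 : 0 < fugacity k q x by rewrite mulr_gt0 // expR_gt0.
have lam1 : lam <= 1 by apply: le_trans e11.
have RB := ratio_bound_iter k2 L1 q0 q1 HE l0 (fL x xx) d01 HepsC lam1.
have Eg : (1 - q) * fugacity k q x ^+ k.-1 = S x ^+ 2 * expR (S x ^+ 2) / k.-1%:R.
  rewrite S2 // exprMn -expRM_natl.
  rewrite (_ : k.-1%:R * ((1 - q) * x ^+ k.-1) = k.-1%:R * (1 - q) * x ^+ k.-1) ?mulrA //.
  by field; rewrite gt_eqF.
rewrite Eg in RB.
have s01 : 0 <= S x <= sm by rewrite S0 Smono.
have [F1 F2] := recursion_bounds_final k2 d01 s01 Sm1 t kd1.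
have Rr := iter_radius_bound k d01 s01 Sm1 t.
have Es : S x ^+ 2 / k.-1%:R = (1 - q) * x ^+ k.-1.
  by rewrite S2 //; field; rewrite gt_eqF.
rewrite Es in F1 F2; rewrite kd2 in Rr.
have Small : 3 * iter_radius k d sm t + 5 * d <= e.
  by clear -Rr Ht d48 e1e e10 d0; lra.
have uE : edges_in E (u |: set0) = 0%N.
  apply/eqP/edges_in0P => f /kE fk; apply/negP => /subset_leq_card.
  by rewrite setU0 cards1 fk leqNgt k2.
have uT : u \notin set0 by rewrite inE.
have T0 : (#|set0 : {set 'I_N}| <= 0)%N by rewrite cards0.
have /andP[B1 B2] := RB E set0 u (subxx E) (fun f fE _ => fE) T0 uT uE.
rewrite !setU0 in B1 B2.
have lam0 : 0 < lam by rewrite mulr_gt0.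
split; first by apply: le_trans e1e.
- apply: le_trans B1; rewrite ler_wpM2r ?Zc_ge0 //= ler_expR.
  by apply: le_trans F1; rewrite lerB.
- apply: le_trans B2 _; rewrite ler_wpM2r ?Zc_ge0 //= ler_expR.
  by apply: (le_trans F2); rewrite lerD2l.
Qed.

(** The fugacity times [exp (- (1 - q) x^(k-1))] is [x], so each vertex is occupied with probability
    close to [tau * x]. *)
Lemma mean_size (R : realType) (k : nat) (q xm e : R) :
  (2 <= k)%N -> 0 <= q -> q <= 1 -> 0 < xm -> k.-1%:R * (1 - q) * xm ^+ k.-1 < 1 -> 0 < e ->
  exists2 eps : R, 0 < eps & forall N (tau : R) (E : {set {set 'I_N}}), tree_like k eps tau E ->
   forall x lam, 0 < x <= xm -> lam = fugacity k q x * tau ->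
   (1 - e) * (N%:R * tau * x) * Zc lam q E set0 <= \sum_(u : 'I_N) Zc lam q E [set u]
     <= (1 + e) * (N%:R * tau * x) * Zc lam q E set0.
Proof.
move=> k2 q0 q1 xm0 Hx e0.
pose e1 := Num.min 1 e / 2.
have e10 : 0 < e1 by rewrite divr_gt0 // lt_min ltr01 e0.
have e11 : e1 <= 1 / 2 by rewrite ler_wpM2r // ge_min lexx.
have e1e : e1 <= e / 2 by rewrite ler_wpM2r // ge_min lexx orbT.
have [eps eps0 H] := vertex_ratio k2 q0 q1 xm0 Hx e10.
exists eps => // N tau E HE x lam xx Elam.
have [x0 xxm] := andP xx.
have [kE /andP[tau0 tau_le] _ _ _] := HE.
have l0 : 0 < fugacity k q x by rewrite mulr_gt0 // expR_gt0.
have lam0 : 0 < lam by rewrite Elam mulr_gt0.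
have Z0 : 0 <= Zc lam q E set0 by apply: Zc_ge0.
have tx0 : 0 <= tau * x by rewrite mulr_ge0 // ltW.
have U u : (1 - e) * (tau * x) * Zc lam q E set0 <= Zc lam q E [set u] <= (1 + e) * (tau * x) * Zc lam q E set0.
  have [Hl Ha Hb] := H N tau E HE x xx u.
  have uT : u \notin (set0 : {set 'I_N}) by rewrite inE.
  rewrite /= -Elam in Hl Ha Hb.
  rewrite -{1}[[set u]]setU0 in Ha; rewrite -{2}[[set u]]setU0 in Ha.
  rewrite -{1}[[set u]]setU0 in Hb; rewrite -{2}[[set u]]setU0 in Hb.
  have B1 := Zc_pin_lb lam0 q0 q1 uT (expR_ge0 _) Ha.
  have B2 := Zc_pin_ub lam0 q0 uT Hb (expR_ge0 _).
  rewrite setU0 in B1 B2.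
  have El s : lam * expR (- ((1 - q) * x ^+ k.-1) + s) = tau * x * expR s.
    rewrite Elam /fugacity expRD expRN; set v := expR _; have v0 : 0 < v by apply: expR_gt0.
    by field; rewrite gt_eqF.
  rewrite !El in B1 B2.
  have [h1 h2] : 1 - e1 <= expR (- e1) /\ expR e1 <= 1 + 2 * e1.
    split; first exact: expR_ge1Dx.
    have h := expR_ge1Dx (- e1); rewrite expRN in h.
    have v0 := expR_gt0 e1; set v := expR e1 in h v0 *.
    have : (1 - e1) * v <= 1 by rewrite -ler_pdivlMr // mul1r.
    clear -e10 e11 v0; nra.
  have l1 : 0 < 1 + lam by rewrite ltr_wpDr // ltW.
  have h3 : 1 - lam <= (1 + lam)^-1.
    by rewrite -[X in _ <= X]mul1r ler_pdivlMr //; clear -lam0; nra.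
  apply/andP; split.
    apply: le_trans B1; rewrite ler_wpM2r //.
    rewrite (_ : tau * x * _ / _ = expR (- e1) / (1 + lam) * (tau * x)); last by ring.
    rewrite ler_wpM2r //.
    apply: (@le_trans _ _ ((1 - e1) * (1 - lam))); first by clear -e1e Hl e10 lam0; nra.
    by apply: ler_pM => //; clear -e11 Hl; lra.
  apply: (le_trans B2); rewrite ler_wpM2r // [X in X <= _]mulrC ler_wpM2r //.
  by apply: (le_trans h2); clear -e1e; lra.
have EN (y : R) : y * (N%:R * tau * x) * Zc lam q E set0 = \sum_(u : 'I_N) (y * (tau * x) * Zc lam q E set0).
  by rewrite sumr_const card_ord -mulr_natl; ring.
rewrite !EN; apply/andP; split; apply: ler_sum => u _; by have /andP[] := U u.
Qed.

Lemma sum_Zc_pin (R : realFieldType) N (lam q : R) (E : {set {set 'I_N}}) :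
  \sum_(u : 'I_N) Zc lam q E [set u] = \sum_(S : {set 'I_N}) #|S|%:R * (lam ^+ #|S| * q ^+ edges_in E S).
Proof.
rewrite /Zc (exchange_big_dep predT) //=; apply: eq_bigr => S _.
rewrite (eq_bigl (fun u => u \in S)); last by move=> u; rewrite sub1set.
by rewrite sumr_const mulr_natl.
Qed.

(** * The log-partition function *)

Lemma Zc_set0E (R : realFieldType) N (lam q : R) (E : {set {set 'I_N}}) :
  Zc lam q E set0 = \sum_(S : {set 'I_N}) lam ^+ #|S| * q ^+ edges_in E S.
Proof. by rewrite /Zc; apply: eq_bigl => S; rewrite sub0set. Qed.

Definition Zpoly (R : realFieldType) N (q : R) (E : {set {set 'I_N}}) : {poly R} :=
  \sum_(S : {set 'I_N}) q ^+ edges_in E S *: 'X^#|S|.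

Lemma Zpoly_horner (R : realFieldType) N (lam q : R) (E : {set {set 'I_N}}) :
  (Zpoly q E).[lam] = Zc lam q E set0.
Proof.
rewrite Zc_set0E horner_sum; apply: eq_bigr => S _.
by rewrite hornerZ hornerXn mulrC.
Qed.

Lemma Zpoly_deriv (R : realFieldType) N (lam q : R) (E : {set {set 'I_N}}) :
  lam * ((Zpoly q E)^`()).[lam] = \sum_(u : 'I_N) Zc lam q E [set u].
Proof.
rewrite sum_Zc_pin raddf_sum horner_sum mulr_sumr; apply: eq_bigr => S _.
rewrite /= derivZ derivXn hornerZ hornerMn hornerXn.
case: #|S| => [|n]; first by rewrite !mulr0n mulr0 mulr0 mul0r.
rewrite /= -mulr_natl exprS; move: (q ^+ _) (lam ^+ n) (n.+1%:R) => w v z.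
by ring.
Qed.

(** Antiderivative, vanishing at 0, of [x] times the logarithmic derivative of the fugacity. Since
    [lam * d(ln Z)/d(lam)] is the mean size, about [N tau x], this is the limit of
    [ln Z / (N tau)]. *)
Definition free_energy (R : realType) k (q x : R) : R :=
  x + (1 - q) * k.-1%:R * x ^+ k / k%:R.

Lemma is_derive_free_energy (R : realType) k (q x : R) : (1 <= k)%N ->
  is_derive x (1 : R) (free_energy k q) (1 + (1 - q) * k.-1%:R * x ^+ k.-1).
Proof.
move=> k1; have kn : k%:R != 0 :> R by rewrite pnatr_eq0 -lt0n.
have -> : free_energy k q = (id + ((1 - q) * k.-1%:R / k%:R) \*: (@id R) ^+ k).
  by apply/funext => y; rewrite !fctE /= /GRing.scale /= /free_energy; field.
by apply: is_derive_eq; rewrite /GRing.scale /=; field.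
Qed.

Lemma is_derive_fugacity (R : realType) k (q x : R) : (2 <= k)%N ->
  is_derive x (1 : R) (fugacity k q)
    (expR ((1 - q) * x ^+ k.-1) * (1 + (1 - q) * k.-1%:R * x ^+ k.-1)).
Proof.
move=> k2.
have -> : fugacity k q = (@id R) * (expR \o ((1 - q) \*: (@id R) ^+ k.-1)).
  by apply/funext => y; rewrite !fctE /= /GRing.scale /=.
apply: is_derive_eq; rewrite !fctE /= /GRing.scale /=.
have -> : x ^+ k.-1 = x * x ^+ k.-2 by rewrite -exprS; case: (k) k2 => [|[]].
ring.
Qed.

Lemma is_derive_ln_Z (R : realType) N k (q tau x : R) (E : {set {set 'I_N}}) :
  (2 <= k)%N -> 0 < Zc (fugacity k q x * tau) q E set0 ->
  is_derive x (1 : R) (fun y => ln (Zc (fugacity k q y * tau) q E set0))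
    ((Zc (fugacity k q x * tau) q E set0)^-1 * (((Zpoly q E)^`()).[fugacity k q x * tau] *
      (tau * (expR ((1 - q) * x ^+ k.-1) * (1 + (1 - q) * k.-1%:R * x ^+ k.-1))))).
Proof.
move=> k2 Z0; have Hf := is_derive_fugacity q x k2.
have -> : (fun y => ln (Zc (fugacity k q y * tau) q E set0)) =
   (@ln R) \o (horner (Zpoly q E) \o (tau \*: fugacity k q)).
  by apply/funext => y /=; rewrite Zpoly_horner /GRing.scale /= mulrC.
have HZ : is_derive x (1 : R) (horner (Zpoly q E) \o (tau \*: fugacity k q))
   (((Zpoly q E)^`()).[fugacity k q x * tau] *
      (tau * (expR ((1 - q) * x ^+ k.-1) * (1 + (1 - q) * k.-1%:R * x ^+ k.-1)))).
  have H1 := is_deriveZ tau Hf.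
  have H2 := is_derive_poly (Zpoly q E) ((tau \*: fugacity k q) x).
  have := is_derive1_comp H2 H1.
  by rewrite /= /GRing.scale /= [tau * fugacity _ _ _]mulrC.
have EZ : (horner (Zpoly q E) \o (tau \*: fugacity k q)) x = Zc (fugacity k q x * tau) q E set0.
  by rewrite /= Zpoly_horner /GRing.scale /= mulrC.
rewrite -EZ in Z0 *.
exact: is_derive1_comp (is_derive1_ln Z0) HZ.
Qed.

(** Both [ln Z] and the free energy vanish at [x = 0], and by [mean_size] their derivatives in [x]
    agree, after scaling by [N tau], up to a factor between [1 - e] and [1 + e]; monotonicity of the
    differences concludes. *)
Lemma ln_Z_near (R : realType) (k : nat) (q xm e : R) :
  (2 <= k)%N -> 0 <= q -> q <= 1 -> 0 < xm -> k.-1%:R * (1 - q) * xm ^+ k.-1 < 1 -> 0 < e ->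
  exists2 eps : R, 0 < eps & forall N (tau : R) (E : {set {set 'I_N}}), tree_like k eps tau E ->
   forall x, 0 < x <= xm ->
   (1 - e) * (N%:R * tau * free_energy k q x) <= ln (Zc (fugacity k q x * tau) q E set0)
     <= (1 + e) * (N%:R * tau * free_energy k q x).
Proof.
move=> k2 q0 q1 xm0 Hx e0.
have [eps eps0 H] := mean_size k2 q0 q1 xm0 Hx e0.
exists eps => // N tau E HE x /andP[x0 xxm].
have [kE /andP[tau0 tau_le] _ _ _] := HE.
have c0 : 0 <= 1 - q by rewrite subr_ge0.
have x0' := ltW x0.
have Z0 y : 0 <= y -> 0 < Zc (fugacity k q y * tau) q E set0.
  move=> y0; rewrite Zc_set0E (bigD1 set0) //= cards0 expr0 mul1r.
  have -> : edges_in E set0 = 0%N.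
    apply/eqP/edges_in0P => f /kE fk; apply/negP => /subset_leq_card.
    by rewrite cards0 fk leqNgt (ltnW k2).
  rewrite expr0 ltr_wpDr // sumr_ge0 // => S _.
  by rewrite mulr_ge0 ?exprn_ge0 // !mulr_ge0 ?expR_ge0 // ltW.
pose F y : R := N%:R * tau * free_energy k q y.
pose f y := ln (Zc (fugacity k q y * tau) q E set0).
pose D y : R := (Zc (fugacity k q y * tau) q E set0)^-1 * (((Zpoly q E)^`()).[fugacity k q y * tau] *
      (tau * (expR ((1 - q) * y ^+ k.-1) * (1 + (1 - q) * k.-1%:R * y ^+ k.-1)))).
pose W y : R := 1 + (1 - q) * k.-1%:R * y ^+ k.-1.
have f0 : f 0 = 0.
  rewrite /f /fugacity !mul0r Zc_set0E (bigD1 set0) //= big1 => [|S]; last first.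
    by rewrite -cards_eq0 => /negbTE S0; rewrite expr0n S0 mul0r.
  rewrite cards0 expr0 mul1r.
  have -> : edges_in E set0 = 0%N.
    apply/eqP/edges_in0P => g /kE gk; apply/negP => /subset_leq_card.
    by rewrite cards0 gk leqNgt (ltnW k2).
  by rewrite expr0 addr0 ln1.
have F0 : F 0 = 0.
  by rewrite /F /free_energy expr0n; case: (k) k2 => // k' _; rewrite /= mulr0 mul0r addr0 mulr0.
have dF (y : R) : is_derive y (1 : R) F (N%:R * tau * W y).
  have -> : F = (N%:R * tau) \*: free_energy k q by apply/funext => z.
  have Hd := is_derive_free_energy q y (ltnW k2).
  by have := is_deriveZ (N%:R * tau) Hd.
have df (y : R) : 0 <= y -> is_derive y (1 : R) f (D y).
  by move=> y0; apply: is_derive_ln_Z => //; exact: Z0.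
have Dbound (y : R) : 0 < y < x -> (1 - e) * (N%:R * tau * W y) <= D y <= (1 + e) * (N%:R * tau * W y).
  move=> /andP[y0 yx]; have yxm : 0 < y <= xm by rewrite y0 (le_trans (ltW yx)).
  have := H N tau E HE y _ yxm erefl; rewrite -Zpoly_deriv.
  have Zy := Z0 y (ltW y0).
  have W0 : 0 <= W y by rewrite addr_ge0 // !mulr_ge0 ?exprn_ge0 // ltW.
  have ED : D y = (Zc (fugacity k q y * tau) q E set0)^-1 * W y / y *
       (fugacity k q y * tau * (Zpoly q E)^`().[fugacity k q y * tau]).
    by rewrite /D /W /fugacity; field; rewrite !gt_eqF.
  rewrite ED; set Z := Zc _ _ _ _ in Zy *; set P := _.[_].
  have G0 : 0 <= Z^-1 * W y / y by rewrite !mulr_ge0 // ?invr_ge0 ltW.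
  move=> /andP[/(ler_wpM2l G0) A /(ler_wpM2l G0) B]; apply/andP; split.
    by apply: le_trans A; rewrite le_eqVlt; apply/orP; left; apply/eqP; field; rewrite !gt_eqF.
  by apply: (le_trans B); rewrite le_eqVlt; apply/orP; left; apply/eqP; field; rewrite !gt_eqF.
apply/andP; split.
- have := @is_derive_ler R (fun y => f y - (1 - e) * F y) (fun y => D y - (1 - e) * (N%:R * tau * W y)) 0 x x0'.
  rewrite f0 F0 mulr0 subr0 subr_ge0; apply.
    move=> y /andP[y0 _]; have d1 := df y y0; have d2 := is_deriveZ (1 - e) (dF y).
    exact: is_deriveB d1 d2.
  by move=> y yx; rewrite subr_ge0; have /andP[] := Dbound y yx.
- have := @is_derive_ler R (fun y => (1 + e) * F y - f y) (fun y => (1 + e) * (N%:R * tau * W y) - D y) 0 x x0'.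
  rewrite f0 F0 mulr0 subr0 subr_ge0; apply.
    move=> y /andP[y0 _]; have d1 := df y y0; have d2 := is_deriveZ (1 + e) (dF y).
    exact: is_deriveB d2 d1.
  by move=> y yx; rewrite subr_ge0; have /andP[] := Dbound y yx.
Qed.

(** * Sets of fixed size *)

(** Chernoff's bound; the normalization is handled by Jensen's inequality, so that
    only the mean under the untilted weight f is needed. *)
Lemma tilt_tail (R : realType) (T : finType) (P : pred T) (X f : T -> R) (t h m : R) :
  (forall s, 0 <= f s) -> (forall s, P s -> t * X s <= t * h) ->
  0 <= \sum_s t * (X s - m) * f s ->
  \sum_(s | P s) expR (t * X s) * f s <= expR (- (t * (m - h))) * \sum_s expR (t * X s) * f s.
Proof.
move=> f0 HP Hm.
have A : expR (t * m) * \sum_s f s <= \sum_s expR (t * X s) * f s.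
  rewrite mulr_sumr -subr_ge0 -sumrB.
  apply: (@le_trans _ _ (\sum_s expR (t * m) * (t * (X s - m) * f s))).
    by rewrite -mulr_sumr mulr_ge0 // expR_ge0.
  apply: ler_sum => s _.
  have -> : t * X s = t * m + t * (X s - m) by ring.
  rewrite expRD; have := expR_ge1Dx (t * (X s - m)).
  have := expR_ge0 (t * m); set a := expR _; set b := expR _ => a0 h1.
  rewrite mulrA -mulrBl ler_wpM2r //.
  have -> : a * b - a = a * (b - 1) by ring.
  by rewrite ler_wpM2l // lerBrDl.
apply: (@le_trans _ _ (expR (t * h) * \sum_s f s)).
  rewrite mulr_sumr big_mkcond /=; apply: ler_sum => s _.
  case: ifP => Ps; last by rewrite mulr_ge0 ?expR_ge0.
  by rewrite ler_wpM2r // ler_expR HP.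
have := ler_wpM2l (expR_ge0 (- (t * (m - h)))) A; rewrite mulrA -expRD.
by rewrite (_ : - (t * (m - h)) + t * m = t * h) //; ring.
Qed.

Lemma exprn_tilt (R : realType) (a b : R) n : 0 < a -> 0 < b ->
  b ^+ n = expR (ln (b / a) * n%:R) * a ^+ n.
Proof.
move=> a0 b0; rewrite expRM_natr lnK ?posrE ?divr_gt0 // -exprMn.
by rewrite divfK // gt_eqF.
Qed.

(** Mean estimates at two neighbouring activities replace a variance bound: tilting from [l0]
    controls small sizes, tilting from [l2] large ones. Each tail keeps at most a quarter of the
    weight, whence [ln 4]. *)
Lemma size_window (R : realType) N (f : {set 'I_N} -> R) (l0 l1 l2 m0 m2 lo hi : R) :
  (forall S, 0 <= f S) -> 0 < l0 -> l0 < l1 -> l1 < l2 ->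
  m0 * (\sum_(S : {set 'I_N}) l0 ^+ #|S| * f S) <= \sum_(S : {set 'I_N}) #|S|%:R * (l0 ^+ #|S| * f S) ->
  \sum_(S : {set 'I_N}) #|S|%:R * (l2 ^+ #|S| * f S) <= m2 * (\sum_(S : {set 'I_N}) l2 ^+ #|S| * f S) ->
  ln 4 <= ln (l1 / l0) * (m0 - lo) -> ln 4 <= ln (l2 / l1) * (hi - m2) ->
  (\sum_(S : {set 'I_N}) l1 ^+ #|S| * f S) / 2 <= \sum_(S : {set 'I_N} | lo <= #|S|%:R <= hi) l1 ^+ #|S| * f S.
Proof.
move=> f0 l00 l01 l12 Hm0 Hm2 H0 H2.
have l10 : 0 < l1 by apply: lt_trans l01.
have l20 : 0 < l2 by apply: lt_trans l12.
set A := \sum_(S : {set 'I_N}) l1 ^+ #|S| * f S.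
have A0 : 0 <= A by apply: sumr_ge0 => S _; rewrite mulr_ge0 ?exprn_ge0 // ltW.
have T1 : \sum_(S : {set 'I_N} | #|S|%:R < lo) l1 ^+ #|S| * f S <= A / 4.
  have t0 : 0 <= ln (l1 / l0) by rewrite ln_ge0 // ler_pdivlMr // mul1r ltW.
  have := @tilt_tail R _ (fun S : {set 'I_N} => #|S|%:R < lo) (fun S : {set 'I_N} => #|S|%:R) (fun S : {set 'I_N} => l0 ^+ #|S| * f S) (ln (l1 / l0)) lo m0.
  have E (S : {set 'I_N}) : expR (ln (l1 / l0) * #|S|%:R) * (l0 ^+ #|S| * f S) = l1 ^+ #|S| * f S.
    by rewrite mulrA -exprn_tilt.
  rewrite !(eq_bigr _ (fun S _ => E S)) -/A => H; apply: le_trans (H _ _ _) _.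
  - by move=> S; rewrite mulr_ge0 ?exprn_ge0 // ltW.
  - by move=> S SL; rewrite ler_wpM2l // ltW.
  - under eq_bigr do rewrite -mulrA mulrBl.
    by rewrite -mulr_sumr mulr_ge0 // sumrB -mulr_sumr subr_ge0.
  - rewrite mulrC ler_wpM2l // -[X in _ <= X]lnK ?posrE ?invr_gt0 //.
    by rewrite ler_expR lnV ?posrE // lerN2.
have T2 : \sum_(S : {set 'I_N} | hi < #|S|%:R) l1 ^+ #|S| * f S <= A / 4.
  have Nt : ln (l1 / l2) = - ln (l2 / l1) by rewrite -lnV ?posrE ?divr_gt0 // invf_div.
  have t0 : 0 <= ln (l2 / l1) by rewrite ln_ge0 // ler_pdivlMr // mul1r ltW.
  have := @tilt_tail R _ (fun S : {set 'I_N} => hi < #|S|%:R) (fun S : {set 'I_N} => #|S|%:R) (fun S : {set 'I_N} => l2 ^+ #|S| * f S) (ln (l1 / l2)) hi m2.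
  have E (S : {set 'I_N}) : expR (ln (l1 / l2) * #|S|%:R) * (l2 ^+ #|S| * f S) = l1 ^+ #|S| * f S.
    by rewrite mulrA -exprn_tilt.
  rewrite !(eq_bigr _ (fun S _ => E S)) -/A => H; apply: le_trans (H _ _ _) _.
  - by move=> S; rewrite mulr_ge0 ?exprn_ge0 // ltW.
  - by move=> S SL; rewrite Nt !mulNr lerN2 ler_wpM2l // ltW.
  - under eq_bigr do rewrite -mulrA mulrBl.
    rewrite -mulr_sumr Nt mulNr -mulrN mulr_ge0 // sumrB -mulr_sumr opprB subr_ge0 //.
  - rewrite mulrC ler_wpM2l // -[X in _ <= X]lnK ?posrE ?invr_gt0 //.
    by rewrite ler_expR lnV ?posrE // lerN2 Nt mulNr -mulrN opprB.
have EA : A = \sum_(S : {set 'I_N} | #|S|%:R < lo) l1 ^+ #|S| * f S +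
    \sum_(S : {set 'I_N} | lo <= #|S|%:R) l1 ^+ #|S| * f S.
  rewrite /A (bigID (fun S : {set 'I_N} => #|S|%:R < lo)) /=; congr (_ + _).
  by apply: eq_bigl => S; rewrite -leNgt.
have EB : \sum_(S : {set 'I_N} | lo <= #|S|%:R) l1 ^+ #|S| * f S <=
    \sum_(S : {set 'I_N} | lo <= #|S|%:R <= hi) l1 ^+ #|S| * f S +
    \sum_(S : {set 'I_N} | hi < #|S|%:R) l1 ^+ #|S| * f S.
  rewrite (bigID (fun S : {set 'I_N} => #|S|%:R <= hi)) /= lerD2l.
  rewrite big_mkcond [X in _ <= X]big_mkcond; apply: ler_sum => S _ /=.
  rewrite -ltNge; case: (hi < _) => /=; rewrite ?andbF // andbT.
  by case: ifP => // _; rewrite mulr_ge0 ?exprn_ge0 // ltW.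
by lra.
Qed.

(** E_m q^X, with value 0 when m > N, where there are no sets to average over. *)
Definition tilted_mean (R : realFieldType) N (q : R) (E : {set {set 'I_N}}) (m : nat) : R :=
  (\sum_(S in msets N m) q ^+ edges_in E S) / #|msets N m|%:R.

Section Canon.
Variables (R : realFieldType) (N : nat) (q : R) (E : {set {set 'I_N}}).
Hypotheses (q0 : 0 <= q) (q1 : q <= 1).

Lemma tilted_mean_ge0 m : 0 <= tilted_mean q E m.
Proof. by rewrite divr_ge0 // sumr_ge0 // => S _; rewrite exprn_ge0. Qed.

Lemma card_msets m : #|msets N m| = 'C(N, m).
Proof. by rewrite -[X in 'C(X, _)]card_ord -card_draws; apply: eq_card => S; rewrite !inE. Qed.

Lemma sum_msets_pair m (g : {set 'I_N} -> R) :
  \sum_(S in msets N m.+1) \sum_(v in S) g (S :\ v) =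
  \sum_(S in msets N m) \sum_(v | v \notin S) g S.
Proof.
rewrite (exchange_big_dep predT) //= [RHS](exchange_big_dep predT) //=.
apply: eq_bigr => v _.
rewrite (reindex_onto (fun S => v |: S) (fun S => S :\ v)) /=; last first.
  by move=> S /andP[_ vS]; rewrite setD1K.
apply: eq_big => [S|S]; last first.
  by move=> /andP[_ /eqP ->].
rewrite !inE eqxx /= andbT; case: (boolP (v \in S)) => vS /=.
  rewrite andbF; apply/negbTE/negP => /andP[_ /eqP/setP/(_ v)].
  by rewrite !inE eqxx vS.
by rewrite cardsU1 vS setU1K // eqxx !andbT eqSS.
Qed.

(** A uniform vertex deleted from a uniform set of size [m + 1] leaves a uniform set of size [m],
    which spans no more edges. From size [N + 1] on the value is 0 by convention, consistently with
    the claim. *)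
Lemma tilted_mean_anti_step m : tilted_mean q E m.+1 <= tilted_mean q E m.
Proof.
have [Nm|mN] := leqP N m.
  rewrite {1}/tilted_mean card_msets bin_small ?ltnS // invr0 mulr0.
  exact: tilted_mean_ge0.
rewrite /tilted_mean !card_msets.
have C0 : (0 < 'C(N, m))%N by rewrite bin_gt0 ltnW.
have C1 : (0 < 'C(N, m.+1))%N by rewrite bin_gt0.
have H : m.+1%:R * (\sum_(S in msets N m.+1) q ^+ edges_in E S) <=
         (N - m)%:R * (\sum_(S in msets N m) q ^+ edges_in E S) :> R.
  apply: (@le_trans _ _ (\sum_(S in msets N m.+1) \sum_(v in S) q ^+ edges_in E (S :\ v))).
    rewrite mulr_sumr; apply: ler_sum => S; rewrite inE => /eqP Sm.
    rewrite mulr_natl -Sm -sumr_const; apply: ler_sum => v _.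
    by rewrite ler_wiXn2l // edges_in_sub // subD1set.
  rewrite (sum_msets_pair m (fun S => q ^+ edges_in E S)) mulr_sumr.
  apply: ler_sum => S; rewrite inE => /eqP Sm.
  rewrite sumr_const mulr_natl.
  have -> : #|[pred v | v \notin S]| = (N - m)%N.
    have := cardC (mem S); rewrite [X in _ = X]card_ord Sm => H; rewrite -[in RHS]H addKn.
    by apply: eq_card => v; rewrite !inE.
  by [].
rewrite ler_pdivrMr ?ltr0n // mulrAC ler_pdivlMr ?ltr0n //.
have EC : (m.+1 * 'C(N, m.+1) = (N - m) * 'C(N, m))%N by rewrite mul_bin_left mulnC mulnC.
have E2 : (m.+1%:R * 'C(N, m.+1)%:R = (N - m)%:R * 'C(N, m)%:R :> R) by rewrite -!natrM EC.
set A := \sum_(S in _) _ in H *; set B := \sum_(S in _) _ in H *.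
rewrite -(@ler_pM2l _ m.+1%:R) // mulrA [X in _ <= X]mulrCA E2.
rewrite [X in _ <= X](_ : _ = ((N - m)%:R * B) * 'C(N, m)%:R); last by ring.
by rewrite ler_wpM2r.
Qed.

Lemma tilted_mean_anti m1 m2 : (m1 <= m2)%N -> tilted_mean q E m2 <= tilted_mean q E m1.
Proof.
move=> /subnKC <-; elim: (m2 - m1)%N => [|n IH]; first by rewrite addn0.
by rewrite addnS (le_trans (tilted_mean_anti_step _)).
Qed.

Lemma sum_by_size (g : nat -> R) (F : {set 'I_N} -> R) :
  \sum_(S : {set 'I_N}) g #|S| * F S = \sum_(j < N.+1) g j * \sum_(S in msets N j) F S.
Proof.
rewrite (partition_big (fun S : {set 'I_N} => inord #|S| : 'I_N.+1) predT) //=.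
apply: eq_bigr => j _; rewrite mulr_sumr.
have cS (S : {set 'I_N}) : (#|S| < N.+1)%N by rewrite ltnS -[X in (_ <= X)%N]card_ord max_card.
apply: eq_big => [S|S /eqP <-]; last by rewrite inordK.
by rewrite inE -val_eqE /= inordK.
Qed.

Lemma sum_msets_tilted_mean j :
  \sum_(S in msets N j) q ^+ edges_in E S = tilted_mean q E j * \sum_(S in msets N j) 1.
Proof.
rewrite sumr_const -/(#|msets N j|%:R); have [C0|C0] := eqVneq #|msets N j| 0%N; last first.
  by rewrite /tilted_mean divfK // pnatr_eq0.
by rewrite C0 mulr0 big1 // => S; move/eqP: C0; rewrite cards_eq0 => /eqP ->; rewrite inE.
Qed.

(** A weight carried by sizes at least [m] only sees averages below the one at [m]. *)
Lemma sum_size_le_tilted_mean m (g : nat -> R) : (forall j, 0 <= g j) ->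
  (forall j, (j < m)%N -> g j = 0) ->
  \sum_(S : {set 'I_N}) g #|S| * q ^+ edges_in E S <= tilted_mean q E m * \sum_(S : {set 'I_N}) g #|S|.
Proof.
move=> g0 gm; under [X in _ <= _ * X]eq_bigr do rewrite -[g _]mulr1.
rewrite (sum_by_size g (fun S => q ^+ edges_in E S)) (sum_by_size g (fun=> 1)) mulr_sumr.
apply: ler_sum => j _; rewrite sum_msets_tilted_mean.
have [jm|mj] := ltnP j m; first by rewrite gm // !mul0r mulr0.
rewrite mulrCA ler_wpM2r //.
  by rewrite mulr_ge0 // sumr_ge0.
exact: tilted_mean_anti.
Qed.

Lemma sum_size_ge_tilted_mean m (g : nat -> R) : (forall j, 0 <= g j) ->
  (forall j, (m < j)%N -> g j = 0) ->
  tilted_mean q E m * (\sum_(S : {set 'I_N}) g #|S|) <= \sum_(S : {set 'I_N}) g #|S| * q ^+ edges_in E S.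
Proof.
move=> g0 gm; under [X in _ * X <= _]eq_bigr do rewrite -[g _]mulr1.
rewrite (sum_by_size g (fun S => q ^+ edges_in E S)) (sum_by_size g (fun=> 1)) mulr_sumr.
apply: ler_sum => j _; rewrite sum_msets_tilted_mean.
have [mj|jm] := ltnP m j; first by rewrite gm // !mul0r mulr0.
rewrite [X in _ <= X]mulrCA ler_wpM2r //.
  by rewrite mulr_ge0 // sumr_ge0.
exact: tilted_mean_anti.
Qed.

End Canon.

Lemma horner_lt_near0 (R : realType) (p : {poly R}) (y : R) : p.[0] < y ->
  exists2 d : R, 0 < d & forall x, 0 <= x <= d -> p.[x] < y.
Proof.
move=> py; have /cvgr_lt/(_ y py)/nbhs_ballP[d /= d0 H] := @continuous_horner R p 0.
exists (d / 2); first by rewrite divr_gt0.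
move=> x /andP[x0 xd]; apply: H; rewrite /ball /= sub0r normrN ger0_norm //.
by apply: le_lt_trans xd _; rewrite ltr_pdivrMr // ltr_pMr // ltr1n.
Qed.

Lemma sum_exprn_card (R : realFieldType) N (lam : R) :
  \sum_(S : {set 'I_N}) lam ^+ #|S| = (1 + lam) ^+ N.
Proof.
under eq_bigr do rewrite -[_ ^+ _]mulr1.
rewrite (sum_by_size (fun j => lam ^+ j) (fun=> 1)) exprDn; apply: eq_bigr => j _.
by rewrite sumr_const card_msets expr1n mul1r mulr_natr.
Qed.

Lemma sum_card_exprn (R : realFieldType) N (lam : R) : 0 < lam ->
  (1 + lam) * (\sum_(S : {set 'I_N}) #|S|%:R * lam ^+ #|S|) =
  N%:R * lam * (\sum_(S : {set 'I_N}) lam ^+ #|S|).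
Proof.
move=> l0.
have E1 (S : {set 'I_N}) : lam ^+ #|S| = lam ^+ #|S| * 1 ^+ edges_in (set0 : {set {set 'I_N}}) S.
  by rewrite expr1n mulr1.
rewrite [in LHS](eq_bigr _ (fun (S : {set 'I_N}) _ => congr1 (fun z => #|S|%:R * z) (E1 S))).
rewrite [in RHS](eq_bigr _ (fun (S : {set 'I_N}) _ => E1 S)) -sum_Zc_pin -Zc_set0E mulr_sumr.
rewrite (eq_bigr (fun _ : 'I_N => lam * @Zc R N lam 1 set0 set0)) => [|u _].
  by rewrite sumr_const card_ord -[in LHS]mulr_natl mulrA.
have uT : u \notin (set0 : {set 'I_N}) by rewrite inE.
have := Zc_marginal lam 1 set0 uT; rewrite setU0.
have -> : avoid set0 u = set0 by apply/setP => e; rewrite !inE.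
by move=> ->; ring.
Qed.

Lemma fugacity_ratio (R : realType) k (q x y tau : R) : q <= 1 -> 0 < tau -> 0 < x <= y ->
  [/\ 0 < fugacity k q x * tau, ln (y / x) <= ln (fugacity k q y * tau / (fugacity k q x * tau))
   & x < y -> fugacity k q x * tau < fugacity k q y * tau].
Proof.
move=> q1 t0 /andP[x0 xy]; have y0 : 0 < y by apply: lt_le_trans xy.
have c0 : 0 <= 1 - q by rewrite subr_ge0.
have fx : 0 < fugacity k q x by rewrite mulr_gt0 ?expR_gt0.
have fy : 0 < fugacity k q y by rewrite mulr_gt0 ?expR_gt0.
have E : expR ((1 - q) * x ^+ k.-1) <= expR ((1 - q) * y ^+ k.-1).
  by rewrite ler_expR ler_wpM2l // lerXn2r // nnegrE ltW.
split; first by rewrite mulr_gt0.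
- rewrite ler_ln ?posrE ?divr_gt0 ?mulr_gt0 ?expR_gt0 //.
  have -> : fugacity k q y * tau / (fugacity k q x * tau) =
      y / x * (expR ((1 - q) * y ^+ k.-1) / expR ((1 - q) * x ^+ k.-1)).
    rewrite /fugacity; move: (expR_gt0 ((1 - q) * y ^+ k.-1)) (expR_gt0 ((1 - q) * x ^+ k.-1)).
    by move: (expR _) (expR _) => u v u0 v0; field; rewrite !gt_eqF.
  by rewrite ler_peMr ?divr_ge0 ?(ltW x0) ?(ltW y0) // ler_pdivlMr ?expR_gt0 // mul1r.
- move=> xy'; rewrite ltr_pM2r //; apply: (@lt_le_trans _ _ (y * expR ((1 - q) * x ^+ k.-1))).
    by rewrite ltr_pM2r ?expR_gt0.
  by rewrite ler_wpM2l // ltW.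
Qed.

Lemma free_energy_le (R : realType) k (q x y : R) : q <= 1 -> 0 <= x <= y ->
  free_energy k q x <= free_energy k q y.
Proof.
move=> q1 /andP[x0 xy]; apply: lerD => //.
rewrite ler_wpM2r ?invr_ge0 // ler_wpM2l ?mulr_ge0 ?subr_ge0 //.
by rewrite lerXn2r // nnegrE (le_trans x0).
Qed.

Lemma ln2_le1 (R : realType) : ln 2 <= 1 :> R.
Proof. by rewrite (_ : 2 = 1 + 1) ?le_ln1Dx //; lra. Qed.

Lemma ln4_le2 (R : realType) : ln 4 <= 2 :> R.
Proof.
have -> : 4 = 2 * 2 :> R by rewrite -natrM.
by rewrite lnM ?posrE // -[X in _ <= X]/(1 + 1) lerD // ln2_le1.
Qed.

(** At density [x1], slightly above [b], half of the partition function comes from sizes between [m]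
    and [hi], where averages are at most the one at [m]. The total weight of this window, edges
    ignored, is bounded by retilting to activity [b * tau], where all sets together weigh at most
    [exp (b M)]. The free energy at [b], less [b] and the tilting cost [(1 - q) b^k], is
    [- (1 - q) b^k / k]. *)
Lemma tilted_mean_ge (R : realType) (k : nat) (q b e : R) :
  (2 <= k)%N -> 0 <= q -> q <= 1 -> 0 < b -> k.-1%:R * (1 - q) * b ^+ k.-1 < 1 -> 0 < e ->
  exists2 eps : R, 0 < eps & forall N (tau : R) (E : {set {set 'I_N}}) (m : nat),
   tree_like k eps tau E -> 1 <= eps * (N%:R * tau) -> m%:R <= (b + eps) * (N%:R * tau) ->
   expR (- ((1 - q) * b ^+ k / k%:R + e) * (N%:R * tau)) <= tilted_mean q E m.
Proof.
move=> k2 q0 q1 b0 Hb e0; have c0 : 0 <= 1 - q by rewrite subr_ge0.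
have b0' := ltW b0; have kn0 : k%:R != 0 :> R by rewrite pnatr_eq0 -lt0n ltnW.
(* [p1] keeps the contraction condition valid up to density [b + 3 * th]; [p2] bounds the cost per
   [M] of the retilting on sizes up to [(b + 4 * th) * M]. *)
pose p1 : {poly R} := (k.-1%:R * (1 - q)) *: (b%:P + 3 *: 'X) ^+ k.-1.
pose p2 : {poly R} := (b%:P + 4 *: 'X) * ((2 / b) *: 'X + (1 - q) *: (b%:P + 2 *: 'X) ^+ k.-1).
have p1E x : p1.[x] = k.-1%:R * (1 - q) * (b + 3 * x) ^+ k.-1.
  by rewrite /p1 hornerZ horner_exp hornerD hornerC hornerZ hornerX.
have p2E x : p2.[x] = (b + 4 * x) * (2 / b * x + (1 - q) * (b + 2 * x) ^+ k.-1).
  by rewrite /p2 hornerM !hornerD !hornerZ horner_exp hornerD !hornerC !hornerZ !hornerX.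
have bk : b * b ^+ k.-1 = b ^+ k by rewrite -exprS; case: (k) k2.
have [d1 d10 H1] := @horner_lt_near0 R p1 1 ltac:(rewrite p1E mulr0 addr0; exact: Hb).
have e40 : 0 < e / 4 by rewrite divr_gt0.
have [d2 d20 H2] := @horner_lt_near0 R p2 ((1 - q) * b ^+ k + e / 4)
  ltac:(by rewrite p2E !mulr0 !addr0 add0r mulrCA bk ltrDl).
pose th := Num.min d1 d2.
have th0 : 0 < th by rewrite lt_min d10 d20.
have th1 : 0 <= th <= d1 by rewrite (ltW th0) ge_min lexx.
have th2 : 0 <= th <= d2 by rewrite (ltW th0) ge_min lexx orbT.
have {H1} Hxm := H1 th th1; have {H2} Hth := H2 th th2.
rewrite p1E in Hxm; rewrite p2E in Hth.
set x0 := b + th; set x1 := b + 2 * th in Hth; set x2 := b + 3 * th in Hxm.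
have [x00 [x01 x12]] : 0 < x0 /\ x0 < x1 /\ x1 < x2 by rewrite /x0 /x1 /x2; clear -b0 th0; lra.
have x10 := lt_trans x00 x01; have x20 := lt_trans x10 x12.
have bx1 : b < x1 by rewrite /x1; clear -th0; lra.
pose Phi := free_energy k q x1.
have Phi0 : 0 <= Phi by rewrite addr_ge0 ?(ltW x10) // !mulr_ge0 ?invr_ge0 ?exprn_ge0 ?(ltW x10).
(* The first term keeps the uncertainty of the means below the spacing [th] of the densities, the
   second controls the relative error of [ln Z]. *)
pose e1 := Num.min (th / (2 * x2)) (e / (4 * (1 + Phi))).
have P1 : 0 < 4 * (1 + Phi) by rewrite mulr_gt0 // ltr_wpDr.
have e10 : 0 < e1 by rewrite lt_min !divr_gt0 // mulr_gt0.
have e1a : e1 * x2 <= th / 2.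
  apply: (@le_trans _ _ (th / (2 * x2) * x2)); first by rewrite ler_wpM2r ?(ltW x20) // ge_min lexx.
  by rewrite le_eqVlt; apply/orP; left; apply/eqP; field; rewrite gt_eqF.
have e1b : e1 * Phi <= e / 4.
  apply: (@le_trans _ _ (e / (4 * (1 + Phi)) * (1 + Phi))).
    by apply: ler_pM; rewrite ?(ltW e10) // ?ge_min ?lexx ?orbT // lerDr.
  by rewrite le_eqVlt; apply/orP; left; apply/eqP; field; rewrite gt_eqF // ltr_wpDr.
have [ep1 ep10 HM] := mean_size k2 q0 q1 x20 Hxm e10.
have [ep2 ep20 HZ] := ln_Z_near k2 q0 q1 x20 Hxm e10.
pose r1 := ln (x1 / x0); pose r2 := ln (x2 / x1).
have r10 : 0 < r1 by rewrite ln_gt0 // ltr_pdivlMr // mul1r.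
have r20 : 0 < r2 by rewrite ln_gt0 // ltr_pdivlMr // mul1r.
pose eps := Num.min (Num.min ep1 ep2) (Num.min (th / 4) (Num.min (e / 4) (Num.min (r1 * th / 8) (r2 * th / 4)))).
have eps0 : 0 < eps by rewrite !lt_min ep10 ep20 !divr_gt0 ?mulr_gt0.
have [l1 l2 l3 l4 [l5 l6]] : [/\ eps <= ep1, eps <= ep2, eps <= th / 4, eps <= e / 4 &
   eps <= r1 * th / 8 /\ eps <= r2 * th / 4].
  by split; [| | | |split]; rewrite !ge_min lexx ?orbT.
exists eps => // N tau E m HE HM1 Hm.
have [kE /andP[tau0 tau_le] _ _ _] := HE.
set M := N%:R * tau in HM1 Hm *.
have M0 : 0 < M.
  by rewrite ltNge; apply/negP => M0; have := mulr_ge0_le0 (ltW eps0) M0; clear -HM1; lra.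
have M0' := ltW M0.
have G0 := HM N tau E (tree_like_le l1 HE) x0 _ _ erefl.
have /G0/andP[{}G0 _] : 0 < x0 <= x2 by rewrite x00 ltW // (lt_trans x01).
have G2 := HM N tau E (tree_like_le l1 HE) x2 _ _ erefl.
have /G2/andP[_ {}G2] : 0 < x2 <= x2 by rewrite x20 lexx.
have GZ := HZ N tau E (tree_like_le l2 HE) x1.
have /GZ/andP[{}GZ _] : 0 < x1 <= x2 by rewrite x10 ltW.
rewrite -/M -/Phi in G0 G2 GZ.
rewrite sum_Zc_pin Zc_set0E in G0; rewrite sum_Zc_pin Zc_set0E in G2.
have [L0 R1 S1] := @fugacity_ratio R k q x0 x1 tau q1 tau0 ltac:(by rewrite x00 ltW).
have [L1 R2 S2] := @fugacity_ratio R k q x1 x2 tau q1 tau0 ltac:(by rewrite x10 ltW).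
set lam1 := fugacity k q x1 * tau in R1 S1 L1 R2 S2 GZ.
have gap0 : ln 4 <= ln (lam1 / (fugacity k q x0 * tau)) * ((1 - e1) * (M * x0) - m%:R).
  apply: (le_trans (ln4_le2 R)).
  have A : th * M / 4 <= (1 - e1) * (M * x0) - m%:R.
    have : e1 * x0 <= th / 2.
      by apply: le_trans e1a; rewrite ler_wpM2l ?(ltW e10) // ltW // (lt_trans x01).
    move/(ler_wpM2r M0') => A1.
    have A2 : eps * M <= th / 4 * M by rewrite ler_wpM2r.
    rewrite /x0 in A1 *; clear -A1 A2 Hm; nra.
  apply: (@le_trans _ _ (r1 * (th * M / 4))).
    have := ler_wpM2r M0' l5; clear -HM1; lra.
  apply: ler_pM => //; [exact: ltW | by rewrite !mulr_ge0 // ltW].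
have gap2 : ln 4 <= ln (fugacity k q x2 * tau / lam1) * ((b + 4 * th) * M - (1 + e1) * (M * x2)).
  apply: (le_trans (ln4_le2 R)).
  have A : th * M / 2 <= (b + 4 * th) * M - (1 + e1) * (M * x2).
    have A1 := ler_wpM2r M0' e1a.
    rewrite /x2 in A1 *; clear -A1; nra.
  apply: (@le_trans _ _ (r2 * (th * M / 2))).
    have := ler_wpM2r M0' l6; clear -HM1; lra.
  apply: ler_pM => //; [exact: ltW | by rewrite !mulr_ge0 // ltW].
have W := @size_window R N (fun S => q ^+ edges_in E S) _ _ _ _ _ _ _
  (fun S => exprn_ge0 _ q0) L0 (S1 x01) (S2 x12) G0 G2 gap0 gap2.
set hi := (b + 4 * th) * M in W gap2.
pose g (j : nat) : R := if m%:R <= j%:R :> R then if j%:R <= hi then lam1 ^+ j else 0 else 0.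
have g0 j : 0 <= g j by rewrite /g; do 2 case: ifP => // _; rewrite exprn_ge0 // ltW.
have gm j : (j < m)%N -> g j = 0 by move=> jm; rewrite /g ler_nat leqNgt jm.
have C1 := sum_size_le_tilted_mean E q0 q1 g0 gm.
have lb0 : 0 < b * tau by rewrite mulr_gt0.
have b1 : b * tau <= lam1.
  have [_ _ /(_ bx1)] := @fugacity_ratio R k q b x1 tau q1 tau0 ltac:(by rewrite b0 ltW).
  move/ltW; apply: le_trans; rewrite ler_wpM2r ?(ltW tau0) // ler_peMr //.
  by apply: le_trans (expR_ge1Dx _); rewrite lerDl mulr_ge0 // exprn_ge0.
have lr0 : 0 <= ln (lam1 / (b * tau)) by rewrite ln_ge0 // ler_pdivlMr // mul1r.
have C2 : \sum_(S : {set 'I_N}) g #|S| <= expR (ln (lam1 / (b * tau)) * hi) * expR (b * M).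
  apply: (@le_trans _ _ (\sum_(S : {set 'I_N}) expR (ln (lam1 / (b * tau)) * hi) * (b * tau) ^+ #|S|)).
    apply: ler_sum => S _; rewrite /g.
    have h : 0 <= expR (ln (lam1 / (b * tau)) * hi) * (b * tau) ^+ #|S|.
      by rewrite mulr_ge0 ?expR_ge0 // exprn_ge0 // ltW.
    case: ifP => // _; case: ifP => // Shi.
    rewrite (exprn_tilt _ lb0 L1) ler_wpM2r ?exprn_ge0 ?(ltW lb0) //.
    by rewrite ler_expR ler_wpM2l.
  rewrite -mulr_sumr sum_exprn_card ler_wpM2l ?expR_ge0 //.
  have -> : b * M = N%:R * (b * tau) by rewrite /M; ring.
  by rewrite expRM_natl lerXn2r ?nnegrE ?expR_ge0 ?expR_ge1Dx // addr_ge0 // ltW.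
have lnr : ln (lam1 / (b * tau)) <= 2 / b * th + (1 - q) * x1 ^+ k.-1.
  have -> : lam1 / (b * tau) = (1 + 2 / b * th) * expR ((1 - q) * x1 ^+ k.-1).
    by rewrite /lam1 /fugacity /x1; field; rewrite !gt_eqF.
  have h : 0 <= 2 / b * th by rewrite mulr_ge0 ?divr_ge0 // ltW.
  have h2 : 0 < 1 + 2 / b * th by rewrite ltr_wpDr.
  rewrite lnM ?posrE ?expR_gt0 // expRK lerD2r le_ln1Dx //.
  by clear -h; lra.
have hi0 : 0 <= b + 4 * th by clear -b0 th0; lra.
have C3 : ln (lam1 / (b * tau)) * hi <= ((1 - q) * b ^+ k + e / 4) * M.
  rewrite /hi mulrA ler_wpM2r // mulrC; apply: le_trans (ltW Hth).
  by rewrite ler_wpM2l.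
have WS : \sum_(S : {set 'I_N} | (m%:R : R) <= #|S|%:R <= hi) lam1 ^+ #|S| * q ^+ edges_in E S =
   \sum_(S : {set 'I_N}) g #|S| * q ^+ edges_in E S.
  rewrite big_mkcond /=; apply: eq_bigr => S _; rewrite /g.
  by case: (m%:R <= _) => /=; rewrite ?mul0r //; case: ifP => // _; rewrite mul0r.
have Z0 : 0 < Zc lam1 q E set0.
  apply: Zc_gt0 => //; apply/eqP/edges_in0P => f /kE fk; apply/negP => /subset_leq_card.
  by rewrite cards0 fk leqNgt (ltnW k2).
have C0 := tilted_mean_ge0 E q0 m.
have FIN : Zc lam1 q E set0 / 2 <= tilted_mean q E m * expR (((1 - q) * b ^+ k + e / 4) * M + b * M).
  rewrite Zc_set0E; apply: le_trans W _; rewrite WS; apply: (le_trans C1).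
  rewrite ler_wpM2l //; apply: (le_trans C2); rewrite expRD ler_wpM2r ?expR_ge0 //.
  by rewrite ler_expR.
have Z2 : expR ((1 - e1) * (M * Phi) - 1) <= Zc lam1 q E set0 / 2.
  rewrite -[X in _ <= X]lnK ?posrE ?divr_gt0 // ler_expR ln_div ?posrE // lerB //.
  exact: ln2_le1.
have := le_trans Z2 FIN; rewrite -ler_pdivrMr ?expR_gt0 // -expRN -expRD; apply: le_trans.
rewrite ler_expR.
have Fb : free_energy k q b <= Phi by apply: free_energy_le => //; rewrite b0' ltW.
have Fbe : free_energy k q b = b + (1 - q) * b ^+ k - (1 - q) * b ^+ k / k%:R.
  rewrite /free_energy.
  have -> : k.-1%:R = k%:R - 1 :> R by rewrite -[X in X%:R - 1](prednK (ltnW k2)) -natr1 addrK.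
  by field.
rewrite Fbe in Fb.
have h1 := ler_wpM2r M0' Fb; have h2 := ler_wpM2r M0' e1b; have h3 := ler_wpM2r M0' l4.
move: h1 h2 h3; set A := _ / k%:R; set B := (1 - q) * b ^+ k.
clear -HM1; rewrite -/M; set P := Phi. 
clearbody A B P M => h1 h2 h3; nra.
Qed.

Lemma mean_free_le (R : realFieldType) N (l : R) : 0 < l ->
  \sum_(S : {set 'I_N}) #|S|%:R * (l ^+ #|S| * 1) <= N%:R * l * \sum_(S : {set 'I_N}) l ^+ #|S| * 1.
Proof.
move=> l0; have := sum_card_exprn N l0.
rewrite (eq_bigr _ (fun (S : {set 'I_N}) _ => congr1 ( *%R #|S|%:R) (mulr1 (l ^+ #|S|)))).
rewrite (eq_bigr _ (fun (S : {set 'I_N}) _ => mulr1 (l ^+ #|S|))) => <-.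
rewrite ler_peMl ?lerDl ?(ltW l0) //.
by apply: sumr_ge0 => S _; rewrite mulr_ge0 // exprn_ge0 // ltW.
Qed.

Lemma mean_free_ge (R : realFieldType) N (l : R) : 0 < l <= 1 ->
  N%:R * l * (1 - l) * (\sum_(S : {set 'I_N}) l ^+ #|S| * 1)
  <= \sum_(S : {set 'I_N}) #|S|%:R * (l ^+ #|S| * 1).
Proof.
move=> /andP[l0 l1]; have := sum_card_exprn N l0.
rewrite (eq_bigr _ (fun (S : {set 'I_N}) _ => congr1 ( *%R #|S|%:R) (mulr1 (l ^+ #|S|)))).
rewrite (eq_bigr _ (fun (S : {set 'I_N}) _ => mulr1 (l ^+ #|S|))) => H.
rewrite mulrAC -H mulrAC ler_piMl //; last by clear -l0 l1; nra.
by apply: sumr_ge0 => S _; rewrite mulr_ge0 // exprn_ge0 // ltW.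
Qed.

(** Used for [(1 + y)^N] with [y] of order [tau], where the quadratic loss [N y^2] is negligible
    against [N tau]. *)
Lemma expR_le_onep (R : realType) (y : R) : 0 <= y -> expR (y * (1 - y)) <= 1 + y.
Proof.
move=> y0; have y1 : 0 < 1 + y by rewrite ltr_wpDr.
have H := expR_ge1Dx (- (y * (1 - y))).
have E0 := expR_gt0 (y * (1 - y)); rewrite expRN in H.
set v := expR _ in H E0 *.
have : (1 - y * (1 - y)) * v <= 1 by rewrite -ler_pdivlMr // mul1r.
have : 0 <= y ^+ 2 * y * v by rewrite !mulr_ge0 ?sqr_ge0 // ltW.
have [h|h] := lerP v (1 + y) => // A B.
have : 0 <= y * y ^+ 2 * (v - (1 + y)) by rewrite !mulr_ge0 ?sqr_ge0 // subr_ge0 ltW.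
have : 0 <= y ^+ 3 * y by rewrite mulr_ge0 ?exprn_ge0.
clear -A B h y0 E0; nra.
Qed.

(** Here the window lies below [m] and is filled by sets weighted without their edges, at an
    activity slightly below [b * tau], so only a binomial size has to concentrate. Averages in the
    window are at least the one at [m], and the weighted sum over it is at most the full partition
    function at density [b]. *)
Lemma tilted_mean_le (R : realType) (k : nat) (q b e : R) :
  (2 <= k)%N -> 0 <= q -> q <= 1 -> 0 < b -> k.-1%:R * (1 - q) * b ^+ k.-1 < 1 -> 0 < e ->
  exists2 eps : R, 0 < eps & forall N (tau : R) (E : {set {set 'I_N}}) (m : nat),
   tree_like k eps tau E -> 1 <= eps * (N%:R * tau) -> (b - eps) * (N%:R * tau) <= m%:R ->
   tilted_mean q E m <= expR ((- ((1 - q) * b ^+ k / k%:R) + e) * (N%:R * tau)).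
Proof.
move=> k2 q0 q1 b0 Hb e0; have c0 : 0 <= 1 - q by rewrite subr_ge0.
have b0' := ltW b0; have kn0 : k%:R != 0 :> R by rewrite pnatr_eq0 -lt0n ltnW.
have bk : b * b ^+ k.-1 = b ^+ k by rewrite -exprS; case: (k) k2.
pose C := (1 - q) * b ^+ k.-1.
have C0 : 0 <= C by rewrite mulr_ge0 // exprn_ge0.
have D0 : 0 < 4 * C + 2 by rewrite ltr_wpDl // mulr_ge0.
pose th := Num.min (b / 8) (e / (4 * (4 * C + 2))).
have th0 : 0 < th by rewrite lt_min !divr_gt0 // mulr_gt0.
have thb : th <= b / 8 by rewrite ge_min lexx.
have thC : th * (4 * C + 2) <= e / 4.
  apply: (@le_trans _ _ (e / (4 * (4 * C + 2)) * (4 * C + 2))).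
    by rewrite ler_wpM2r ?(ltW D0) // ge_min lexx orbT.
  by rewrite le_eqVlt; apply/orP; left; apply/eqP; field; rewrite gt_eqF.
set x0 := b - 3 * th; set x1 := b - 2 * th; set x2 := b - th.
have [x00 [x01 [x12 x2b]]] : 0 < x0 /\ x0 < x1 /\ x1 < x2 /\ x2 < b.
  by rewrite /x0 /x1 /x2; clear -thb b0 th0; lra.
have x10 := lt_trans x00 x01; have x20 := lt_trans x10 x12.
pose Phi := free_energy k q b.
have Phi0 : 0 <= Phi by rewrite addr_ge0 // !mulr_ge0 ?invr_ge0 ?exprn_ge0.
pose e1 := e / (4 * (1 + Phi)).
have P1 : 0 < 4 * (1 + Phi) by rewrite mulr_gt0 // ltr_wpDr.
have e10 : 0 < e1 by rewrite divr_gt0.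
have e1b : e1 * Phi <= e / 4.
  apply: (@le_trans _ _ (e / (4 * (1 + Phi)) * (1 + Phi))).
    by rewrite ler_wpM2l ?(ltW e10) // lerDr.
  by rewrite le_eqVlt; apply/orP; left; apply/eqP; field; rewrite gt_eqF // ltr_wpDr.
have [ep1 ep10 HZ] := ln_Z_near k2 q0 q1 b0 Hb e10.
pose r1 := ln (x1 / x0); pose r2 := ln (x2 / x1).
have r10 : 0 < r1 by rewrite ln_gt0 // ltr_pdivlMr // mul1r.
have r20 : 0 < r2 by rewrite ln_gt0 // ltr_pdivlMr // mul1r.
have bb0 : 0 < b ^+ 2 by rewrite exprn_gt0.
pose eps := Num.min (Num.min ep1 (b^-1)) (Num.min (Num.min (th / 2) (th / (2 * b ^+ 2)))
  (Num.min (Num.min (e / 4) (e / (4 * b ^+ 2))) (Num.min (r1 * th / 4) (r2 * th / 4)))).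
have eps0 : 0 < eps by rewrite !lt_min ep10 invr_gt0 b0 !divr_gt0 ?mulr_gt0.
have [l1 [l2 [l3 [l4 [l5 [l6 [l7 l8]]]]]]] : eps <= ep1 /\ eps <= b^-1 /\ eps <= th / 2 /\
    eps <= th / (2 * b ^+ 2) /\ eps <= e / 4 /\ eps <= e / (4 * b ^+ 2) /\
    eps <= r1 * th / 4 /\ eps <= r2 * th / 4.
  by do !split; rewrite !ge_min lexx ?orbT.
exists eps => // N tau E m HE HM1 Hm.
have [kE /andP[tau0 tau_le] _ _ _] := HE.
set M := N%:R * tau in HM1 Hm *.
have M0 : 0 < M.
  by rewrite ltNge; apply/negP => M0; have := mulr_ge0_le0 (ltW eps0) M0; clear -HM1; lra.
have M0' := ltW M0.
have bt1 : b * tau <= 1.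
  by rewrite mulrC -ler_pdivlMr // mul1r (le_trans tau_le).
have bt2 : b ^+ 2 * tau <= th / 2.
  apply: (@le_trans _ _ (b ^+ 2 * (th / (2 * b ^+ 2)))).
    by rewrite ler_wpM2l ?(ltW bb0) // (le_trans tau_le).
  by rewrite le_eqVlt; apply/orP; left; apply/eqP; field; rewrite gt_eqF.
have bt3 : b ^+ 2 * tau <= e / 4.
  apply: (@le_trans _ _ (b ^+ 2 * (e / (4 * b ^+ 2)))).
    by rewrite ler_wpM2l ?(ltW bb0) // (le_trans tau_le).
  by rewrite le_eqVlt; apply/orP; left; apply/eqP; field; rewrite gt_eqF.
have GZ := HZ N tau E (tree_like_le l1 HE) b.
have /GZ/andP[_ {}GZ] : 0 < b <= b by rewrite b0 lexx.
rewrite -/M -/Phi in GZ.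
have lx x : 0 < x -> 0 < x * tau by move=> h; rewrite mulr_gt0.
have L01 : x0 * tau < x1 * tau by rewrite ltr_pM2r.
have L12 : x1 * tau < x2 * tau by rewrite ltr_pM2r.
have xt1 x : x < b -> x * tau <= 1.
  by move=> h; apply: le_trans bt1; rewrite ler_wpM2r ?(ltW tau0) // ltW.
have G0 := @mean_free_ge R N (x0 * tau).
have /G0 {}G0 : 0 < x0 * tau <= 1 by rewrite lx // xt1 // (lt_trans x01) // (lt_trans x12).
have G2 := @mean_free_le R N _ (lx x2 x20).
have rat x y : 0 < x -> 0 < y -> y * tau / (x * tau) = y / x.
  by move=> h1 h2; field; rewrite !gt_eqF.
have gap0 : ln 4 <= ln (x1 * tau / (x0 * tau)) * (N%:R * (x0 * tau) * (1 - x0 * tau) - (b - 4 * th) * M).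
  apply: (le_trans (ln4_le2 R)); rewrite rat // -/r1.
  apply: (@le_trans _ _ (r1 * (th * M / 2))).
    have := ler_wpM2r M0' l7; clear -HM1; lra.
  rewrite ler_wpM2l ?(ltW r10) //.
  have -> : N%:R * (x0 * tau) * (1 - x0 * tau) = (x0 - x0 ^+ 2 * tau) * M by rewrite /M; ring.
  have : x0 ^+ 2 * tau <= th / 2.
    apply: le_trans bt2; rewrite ler_wpM2r ?(ltW tau0) // lerXn2r // ?nnegrE ?(ltW x00) //.
    by rewrite ltW // (lt_trans x01) // (lt_trans x12).
  move/(ler_wpM2r M0'); rewrite mulrBl; set z := x0 ^+ 2 * tau * M.
  rewrite /x0; clear; clearbody z M; lra.
have gap2 : ln 4 <= ln (x2 * tau / (x1 * tau)) * (m%:R - N%:R * (x2 * tau)).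
  apply: (le_trans (ln4_le2 R)); rewrite rat // -/r2.
  apply: (@le_trans _ _ (r2 * (th * M / 2))).
    have := ler_wpM2r M0' l8; clear -HM1; lra.
  rewrite ler_wpM2l ?(ltW r20) //.
  have -> : N%:R * (x2 * tau) = x2 * M by rewrite /M; ring.
  have h1 := ler_wpM2r M0' l3; rewrite /x2; clear -Hm h1; nra.
have W := @size_window R N (fun=> 1) _ _ _ _ _ _ _
  (fun S => ler01) (lx x0 x00) L01 L12 G0 G2 gap0 gap2.
set lo := (b - 4 * th) * M in W gap0.
set lam := fugacity k q b * tau in GZ.
have fb0 : 0 < fugacity k q b by rewrite mulr_gt0 // expR_gt0.
have lam0 : 0 < lam by rewrite mulr_gt0.
have lam1 : x1 * tau <= lam.
  rewrite ler_wpM2r ?(ltW tau0) // (@le_trans _ _ b) //; first by rewrite ltW // (lt_trans x12).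
  by rewrite ler_peMr // (le_trans _ (expR_ge1Dx _)) // lerDl.
pose g (j : nat) : R := if lo <= j%:R then if j%:R <= m%:R :> R then lam ^+ j else 0 else 0.
have g0 j : 0 <= g j by rewrite /g; do 2 case: ifP => // _; rewrite exprn_ge0 // ltW.
have gm j : (m < j)%N -> g j = 0 by move=> jm; rewrite /g ler_nat [(j <= m)%N]leqNgt jm /= if_same.
have C1 := sum_size_ge_tilted_mean E q0 q1 g0 gm.
have lr0 : 0 <= ln (lam / (x1 * tau)) by rewrite ln_ge0 // ler_pdivlMr ?lx // mul1r.
have lo0 : 0 <= lo by rewrite /lo mulr_ge0 // -/x0; clear -thb th0; lra.
have C2 : expR (ln (lam / (x1 * tau)) * lo) *
     (\sum_(S : {set 'I_N} | lo <= #|S|%:R <= (m%:R : R)) (x1 * tau) ^+ #|S| * 1) <= \sum_(S : {set 'I_N}) g #|S|.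
  rewrite mulr_sumr big_mkcond /=; apply: ler_sum => S _; rewrite /g mulr1.
  case: ifP => [/andP[h1 h2]|_]; last by do 2 case: ifP => // _; rewrite exprn_ge0 // ltW.
  rewrite h1 h2 (exprn_tilt _ (lx x1 x10) lam0) ler_wpM2r ?exprn_ge0 ?(ltW (lx x1 x10)) //.
  by rewrite ler_expR ler_wpM2l.
have C3 : \sum_(S : {set 'I_N}) g #|S| * q ^+ edges_in E S <= Zc lam q E set0.
  rewrite Zc_set0E; apply: ler_sum => S _; rewrite ler_wpM2r ?exprn_ge0 // /g.
  by case: ifP => _; [case: ifP => // _|]; rewrite exprn_ge0 // ltW.
have C4 : expR (x1 * M - b ^+ 2 * tau * M) <= \sum_(S : {set 'I_N}) (x1 * tau) ^+ #|S| * 1.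
  rewrite (eq_bigr _ (fun (S : {set 'I_N}) _ => mulr1 ((x1 * tau) ^+ #|S|))) sum_exprn_card.
  apply: (@le_trans _ _ (expR (x1 * tau * (1 - x1 * tau)) ^+ N)); last first.
    by rewrite lerXn2r ?nnegrE ?expR_ge0 ?expR_le_onep ?addr_ge0 ?(ltW (lx x1 x10)).
  rewrite -expRM_natl ler_expR.
  have -> : N%:R * (x1 * tau * (1 - x1 * tau)) = x1 * M - x1 ^+ 2 * tau * M by rewrite /M; ring.
  rewrite lerD2l lerN2 ler_wpM2r // ler_wpM2r ?(ltW tau0) // lerXn2r // ?nnegrE ?(ltW x10) //.
  by rewrite ltW // (lt_trans x12).
have lnr : C <= ln (lam / (x1 * tau)).
  have -> : lam / (x1 * tau) = (b / x1) * expR C.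
    by rewrite /lam /fugacity -/C; move: (expR C) => z; field; rewrite !gt_eqF.
  rewrite lnM ?posrE ?divr_gt0 ?expR_gt0 // expRK lerDr ln_ge0 // ler_pdivlMr // mul1r.
  by rewrite ltW // (lt_trans x12).
have T0 := tilted_mean_ge0 E q0 m.
have FIN : tilted_mean q E m * (expR (C * lo) * (expR (x1 * M - b ^+ 2 * tau * M) / 2)) <= expR ((1 + e1) * (M * Phi)).
  apply: (@le_trans _ _ (tilted_mean q E m * \sum_(S : {set 'I_N}) g #|S|)).
    rewrite ler_wpM2l //; apply: le_trans C2; apply: ler_pM; rewrite ?expR_ge0 ?divr_ge0 ?expR_ge0 //.
      by rewrite ler_expR ler_wpM2r.
    by apply: le_trans W; rewrite ler_wpM2r.
  apply: (le_trans C1); apply: (le_trans C3).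
  have Z0 : 0 < Zc lam q E set0.
    apply: Zc_gt0 => //; apply/eqP/edges_in0P => f /kE fk; apply/negP => /subset_leq_card.
    by rewrite cards0 fk leqNgt (ltnW k2).
  by rewrite -[X in X <= _]lnK ?posrE // ler_expR.
have H2 : expR (- 1) <= 2^-1 :> R.
  by rewrite -[X in _ <= X]lnK ?posrE ?invr_gt0 // ler_expR lnV ?posrE // lerN2 ln2_le1.
have FIN2 : tilted_mean q E m * expR (C * lo + (x1 * M - b ^+ 2 * tau * M) - 1) <= expR ((1 + e1) * (M * Phi)).
  apply: le_trans FIN; rewrite ler_wpM2l // !expRD -mulrA ler_wpM2l ?expR_ge0 //.
  by rewrite -expRD ler_wpM2l // expR_ge0.
rewrite -ler_pdivlMr ?expR_gt0 // -expRN -expRD in FIN2; apply: (le_trans FIN2).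
rewrite ler_expR.
have Fbe : Phi = b + b * C - (1 - q) * b ^+ k / k%:R.
  rewrite /Phi /free_energy.
  have -> : k.-1%:R = k%:R - 1 :> R by rewrite -[X in X%:R - 1](prednK (ltnW k2)) -natr1 addrK.
  have -> : b * C = (1 - q) * b ^+ k by rewrite /C mulrCA bk.
  by field.
have h2 := ler_wpM2r M0' e1b; have h3 := ler_wpM2r M0' l5; have h4 := ler_wpM2r M0' thC.
have h5 := ler_wpM2r M0' bt3.
have h6 : (1 + e1) * (M * Phi) = M * (b + b * C - (1 - q) * b ^+ k / k%:R) + e1 * Phi * M by rewrite -Fbe; ring.
rewrite h6; rewrite /lo /x1; move: h2 h3 h4 h5; set A := _ / k%:R; set B := b ^+ 2 * tau.
set P := e1 * Phi; clear -HM1; clearbody A B P M C th eps => h2 h3 h4 h5; nra.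
Qed.

(** * Expectation and exponential tilting *)

(** The quotient of binomials is a product of [k] factors [(m - i) / (N - i)], each at most
    [m / N]. *)
Lemma bin_sub_le (R : realFieldType) (x : R) k N m : x <= 1 -> (k <= m <= N)%N ->
  m%:R <= x * N%:R -> 'C(N - k, m - k)%:R <= x ^+ k * 'C(N, m)%:R.
Proof.
move=> x1; elim: k N m => [|k IH] N m; first by rewrite !subn0 expr0 mul1r.
case: m => [|m]; first by case/andP.
case: N => [|N]; first by case/andP.
move=> /andP[km mN] Hx; rewrite !subSS.
have x0 : 0 <= x.
  by rewrite -(pmulr_lge0 _ (ltr0Sn R N)) (le_trans _ Hx).
have H := IH N m ltac:(rewrite -ltnS km; exact: mN).
have Hm : m%:R <= x * N%:R by move: Hx; rewrite -!natr1 mulrDr mulr1; lra.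
apply: (le_trans (H Hm)); rewrite exprSr -mulrA ler_wpM2l ?exprn_ge0 //.
rewrite -(@ler_pM2l _ N.+1%:R) // -natrM mul_bin_diag natrM mulrA ler_wpM2r //.
by rewrite mulrC.
Qed.

(** Each factor [(m - i) / (N - i)] is at least [(m - i) / N], and the slack [k%:R] covers every
    [i < k]. *)
Lemma bin_sub_ge (R : realFieldType) (y : R) k N m : 0 <= y -> (k <= m <= N)%N ->
  y * N%:R + k%:R <= m%:R -> y ^+ k * 'C(N, m)%:R <= 'C(N - k, m - k)%:R.
Proof.
move=> y0; elim: k N m => [|k IH] N m; first by rewrite !subn0 expr0 mul1r.
case: m => [|m]; first by case/andP.
case: N => [|N]; first by case/andP.
move=> /andP[km mN] Hy; rewrite !subSS.
have H := IH N m ltac:(rewrite -ltnS km; exact: mN).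
have Hm : y * N%:R + k%:R <= m%:R by move: Hy; rewrite -!natr1 mulrDr mulr1; lra.
apply: le_trans (H Hm); rewrite exprSr -mulrA ler_wpM2l ?exprn_ge0 //.
rewrite -(@ler_pM2l _ N.+1%:R) // -[X in _ <= X]natrM mul_bin_diag natrM mulrA ler_wpM2r //.
by rewrite mulrC; apply: le_trans Hy; rewrite lerDl.
Qed.

Lemma card_msets_containing N m (e : {set 'I_N}) : (#|e| <= m)%N ->
  #|[set S in msets N m | e \subset S]| = 'C(N - #|e|, m - #|e|).
Proof.
move=> em; have Ce : (#|~: e| = N - #|e|)%N.
  have := cardsC e; rewrite [X in _ = X]card_ord => H.
  by rewrite -[LHS](addKn #|e|) H.
rewrite -Ce -cards_draws.
have inj : {in [set B : {set 'I_N} | (B \subset ~: e) && (#|B| == m - #|e|)%N] &, injective (fun B => e :|: B)}.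
  move=> B B'; rewrite !inE => /andP[sB _] /andP[sB' _] /setP EQ.
  apply/setP => w; have := EQ w; rewrite !inE; case: (boolP (w \in e)) => //= we _.
  have h (X : {set 'I_N}) : X \subset ~: e -> w \in X = false.
    by move=> sX; apply/negbTE/negP => wX; have := subsetP sX w wX; rewrite inE we.
  by rewrite !h.
rewrite -(card_in_imset inj); apply: eq_card => S; rewrite !inE.
apply/andP/imsetP => [[/eqP Sm eS]|[B]].
  exists (S :\: e).
    rewrite inE cardsD (setIidPr eS) Sm eqxx andbT.
    by apply/subsetP => w; rewrite !inE => /andP[].
  apply/setP => w; rewrite !inE; case: (boolP (w \in e)) => //= we.
  by rewrite (subsetP eS).
rewrite inE => /andP[sB /eqP CB] ->; split; last exact: subsetUl.
by rewrite cardsU (disjoint_setI0 _) ?cards0 ?subn0 ?CB ?subnKC // disjoint_sym disjoints_subset.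
Qed.

Lemma sum_edges_in (R : realFieldType) N m (E : {set {set 'I_N}}) :
  \sum_(S in msets N m) (edges_in E S)%:R = \sum_(e in E) #|[set S in msets N m | e \subset S]|%:R :> R.
Proof.
have -> : \sum_(S in msets N m) (edges_in E S)%:R =
    \sum_(S in msets N m) \sum_(e in E | e \subset S) 1 :> R.
  apply: eq_bigr => S _; rewrite sumr_const; congr (_%:R); apply: eq_card => e.
  by rewrite !inE.
rewrite (exchange_big_dep (fun e => e \in E)) /= => [|S e _ /andP[]//].
apply: eq_bigr => e eE; rewrite sumr_const; congr (_%:R); apply: eq_card => S.
by rewrite !inE unfold_in !inE eE.
Qed.

Lemma card_edges (R : realFieldType) N k (E : {set {set 'I_N}}) : kuniform k E ->
  \sum_(v : 'I_N) (hdeg E [set v])%:R = #|E|%:R * k%:R :> R.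
Proof.
move=> kE; have -> : \sum_(v : 'I_N) (hdeg E [set v])%:R =
    \sum_(v : 'I_N) \sum_(e in E | v \in e) 1 :> R.
  apply: eq_bigr => v _; rewrite sumr_const; congr (_%:R); apply: eq_card => e.
  by rewrite !inE sub1set.
rewrite (exchange_big_dep (fun e => e \in E)) /= => [|v e _ /andP[]//].
rewrite mulr_natl -sumr_const; apply: eq_bigr => e eE.
rewrite sumr_const -(kE e eE); congr (_%:R); apply: eq_card => v.
by rewrite unfold_in eE.
Qed.

(** By linearity all edges contribute the same quotient of binomials, and summing degrees pins down
    the number of edges; approximate regularity makes the two bounds meet. *)
Lemma Em_edges_bounds (R : realType) N k m (E : {set {set 'I_N}}) (eps tau x y : R) :
  (2 <= k)%N -> tree_like k eps tau E -> eps <= 1 -> (k <= m <= N)%N ->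
  0 <= y -> x * tau <= 1 -> m%:R <= x * tau * N%:R -> y * tau * N%:R + k%:R <= m%:R ->
  (1 - eps) * y ^+ k / k%:R * (N%:R * tau) <= Em m (edges_in E) <= x ^+ k / k%:R * (N%:R * tau).
Proof.
move=> k2 HE eps1 kmN y0 xt1 Hx Hy.
have [kE /andP[tau0 tau_le] _ _ Hd] := HE.
have [km mN] := andP kmN.
have kn : 0 < k%:R :> R by rewrite ltr0n ltnW.
have C0 : 0 < 'C(N, m)%:R :> R by rewrite ltr0n bin_gt0.
have E1 : Em m (edges_in E) = #|E|%:R * 'C(N - k, m - k)%:R / 'C(N, m)%:R :> R.
  rewrite /Em card_msets sum_edges_in (eq_bigr (fun=> 'C(N - k, m - k)%:R)) => [|e eE].
    by rewrite sumr_const mulr_natl.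
  by rewrite card_msets_containing (kE e eE).
have U : #|E|%:R * k%:R * tau ^+ k.-1 <= N%:R.
  rewrite -(card_edges R kE) mulr_suml.
  apply: (@le_trans _ _ (\sum_(v : 'I_N) 1)); last by rewrite sumr_const card_ord.
  by apply: ler_sum => v _; have /andP[] := Hd v.
have L : (1 - eps) * N%:R <= #|E|%:R * k%:R * tau ^+ k.-1.
  rewrite -(card_edges R kE) mulr_suml.
  apply: (@le_trans _ _ (\sum_(v : 'I_N) (1 - eps))).
    by rewrite sumr_const card_ord mulr_natr.
  by apply: ler_sum => v _; have /andP[] := Hd v.
have B1 := bin_sub_le xt1 kmN Hx.
have B2 := bin_sub_ge (mulr_ge0 y0 (ltW tau0)) kmN Hy.
rewrite exprMn in B1; rewrite exprMn in B2.
have Tk : tau ^+ k = tau ^+ k.-1 * tau by rewrite -exprSr prednK // ltnW.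
rewrite Tk in B1 B2.
have e0 : 0 <= #|E|%:R :> R by [].
have yk : 0 <= y ^+ k by rewrite exprn_ge0.
have x0 : 0 <= x ^+ k.
  have : 0 <= x ^+ k * (tau ^+ k.-1 * tau) * 'C(N, m)%:R by apply: le_trans B1.
  by rewrite pmulr_lge0 // pmulr_lge0 // mulr_gt0 // exprn_gt0.
rewrite E1; apply/andP; split.
- rewrite ler_pdivlMr //; apply: (@le_trans _ _ (#|E|%:R * (y ^+ k * (tau ^+ k.-1 * tau) * 'C(N, m)%:R))); last first.
    by rewrite ler_wpM2l.
  have h : 0 <= y ^+ k / k%:R * tau * 'C(N, m)%:R by rewrite !mulr_ge0 ?invr_ge0 ?(ltW kn) ?(ltW tau0) ?(ltW C0).
  have := ler_wpM2r h L.
  rewrite (_ : (1 - eps) * N%:R * _ = (1 - eps) * y ^+ k / k%:R * (N%:R * tau) * 'C(N, m)%:R); last by ring.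
  move/le_trans; apply; rewrite le_eqVlt; apply/orP; left; apply/eqP.
  by field; rewrite gt_eqF.
- rewrite ler_pdivrMr //; apply: (@le_trans _ _ (#|E|%:R * (x ^+ k * (tau ^+ k.-1 * tau) * 'C(N, m)%:R))).
    by rewrite ler_wpM2l.
  have h : 0 <= x ^+ k / k%:R * tau * 'C(N, m)%:R by rewrite !mulr_ge0 ?invr_ge0 ?(ltW kn) ?(ltW tau0) ?(ltW C0).
  have := ler_wpM2r h U.
  rewrite (_ : N%:R * (_ * _) = x ^+ k / k%:R * (N%:R * tau) * 'C(N, m)%:R); last by ring.
  apply: le_trans; rewrite le_eqVlt; apply/orP; left; apply/eqP.
  by field; rewrite gt_eqF.
Qed.

Lemma PmE (R : realType) N m (A : pred {set 'I_N}) :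
  Pm m A = (\sum_(S in msets N m) (A S)%:R) / #|msets N m|%:R :> R.
Proof.
rewrite /Pm; congr (_ / _).
transitivity (\sum_(S in msets N m) (if A S then 1 else 0 : R)).
  by rewrite -big_mkcondr sumr_const; congr (_%:R); apply: eq_card => S; rewrite [RHS]unfold_in !inE.
by apply: eq_bigr => S _; case: (A S).
Qed.

(** Markov's inequality for [q^(X - t)], which is at least 1 on the event [X <= t]. *)
Lemma Pm_le_tilted_mean (R : realType) N m (E : {set {set 'I_N}}) (q t : R) : 0 < q <= 1 ->
  Pm m (fun S => (edges_in E S)%:R <= t) <= tilted_mean q E m * expR (- (t * ln q)).
Proof.
move=> /andP[q0 q1]; rewrite PmE /tilted_mean mulrAC ler_wpM2r ?invr_ge0 //.
rewrite mulr_suml; apply: ler_sum => S _; case: (lerP _ t) => h; last first.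
  by rewrite mulr_ge0 ?expR_ge0 // exprn_ge0 // ltW.
have -> : q ^+ edges_in E S = expR ((edges_in E S)%:R * ln q).
  by rewrite expRM_natl lnK ?posrE.
rewrite -expRD; apply: le_trans (expR_ge1Dx _); rewrite lerDl.
have : ln q <= 0 by rewrite ln_le0.
by clear -h; nra.
Qed.

(** Above [t] the weight [q^X] is compared with [q2^X], below [s] with [q0^X]. In between
    [q^X <= q^s], which leaves the probability that is to be bounded from below. *)
Lemma tilted_mean_split (R : realType) N m (E : {set {set 'I_N}}) (q0 q q2 s t : R) :
  0 < q0 -> q0 <= q -> q <= q2 -> q <= 1 ->
  tilted_mean q E m <= expR (t * ln (q / q2)) * tilted_mean q2 E m
    + expR (s * ln (q / q0)) * tilted_mean q0 E m
    + expR (s * ln q) * Pm m (fun S => (edges_in E S)%:R <= t).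
Proof.
move=> q00 q0q qq2 q1; rewrite PmE /tilted_mean !mulrA -!mulrDl ler_wpM2r ?invr_ge0 //.
have q_0 : 0 < q by apply: lt_le_trans q0q.
have q20 : 0 < q2 by apply: lt_le_trans qq2.
rewrite !mulr_sumr -!big_split /=; apply: ler_sum => S _.
set X := edges_in E S.
have A (p : R) : 0 < p -> q ^+ X = expR (X%:R * ln (q / p)) * p ^+ X.
  by move=> p0; rewrite (exprn_tilt _ p0 q_0) mulrC [ln _ * _]mulrC mulrC.
have N1 : 0 <= expR (t * ln (q / q2)) * q2 ^+ X by rewrite mulr_ge0 ?expR_ge0 // exprn_ge0 // ltW.
have N2 : 0 <= expR (s * ln (q / q0)) * q0 ^+ X by rewrite mulr_ge0 ?expR_ge0 // exprn_ge0 // ltW.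
have [h|h] := lerP X%:R t; last first.
  apply: (@le_trans _ _ (expR (t * ln (q / q2)) * q2 ^+ X)); last by rewrite mulr0 addr0 lerDl.
  rewrite (A q2 q20) ler_wpM2r ?exprn_ge0 ?(ltW q20) // ler_expR.
  have : ln (q / q2) <= 0 by rewrite ln_le0 // ler_pdivrMr // mul1r.
  by clear -h; nra.
have [h2|h2] := ltP X%:R s.
  apply: (@le_trans _ _ (expR (s * ln (q / q0)) * q0 ^+ X)); last by rewrite mulr1 -addrA addrCA lerDl addr_ge0 ?expR_ge0.
  rewrite (A q0 q00) ler_wpM2r ?exprn_ge0 ?(ltW q00) // ler_expR.
  have : 0 <= ln (q / q0) by rewrite ln_ge0 // ler_pdivlMr // mul1r.
  by clear -h2; nra.
apply: (@le_trans _ _ (expR (s * ln q))); last by rewrite mulr1 lerDr addr_ge0.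
have -> : q ^+ X = expR (X%:R * ln q) by rewrite expRM_natl lnK ?posrE.
rewrite ler_expR.
have : ln q <= 0 by rewrite ln_le0.
by clear -h2; nra.
Qed.

Lemma tilted_mean0 (R : realType) N m (E : {set {set 'I_N}}) :
  Pm m (fun S => edges_in E S == 0%N) = tilted_mean 0 E m :> R.
Proof.
by rewrite PmE /tilted_mean; congr (_ / _); apply: eq_bigr => S _; rewrite expr0n.
Qed.

Local Open Scope classical_set_scope.
Local Open Scope ring_scope.

(** * Passage to the limit *)

(** For k >= 3 the pair degrees, and for k = 2 the codegrees, force N tau to be
    large. *)
Lemma mass_large3 (R : realType) N k (eps tau : R) (E : {set {set 'I_N}}) (v : 'I_N) :
  (3 <= k)%N -> tree_like k eps tau E -> 1 - eps <= eps * (N%:R * tau).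
Proof.
move=> k3 HE; have [kE /andP[tau0 tau_le] _ _ Hd] := HE.
have eps0 : 0 <= eps by apply: ltW; apply: lt_le_trans tau_le.
have /andP[Hv _] := Hd v; apply: (le_trans Hv).
have H : (hdeg E [set v]%SET <= \sum_(t | t != v) hdeg E [set v; t]%SET)%N.
  apply: (@leq_trans #|(\bigcup_(t | t != v) [set e in E | [set v; t]%SET \subset e])%SET|); last first.
    exact: leq_card_bigcup.
  apply/subset_leq_card/subsetP => e; rewrite inE sub1set => /andP[eE ve].
  have : (0 < #|e :\ v|)%N.
    by have := cardsD1 v e; rewrite ve (kE e eE); move: #|_|; case=> //; case: (k) k3 => [|[]].
  rewrite card_gt0 => /set0Pn[t]; rewrite !inE => /andP[tv te].
  by apply/bigcupP; exists t => //; rewrite inE eE subUset !sub1set ve te.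
rewrite -(ler_nat R) natr_sum in H.
have -> : k.-1 = (k - 2).+1 by case: (k) k3 => [|[|k']] // _; rewrite subn2.
rewrite exprSr mulrA mulrA ler_wpM2r ?(ltW tau0) //.
apply: (le_trans (ler_wpM2r (exprn_ge0 _ (ltW tau0)) H)); rewrite mulr_suml.
apply: (@le_trans _ _ (\sum_(t : 'I_N | t != v) eps)); last first.
  rewrite sumr_const mulr_natr.
  by apply: ler_wpMn2l => //; rewrite -[X in (_ <= X)%N](card_ord N) max_card.
apply: ler_sum => t tv; have C2 : #|[set v; t]%SET| = 2%N by rewrite cards2 eq_sym tv.
have := hdeg_scaled HE (S := [set v; t]%SET); rewrite C2; apply.
by case: (k) k3 => [|[|[]]].
Qed.

(** Count paths of length two from [v]: there are of order [tau^(-2)] of them, while each endpoint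
    other than [v] is reached at most [eps / tau] times by the codegree condition. Hence there must
    be many endpoints. *)
Lemma mass_large2 (R : realType) N (eps tau : R) (E : {set {set 'I_N}}) (v : 'I_N) :
  eps <= 1 / 4 -> tree_like 2 eps tau E -> 1 / 4 <= eps * (N%:R * tau).
Proof.
move=> eps1 HE; have [kE /andP[tau0 tau_le] _ _ Hd] := HE.
have eps0 : 0 < eps by apply: lt_le_trans tau_le.
pose a (t w : 'I_N) := [set t; w]%SET \in E.
pose n t := #|[set w | a t w]%SET|.
have n_ge t : 3 / 4 <= (n t)%:R * tau.
  have /andP[Ht _] := Hd t; apply: (@le_trans _ _ ((hdeg E [set t]%SET)%:R * tau ^+ 1)).
    by apply: le_trans Ht; lra.
  rewrite expr1 ler_wpM2r ?(ltW tau0) // ler_nat.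
  apply: leq_trans (leq_imset_card (fun w => [set t; w]%SET) _).
  apply/subset_leq_card/subsetP => e; rewrite inE sub1set => /andP[eE te].
  have /cards1P[w Ew] : #|e :\ t| == 1%N.
    have : (2 = 1 + #|e :\ t|)%N by rewrite -(kE e eE) (cardsD1 t e) te.
    by rewrite add1n => -[<-].
  have Ee : e = [set t; w]%SET by rewrite -Ew setD1K.
  by apply/imsetP; exists w => //; rewrite inE /a -Ee.
pose c w := #|[set t | a t v && a t w]%SET|.
have c_le w : v != w -> (c w)%:R * tau <= eps.
  move=> vw; apply: le_trans (codeg_scaled HE vw); rewrite expr1 ler_wpM2r ?(ltW tau0) // ler_nat.
  rewrite /c -(card_imset _ (@set1_inj _)); apply/subset_leq_card/subsetP => S /imsetP[t].
  by rewrite inE => /andP[tv tw] ->; rewrite inE cards1 eqxx /=; apply/andP; split.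
have H : \sum_(t | a t v) ((n t)%:R - 1) <= \sum_(w | v != w) (c w)%:R :> R.
  have E1 w : (c w)%:R = \sum_(t | a t v) (a t w)%:R :> R.
    rewrite /c big_mkcond /= -sum1_card natr_sum big_mkcond /=; apply: eq_bigr => t _.
    by rewrite inE; case: (a t v); case: (a t w).
  rewrite (eq_bigr _ (fun w _ => E1 w)) exchange_big /=; apply: ler_sum => t tv.
  rewrite /n -sum1_card natr_sum lerBlDr.
  rewrite [X in X <= _](eq_bigl (fun w => a t w)); last by move=> w; rewrite inE.
  rewrite (bigD1 v) //= addrC lerD2r [X in X <= _]big_mkcond [X in _ <= X]big_mkcond /=.
  apply: ler_sum => w _; rewrite (eq_sym v w).
  by case: (a t w); case: (w == v).
have A1 : \sum_(w | v != w) (c w)%:R * tau <= N%:R * eps.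
  apply: (@le_trans _ _ (\sum_(w : 'I_N | v != w) eps)); first by apply: ler_sum => w; apply: c_le.
  rewrite sumr_const mulr_natl; apply: ler_wpMn2l; first exact: ltW.
  by rewrite -[X in (_ <= X)%N](card_ord N) max_card.
have A2 : \sum_(t | a t v) (3 / 4 - tau) <= \sum_(t | a t v) ((n t)%:R - 1) * tau.
  by apply: ler_sum => t _; rewrite mulrBl mul1r lerD2r.
have A3 : \sum_(t | a t v) (3 / 4 - tau) = (n v)%:R * (3 / 4 - tau).
  rewrite sumr_const [(n v)%:R * _]mulr_natl; congr (_ *+ _); apply: eq_card => t.
  by rewrite inE unfold_in /a setUC.
have A4 : \sum_(t | a t v) ((n t)%:R - 1) * tau <= \sum_(w | v != w) (c w)%:R * tau.
  by rewrite -!mulr_suml ler_wpM2r // ltW.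
have A5 : (n v)%:R * (3 / 4 - tau) <= N%:R * eps.
  by rewrite -A3 (le_trans A2) // (le_trans A4).
have A6 := ler_wpM2r (ltW tau0) A5; have A7 := n_ge v.
apply: (@le_trans _ _ ((n v)%:R * (3 / 4 - tau) * tau)); last first.
  by apply: (le_trans A6); rewrite mulrAC mulrC.
rewrite mulrAC; move: A7; set z := _ * tau => A7.
have : tau <= 1 / 4 by apply: le_trans eps1.
clear -A7 tau0; nra.
Qed.

Lemma mass_large (R : realType) N k (eps tau : R) (E : {set {set 'I_N}}) :
  (2 <= k)%N -> (0 < N)%N -> eps <= 1 / 4 -> tree_like k eps tau E -> 1 / 4 <= eps * (N%:R * tau).
Proof.
move=> k2 N0 eps1 HE; have v : 'I_N by exact: Ordinal N0.
have [k3|k3] := leqP 3 k.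
  by apply: le_trans (mass_large3 v k3 HE); lra.
have Ek : k = 2%N by apply/eqP; rewrite eqn_leq k2 andbT -ltnS.
by rewrite Ek in HE; apply: mass_large2 v _ HE.
Qed.

Lemma bigmin_le N (F : 'I_N -> nat) x v : (\big[minn/x]_(i : 'I_N) F i <= F v)%N.
Proof.
have : v \in index_enum 'I_N by rewrite mem_index_enum.
elim: (index_enum _) => [//|i r IH]; rewrite inE big_cons geq_min => /orP[/eqP ->|vr].
  by rewrite leqnn.
by rewrite IH // orbT.
Qed.

Lemma ln_rate_cvg (R : realType) (M P : nat -> R) (L : R) :
  (\forall n \near \oo, 0 < M n) ->
  (forall e : R, 0 < e -> \forall n \near \oo,
     expR ((L - e) * M n) <= P n <= expR ((L + e) * M n)) ->
  (\forall n \near \oo, 0 < P n) /\ (fun n => (M n)^-1 * ln (P n)) @ \oo --> L.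
Proof.
move=> HM HP; split.
  by apply: filterS (HP 1 ltr01) => n /andP[h _]; apply: lt_le_trans h; exact: expR_gt0.
apply/cvgrPdist_le => e e0; have := HP e e0; apply: filterS2 HM => n M0 /andP[h1 h2].
have P0 : 0 < P n by apply: lt_le_trans h1; exact: expR_gt0.
rewrite -[P n]lnK ?posrE // !ler_expR in h1 h2.
rewrite mulrC ler_distlC; apply/andP; split.
  by rewrite ler_pdivlMr.
by rewrite ler_pdivrMr.
Qed.

Section Asymptotics.
Variables (R : realType) (k : nat) (b : R) (N : nat -> nat).
Variables (E : forall n, {set {set 'I_(N n)}}) (m : nat -> nat).
Hypotheses (k2 : (2 <= k)%N) (b0 : 0 < b).
Hypotheses (HT : @asymp_tree_like R k N E) (HR : @approx_regular R N E).

Let Delta n : R := (maxdeg (E n))%:R.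
Let tau n : R := Delta n `^ (- (1 / (k%:R - 1))).
Let M n : R := (N n)%:R * tau n.

Hypothesis Hm : (fun n => ((m n)%:R : R) / (b * (N n)%:R * (maxdeg (E n))%:R `^ (- (1 / (k%:R - 1))))) @ \oo --> (1 : R).

Lemma natr_pred : k%:R - 1 = k.-1%:R :> R.
Proof. by rewrite -[X in X%:R - 1](prednK (ltnW k2)) -natr1 addrK. Qed.

Lemma predk_gt0 : 0 < k.-1%:R :> R.
Proof. by rewrite ltr0n; case: (k) k2 => [|[]]. Qed.

Lemma tau_expr n j : tau n ^+ j = (Delta n `^ (j%:R / k.-1%:R))^-1.
Proof.
rewrite /tau natr_pred powRN exprVn -powR_mulrn ?powR_ge0 // -powRrM.
by congr (_ `^ _)^-1; rewrite mulrAC mul1r.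
Qed.

Lemma tau_expr_pred n : 0 <= Delta n -> tau n ^+ k.-1 = (Delta n)^-1.
Proof. by move=> D0; rewrite tau_expr divff ?gt_eqF ?predk_gt0 // powRr1. Qed.

Lemma near_Delta (A : R) : \forall n \near \oo, A <= Delta n.
Proof. by have [_ /cvgryPge H _ _ _] := HT; apply: H. Qed.

Lemma near_tree_like (eps : R) : 0 < eps ->
  \forall n \near \oo, (0 < N n)%N /\ tree_like k eps (tau n) (E n).
Proof.
move=> eps0; have [kE _ Hl HG [c [c0 Hc]]] := HT.
(* Stated over the finite type ['I_k], so that the eventual bounds for all [l] hold
   simultaneously. *)
have near_l : \forall n \near \oo, forall l : 'I_k, (2 <= l <= k.-1)%N ->
    (maxdeg_l (E n) l)%:R * tau n ^+ (k - l) <= eps.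
  apply: filter_forall => l; case: (boolP (2 <= l <= k.-1)%N) => [lr|_]; last by apply: filterS filterT.
  have /cvgr0Pnorm_le/(_ _ eps0) := Hl l lr; apply: filterS => n Hn _.
  apply: le_trans Hn; apply: le_trans (ler_norm _).
  rewrite tau_expr le_eqVlt; apply/orP; left; apply/eqP; congr (_ / _ `^ _).
  by rewrite natr_pred natrB // ltnW.
have near_G : \forall n \near \oo, (codegGamma k (E n))%:R / Delta n <= eps.
  have /cvgr0Pnorm_le/(_ _ eps0) := HG; apply: filterS => n; apply: le_trans; exact: ler_norm.
have near_m : \forall n \near \oo, 1 - eps <= (mindeg (E n))%:R / Delta n.
  have /cvgrPdist_le/(_ _ eps0) := HR; apply: filterS => n.
  by rewrite ler_distlC => /andP[h _].
near=> n.
have D1 : 1 <= Delta n by near: n; exact: near_Delta.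
have D2 : (eps ^+ k.-1)^-1 <= Delta n by near: n; exact: near_Delta.
have D0 : 0 < Delta n by apply: lt_le_trans D1.
have tk := tau_expr_pred (ltW D0).
have t0 : 0 < tau n by rewrite powR_gt0.
split.
  (* With no vertices the quotient of edges by vertices would be 0 by convention, against its lower
     bound by a positive multiple of [Delta]. *)
  rewrite lt0n; apply/negP => /eqP N0.
  have : c * Delta n <= #|E n|%:R / (N n)%:R by near: n.
  have -> : (N n)%:R^-1 = 0 :> R by rewrite N0 invr0.
  by rewrite mulr0 leNgt mulr_gt0.
split.
- exact: kE.
- rewrite t0 /= -(@ler_pXn2r _ k.-1) ?nnegrE ?(ltW t0) ?(ltW eps0) //; last by case: (k) k2 => [|[]].
  by rewrite tk invf_ple ?posrE ?exprn_gt0.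
- move=> l lr; have lk : (l < k)%N.
    by case/andP: lr => _ lk1; rewrite (leq_ltn_trans lk1) // prednK // ltnW.
  have H : forall l : 'I_k, (2 <= l <= k.-1)%N -> (maxdeg_l (E n) l)%:R * tau n ^+ (k - l) <= eps.
    by near: n.
  exact: H (Ordinal lk) lr.
- by rewrite tk; near: n.
- move=> v; rewrite tk; apply/andP; split; last first.
    rewrite ler_pdivrMr // mul1r ler_nat; exact: (@leq_bigmax _ (fun v => hdeg (E n) [set v]%SET)).
  apply: (@le_trans _ _ ((mindeg (E n))%:R / Delta n)); first by near: n.
  rewrite ler_wpM2r ?invr_ge0 ?(ltW D0) // ler_nat.
  exact: (@bigmin_le _ (fun v => hdeg (E n) [set v]%SET)).
Unshelve. all: by end_near.
Qed.

Lemma near_mass (eps : R) : 0 < eps -> \forall n \near \oo, 1 <= eps * M n.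
Proof.
move=> eps0; pose e1 := Num.min (eps / 4) (1 / 4).
have e10 : 0 < e1 by rewrite lt_min !divr_gt0.
have := near_tree_like e10; apply: filterS => n [N0 HE].
have e14 : e1 <= 1 / 4 by rewrite ge_min lexx orbT.
have e1e : e1 <= eps / 4 by rewrite ge_min lexx.
have := mass_large k2 N0 e14 HE; rewrite -/(M n) => H.
have M0 : 0 <= M n by rewrite mulr_ge0 // powR_ge0.
have := ler_wpM2r M0 e1e; lra.
Qed.

Lemma near_M_gt0 : \forall n \near \oo, 0 < M n.
Proof.
have := near_mass ltr01; apply: filterS => n; rewrite mul1r; apply: lt_le_trans; exact: ltr01.
Qed.

Lemma near_size (eps : R) : 0 < eps ->
  \forall n \near \oo, (b - eps) * M n <= (m n)%:R <= (b + eps) * M n.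
Proof.
move=> eps0; have eb : 0 < eps / b by rewrite divr_gt0.
have := near_M_gt0; have /cvgrPdist_le/(_ _ eb) := Hm; apply: filterS2 => n.
rewrite -mulrA -/(tau n) -/(M n) => + M0; rewrite ler_distlC => /andP[h1 h2].
have bM : 0 < b * M n by rewrite mulr_gt0.
rewrite ler_pdivlMr // in h1; rewrite ler_pdivrMr // in h2.
have e1 : (1 - eps / b) * (b * M n) = (b - eps) * M n by field; rewrite gt_eqF.
have e2 : (1 + eps / b) * (b * M n) = (b + eps) * M n by field; rewrite gt_eqF.
by rewrite -e1 -e2 h1 h2.
Qed.

Lemma near_tilted_mean (q e : R) : 0 <= q -> q <= 1 -> k.-1%:R * (1 - q) * b ^+ k.-1 < 1 -> 0 < e ->
  \forall n \near \oo, expR ((- ((1 - q) * b ^+ k / k%:R) - e) * M n) <= tilted_mean q (E n) (m n)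
     <= expR ((- ((1 - q) * b ^+ k / k%:R) + e) * M n).
Proof.
move=> q0 q1 Hb e0.
have [ep1 ep10 H1] := tilted_mean_ge k2 q0 q1 b0 Hb e0.
have [ep2 ep20 H2] := tilted_mean_le k2 q0 q1 b0 Hb e0.
near=> n; apply/andP; split.
- have := H1 (N n) (tau n) (E n) (m n); rewrite opprD; apply.
  + by near: n; apply: filterS (near_tree_like ep10) => n [].
  + by near: n; exact: near_mass.
  + by near: n; apply: filterS (near_size ep10) => n /andP[].
- apply: (H2 (N n) (tau n) (E n) (m n)).
  + by near: n; apply: filterS (near_tree_like ep20) => n [].
  + by near: n; exact: near_mass.
  + by near: n; apply: filterS (near_size ep20) => n /andP[].
Unshelve. all: by end_near.
Qed.

Lemma near_expectation (e : R) : 0 < e ->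
  \forall n \near \oo, (b ^+ k / k%:R - e) * M n <= Em (m n) (edges_in (E n)) <= (b ^+ k / k%:R + e) * M n.
Proof.
move=> e0.
have kn : 0 < k%:R :> R by rewrite ltr0n ltnW.
(* The bounds on the expectation as polynomials in the error, so that continuity at 0 gives the
   precision; [p2] is the negated lower bound. *)
pose p1 : {poly R} := (k%:R^-1) *: (b%:P + 'X) ^+ k.
pose p2 : {poly R} := (- k%:R^-1) *: ((1 - 'X) * (b%:P - 'X) ^+ k).
have p1E x : p1.[x] = (b + x) ^+ k / k%:R.
  by rewrite /p1 hornerZ horner_exp hornerD hornerC hornerX mulrC.
have p2E x : p2.[x] = - ((1 - x) * (b - x) ^+ k / k%:R).
  by rewrite /p2 hornerZ hornerM horner_exp !hornerD !hornerN !hornerC !hornerX mulNr mulrC.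
have [d1 d10 H1] := @horner_lt_near0 R p1 (b ^+ k / k%:R + e) ltac:(by rewrite p1E addr0 ltrDl).
have [d2 d20 H2] := @horner_lt_near0 R p2 (- (b ^+ k / k%:R) + e) ltac:(by rewrite p2E !subr0 mul1r ltrDl).
pose ep := Num.min (Num.min d1 d2) (Num.min 1 b).
have ep0 : 0 < ep by rewrite !lt_min d10 d20 ltr01 b0.
have [l1 [l2 [l3 l4]]] : ep <= d1 /\ ep <= d2 /\ ep <= 1 /\ ep <= b.
  by do !split; rewrite !ge_min lexx ?orbT.
have {}H1 := H1 ep ltac:(by rewrite (ltW ep0) l1).
have {}H2 := H2 ep ltac:(by rewrite (ltW ep0) l2).
rewrite p1E in H1; rewrite p2E in H2.
have ek0 : 0 < ep / (2 * k%:R) by rewrite divr_gt0 // mulr_gt0.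
have eh0 : 0 < ep / 2 by rewrite divr_gt0.
have es0 : 0 < Num.min ep (b + ep)^-1 by rewrite lt_min ep0 invr_gt0 addr_gt0.
near=> n.
have M0 : 0 < M n by near: n; exact: near_M_gt0.
have HE : tree_like k (Num.min ep (b + ep)^-1) (tau n) (E n).
  by near: n; apply: filterS (near_tree_like es0) => n [].
have HE' : tree_like k ep (tau n) (E n) by apply: tree_like_le HE; rewrite ge_min lexx.
have Hk : 1 <= ep / (2 * k%:R) * M n by near: n; exact: near_mass.
have Hs : (b - ep / 2) * M n <= (m n)%:R <= (b + ep / 2) * M n by near: n; exact: near_size.
have [m1 m2] := andP Hs.
have t1 : (b + ep) * tau n <= 1.
  have [_ /andP[_ t1] _ _ _] := HE.
  have : tau n <= (b + ep)^-1 by apply: (le_trans t1); rewrite ge_min lexx orbT.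
  by rewrite -[X in _ <= X]div1r ler_pdivlMr ?addr_gt0 // mulrC.
have kM : k%:R <= ep / 2 * M n.
  have := ler_wpM2l (ltW kn) Hk; rewrite mulr1.
  have -> : k%:R * (ep / (2 * k%:R) * M n) = ep / 2 * M n by field; rewrite gt_eqF.
  by [].
have hx : (m n)%:R <= (b + ep) * tau n * (N n)%:R.
  apply: (le_trans m2); rewrite -mulrA [tau n * _]mulrC -/(M n) ler_wpM2r ?(ltW M0) // lerD2l.
  by rewrite ler_pdivrMr // ler_peMr ?(ltW ep0) // ler1n.
have hy : (b - ep) * tau n * (N n)%:R + k%:R <= (m n)%:R.
  rewrite -mulrA [tau n * _]mulrC -/(M n); apply: le_trans m1.
  by rewrite (_ : (b - ep / 2) * M n = (b - ep) * M n + ep / 2 * M n) ?lerD2l //; field.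
have yM0 : 0 <= (b - ep) * tau n * (N n)%:R by rewrite !mulr_ge0 ?subr_ge0 // powR_ge0.
have kmN : (k <= m n <= N n)%N.
  rewrite -!(ler_nat R); apply/andP; split; first by apply: le_trans hy; rewrite lerDr.
  by apply: (le_trans hx); rewrite ler_piMl.
have /andP[B1 B2] := Em_edges_bounds k2 HE' l3 kmN (y := b - ep) ltac:(by rewrite subr_ge0) t1 hx hy.
apply/andP; split.
  apply: le_trans B1; rewrite -/(M n) ler_wpM2r ?(ltW M0) //.
  by have := ltW H2; rewrite lerNl opprD opprK.
by apply: (le_trans B2); rewrite -/(M n) ler_wpM2r ?(ltW M0) // ltW.
Unshelve. all: by end_near.
Qed.

End Asymptotics.

(** * The lower tail by exponential tilting *)

Lemma ln_lt_subr1 (R : realType) (x : R) : 0 < x -> x != 1 -> ln x < x - 1.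
Proof.
move=> x0 x1; have h : x - 1 != 0 by rewrite subr_eq0.
have := expR_gt1Dx h; rewrite addrCA subrr addr0 => H.
by rewrite -ltr_expR lnK ?posrE.
Qed.

(** The tilt by q concentrates X strictly between q0 mu and eta mu: the tails are
    compared with the tilts by eta and by q0. *)
Lemma lower_tail_bound (R : realType) (beta eta th d M mu w w0 w2 P : R) :
  let q := eta * (1 - th) in let q0 := eta * (1 - 2 * th) in
  0 < eta -> eta < 1 -> 0 < th -> th <= 1 / 4 -> 0 <= d -> d <= beta -> 0 < M ->
  (beta - d) * M <= mu <= (beta + d) * M ->
  expR ((- ((1 - q) * beta) - d) * M) <= w ->
  w2 <= expR ((- ((1 - eta) * beta) + d) * M) ->
  w0 <= expR ((- ((1 - q0) * beta) + d) * M) ->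
  w <= expR (eta * mu * ln (q / eta)) * w2 + expR (q0 * mu * ln (q / q0)) * w0 + expR (q0 * mu * ln q) * P ->
  0 <= P ->
  ln 4 <= (- (eta * beta * (ln (1 - th) + th)) - d * (2 - eta * ln (1 - th))) * M ->
  ln 4 <= (eta * th * beta - q0 * beta * ln (q / q0) - d * (2 + q0 * ln (q / q0))) * M ->
  expR ((- (beta * (1 - eta + eta * ln eta)) - (beta * eta * th * (1 - 2 * ln eta) + d * (1 - eta * ln eta))) * M - ln 2) <= P.
Proof.
move=> q q0 eta0 eta1 th0 th1 d0 db M0 /andP[mu1 mu2] Hw Hw2 Hw0 Hsplit P0 G1 G2.
have q_0 : 0 < q by rewrite mulr_gt0 //; clear -th1; lra.
have q00 : 0 < q0 by rewrite mulr_gt0 //; clear -th1; lra.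
have Eq : q / eta = 1 - th by rewrite /q; field; rewrite gt_eqF.
have w_gt : 0 < w by apply: lt_le_trans (expR_gt0 _) Hw.
have ml1 : ln (1 - th) <= 0 by rewrite ln_le0 // gerBl ltW.
have lw : expR (- ln 4) = 1 / 4 :> R by rewrite expRN lnK ?posrE // div1r.
(* [G1] and [G2] make each tail term at most a quarter of [w], so at least half of [w] is left for
   the middle range. *)
have T1 : expR (eta * mu * ln (q / eta)) * w2 <= w / 4.
  apply: (@le_trans _ _ (expR (- ln 4) * expR ((- ((1 - q) * beta) - d) * M))); last first.
    by rewrite lw mulrC mul1r ler_wpM2r.
  apply: (le_trans (ler_wpM2l (expR_ge0 _) Hw2)); rewrite -!expRD ler_expR Eq.
  have h : eta * mu * ln (1 - th) <= eta * ((beta - d) * M) * ln (1 - th).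
    by rewrite -!mulrA ler_wpM2l ?(ltW eta0) // !mulrA ler_wnM2r.
  apply: le_trans (_ : eta * ((beta - d) * M) * ln (1 - th) + (- ((1 - eta) * beta) + d) * M <= _).
    by rewrite lerD2r.
  move: G1; rewrite /q; set l := ln (1 - th); set l4 := ln 4; clear; clearbody l l4; nra.
have om0 : 0 <= ln (q / q0).
  rewrite ln_ge0 // ler_pdivlMr // mul1r /q /q0 ler_wpM2l ?(ltW eta0) //; clear -th0; lra.
have T2 : expR (q0 * mu * ln (q / q0)) * w0 <= w / 4.
  apply: (@le_trans _ _ (expR (- ln 4) * expR ((- ((1 - q) * beta) - d) * M))); last first.
    by rewrite lw mulrC mul1r ler_wpM2r.
  apply: (le_trans (ler_wpM2l (expR_ge0 _) Hw0)); rewrite -!expRD ler_expR.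
  have h : q0 * mu * ln (q / q0) <= q0 * ((beta + d) * M) * ln (q / q0).
    by rewrite ler_wpM2r // ler_wpM2l // ltW.
  apply: le_trans (_ : q0 * ((beta + d) * M) * ln (q / q0) + (- ((1 - q0) * beta) + d) * M <= _).
    by rewrite lerD2r.
  move: G2; set l := ln (q / q0); set l4 := ln 4.
  have Eqq : q = q0 + eta * th by rewrite /q /q0; ring.
  rewrite Eqq; clear; clearbody l l4 q0; nra.
have T3 : w / 2 <= expR (q0 * mu * ln q) * P.
  by move: Hsplit T1 T2; set A := _ * w2; set B := _ * w0; set C := _ * P; clear; clearbody A B C; lra.
have T4 : expR (- (q0 * mu * ln q)) * (w / 2) <= P.
  have := ler_wpM2l (expR_ge0 (- (q0 * mu * ln q))) T3.
  by rewrite [expR _ * (expR _ * P)]mulrA -expRD addNr expR0 mul1r.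
apply: le_trans T4.
have w2' : expR ((- ((1 - q) * beta) - d) * M - ln 2) <= w / 2.
  rewrite expRD expRN lnK ?posrE //; by rewrite ler_wpM2r ?invr_ge0.
apply: le_trans (ler_wpM2l (expR_ge0 _) w2'); rewrite -expRD ler_expR.
have lq : ln q <= ln eta.
  by rewrite ler_ln ?posrE // /q ler_piMr ?(ltW eta0) // gerBl ltW.
have le0 : ln eta <= 0 by rewrite ln_le0 // ltW.
have K1 : (beta - d) * M * (eta * (1 - 2 * th)) * (- ln eta) <= - (q0 * mu * ln q).
  have h1 : (beta - d) * M * q0 <= q0 * mu by rewrite mulrC ler_wpM2l // ltW.
  have h2 : 0 <= (beta - d) * M * q0.
    by apply: mulr_ge0 (ltW q00); rewrite mulr_ge0 ?subr_ge0 // ltW.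
  rewrite -[X in _ <= X]mulrN; apply: ler_pM => //; first by rewrite oppr_ge0.
  by rewrite lerN2.
move: K1; rewrite /q; set K := - (q0 * mu * ln q); set l2 := ln 2; set le := ln eta in le0 *.
set BM := beta * M; set dM := d * M.
have dM0 : 0 <= dM by rewrite mulr_ge0 // ltW.
have e1 : (beta - d) * M * (eta * (1 - 2 * th)) * - le = (eta * (1 - 2 * th)) * (- le) * (BM - dM) by rewrite /BM /dM; ring.
have X : 0 <= eta * th * (- le) * dM.
  by rewrite mulr_ge0 // mulr_ge0 ?oppr_ge0 // mulr_ge0 // ltW.
rewrite e1 => K1.
have -> : (- (beta * (1 - eta + eta * le)) - (beta * eta * th * (1 - 2 * le) + d * (1 - eta * le))) * M - l2 =
   - ((1 - eta + eta * le) * BM) - (eta * th * (1 - 2 * le) * BM + (1 - eta * le) * dM) - l2.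
  by rewrite /BM /dM; ring.
have -> : (- ((1 - eta * (1 - th)) * beta) - d) * M = - ((1 - eta * (1 - th)) * BM) - dM.
  by rewrite /BM /dM; ring.
move: K1 X; clear; clearbody K l2 le BM dM; move=> K1 X; lra.
Qed.

Section LowerTail.
Variables (R : realType) (k : nat) (b : R) (N : nat -> nat).
Variables (E : forall n, {set {set 'I_(N n)}}) (m : nat -> nat).
Hypotheses (k2 : (2 <= k)%N) (b0 : 0 < b).
Hypotheses (HT : @asymp_tree_like R k N E) (HR : @approx_regular R N E).
Hypothesis Hm : (fun n => ((m n)%:R : R) / (b * (N n)%:R * (maxdeg (E n))%:R `^ (- (1 / (k%:R - 1))))) @ \oo --> (1 : R).

Let tau n : R := (maxdeg (E n))%:R `^ (- (1 / (k%:R - 1))).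
Let M n : R := (N n)%:R * tau n.

Lemma scale_eq n : (maxdeg (E n))%:R `^ (1 / (k%:R - 1)) / (N n)%:R = (M n)^-1 :> R.
Proof. by rewrite /M /tau powRN invfM invrK mulrC. Qed.

Lemma rate_zero : k.-1%:R * b ^+ k.-1 < 1 ->
  (\forall n \near \oo, 0 < Pm (m n) (fun S => edges_in (E n) S == 0%N) :> R) /\
  (fun n => (M n)^-1 * ln (Pm (m n) (fun S => edges_in (E n) S == 0%N))) @ \oo --> (- (b ^+ k / k%:R)).
Proof.
move=> Hb; apply: ln_rate_cvg; first exact: (near_M_gt0 k2 HT HR).
move=> e e0; have Hb0 : k.-1%:R * (1 - 0) * b ^+ k.-1 < 1 by rewrite subr0 mulr1.
have := near_tilted_mean k2 b0 HT HR Hm (lexx 0) ler01 Hb0 e0.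
by apply: filterS => n; rewrite tilted_mean0 subr0 mul1r.
Qed.

(** The upper bound is Markov's inequality with the tilt [eta] itself. For the lower bound the tilt
    [q] is slightly smaller than [eta], which puts the typical value of X strictly below the
    threshold. *)
Lemma rate_pos (eta : R) : 0 < eta -> eta < 1 -> k.-1%:R * b ^+ k.-1 * (1 - eta) < 1 ->
  (\forall n \near \oo, 0 < Pm (m n) (fun S => (edges_in (E n) S)%:R <= eta * Em (m n) (edges_in (E n))) :> R) /\
  (fun n => (M n)^-1 * ln (Pm (m n) (fun S => (edges_in (E n) S)%:R <= eta * Em (m n) (edges_in (E n))))) @ \oo
     --> (- (b ^+ k / k%:R * (1 - eta + eta * ln eta))).
Proof.
move=> eta0 eta1 Hb; apply: ln_rate_cvg; first exact: (near_M_gt0 k2 HT HR).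
move=> e e0.
have kn : 0 < k%:R :> R by rewrite ltr0n ltnW.
set beta := b ^+ k / k%:R.
have beta0 : 0 < beta by rewrite divr_gt0 // exprn_gt0.
have le0 : ln eta < 0 by rewrite ln_lt0 // eta0.
pose Kb := k.-1%:R * b ^+ k.-1.
have Kb0 : 0 < Kb by rewrite mulr_gt0 ?exprn_gt0 // (predk_gt0 R k2).
have s0 : 0 < 1 - Kb * (1 - eta) by rewrite subr_gt0.
have r0 : 0 < 1 - 2 * ln eta by lra.
(* The second term bounds the loss in the final exponent by [e / 4]; the third keeps the contraction
   condition true at [q0], the smallest tilt in use. *)
pose th := Num.min (1 / 4) (Num.min (e / (4 * (beta * eta * (1 - 2 * ln eta)))) ((1 - Kb * (1 - eta)) / (4 * (eta * Kb)))).
have be0 : 0 < beta * eta * (1 - 2 * ln eta) by apply: mulr_gt0 r0; apply: mulr_gt0.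
have ek0 : 0 < eta * Kb by apply: mulr_gt0.
have th0 : 0 < th.
  by rewrite !lt_min; apply/and3P; split; rewrite divr_gt0 // pmulr_rgt0.
have [t1 [t2 t3]] : th <= 1 / 4 /\ th <= e / (4 * (beta * eta * (1 - 2 * ln eta))) /\
   th <= (1 - Kb * (1 - eta)) / (4 * (eta * Kb)).
  by do !split; rewrite !ge_min lexx ?orbT.
have t2' : beta * eta * th * (1 - 2 * ln eta) <= e / 4.
  rewrite mulrAC; apply: (le_trans (ler_wpM2l (ltW be0) t2)).
  by rewrite le_eqVlt; apply/orP; left; apply/eqP; field; rewrite !gt_eqF.
pose q := eta * (1 - th); pose q0 := eta * (1 - 2 * th).
have q00 : 0 < q0 by rewrite mulr_gt0 //; lra.
have q0q : q0 < q by rewrite ltr_pM2l //; lra.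
have qe : q < eta by rewrite gtr_pMr //; lra.
have q_0 := lt_trans q00 q0q.
have q01 : q0 <= 1 by lra.
have q1 : q <= 1 by lra.
have Hq0 : k.-1%:R * (1 - q0) * b ^+ k.-1 < 1.
  rewrite mulrAC -/Kb.
  have : 2 * (eta * Kb) * th <= (1 - Kb * (1 - eta)) / 2.
    have ek0' : 0 <= 2 * (eta * Kb) by rewrite pmulr_rge0 // ltW.
    apply: (le_trans (ler_wpM2l ek0' t3)).
    by rewrite le_eqVlt; apply/orP; left; apply/eqP; field; rewrite !gt_eqF.
  rewrite /q0; nra.
have Hcond p : q0 <= p -> k.-1%:R * (1 - p) * b ^+ k.-1 < 1.
  move=> h; apply: le_lt_trans Hq0; rewrite ler_wpM2r ?exprn_ge0 ?(ltW b0) //.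
  by rewrite ler_wpM2l // lerB.
pose om := ln (q / q0).
have om0 : 0 < om by rewrite ln_gt0 // ltr_pdivlMr // mul1r.
pose l1 := - ln (1 - th).
have l1_0 : 0 < l1 by rewrite oppr_gt0 ln_lt0 //; lra.
(* The gaps per unit of [M] between the tilted mean and its two tails when [d = 0]. Both are
   positive by the strict inequality [ln y < y - 1], applied to [1 - th] and to [q / q0]. *)
pose g1 := eta * beta * (l1 - th); pose g2 := eta * th * beta - q0 * beta * om.
have g10 : 0 < g1.
  apply: mulr_gt0; first by apply: mulr_gt0.
  rewrite subr_gt0 /l1 ltrNr.
  by have := @ln_lt_subr1 R (1 - th); rewrite addrAC subrr add0r; apply; [lra | rewrite lt_eqF //; lra].
have g20 : 0 < g2.
  have -> : g2 = beta * (eta * th - q0 * om) by rewrite /g2; ring.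
  rewrite mulr_gt0 // subr_gt0 mulrC -ltr_pdivlMr //.
  apply: (@lt_le_trans _ _ (q / q0 - 1)).
    by apply: ln_lt_subr1; rewrite ?divr_gt0 // gt_eqF // ltr_pdivlMr // mul1r.
  rewrite le_eqVlt; apply/orP; left; apply/eqP.
  have -> : q = q0 + eta * th by rewrite /q /q0; ring.
  by field; rewrite gt_eqF.
pose A1 := 2 + eta * l1; pose A2 := 2 + q0 * om; pose A3 := 1 - eta * ln eta.
have A10 : 0 < A1 by rewrite addr_gt0 // mulr_gt0.
have A20 : 0 < A2 by rewrite addr_gt0 // mulr_gt0.
have A30 : 0 < A3 by rewrite subr_gt0 (lt_trans _ ltr01) // pmulr_rlt0.
(* [A1], [A2] and [A3] are the coefficients of [d] in the two gaps and in the final exponent; at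
   most half of each gap is spent. *)
pose d := Num.min (Num.min beta (g1 / (2 * A1))) (Num.min (g2 / (2 * A2)) (e / (4 * A3))).
have d0 : 0 < d.
  by rewrite !lt_min beta0 /=; apply/and3P; split; rewrite divr_gt0 // pmulr_rgt0.
have [db [d1 [d2 d3]]] : d <= beta /\ d <= g1 / (2 * A1) /\ d <= g2 / (2 * A2) /\ d <= e / (4 * A3).
  by do !split; rewrite !ge_min lexx ?orbT.
have d1' : d * A1 <= g1 / 2.
  apply: (le_trans (ler_wpM2r (ltW A10) d1)).
  by rewrite le_eqVlt; apply/orP; left; apply/eqP; field; rewrite !gt_eqF.
have d2' : d * A2 <= g2 / 2.
  apply: (le_trans (ler_wpM2r (ltW A20) d2)).
  by rewrite le_eqVlt; apply/orP; left; apply/eqP; field; rewrite !gt_eqF.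
have d3' : d * A3 <= e / 4.
  apply: (le_trans (ler_wpM2r (ltW A30) d3)).
  by rewrite le_eqVlt; apply/orP; left; apply/eqP; field; rewrite !gt_eqF.
have g14 : 0 < g1 / 4 by rewrite divr_gt0.
have g24 : 0 < g2 / 4 by rewrite divr_gt0.
have e4 : 0 < e / 4 by rewrite divr_gt0.
have NT p : q0 <= p -> p <= 1 -> \forall n \near \oo,
    expR ((- ((1 - p) * beta) - d) * M n) <= tilted_mean p (E n) (m n)
     <= expR ((- ((1 - p) * beta) + d) * M n).
  move=> h1 h2; have := near_tilted_mean k2 b0 HT HR Hm (le_trans (ltW q00) h1) h2 (Hcond p h1) d0.
  by apply: filterS => n; rewrite /beta -!mulrA.
near=> n.
have M0 : 0 < M n by near: n; exact: (near_M_gt0 k2 HT HR).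
have Mg1 : 1 <= g1 / 4 * M n by near: n; exact: (near_mass k2 HT HR).
have Mg2 : 1 <= g2 / 4 * M n by near: n; exact: (near_mass k2 HT HR).
have Me : 1 <= e / 4 * M n by near: n; exact: (near_mass k2 HT HR).
have mu12 : (beta - d) * M n <= Em (m n) (edges_in (E n)) <= (beta + d) * M n.
  by near: n; exact: (near_expectation k2 b0 HT HR Hm).
have /andP[w1 w1'] : expR ((- ((1 - q) * beta) - d) * M n) <= tilted_mean q (E n) (m n)
     <= expR ((- ((1 - q) * beta) + d) * M n) by near: n; apply: NT => //; exact: ltW.
have /andP[w2 w2'] : expR ((- ((1 - eta) * beta) - d) * M n) <= tilted_mean eta (E n) (m n)
     <= expR ((- ((1 - eta) * beta) + d) * M n) by near: n; apply: NT; rewrite ltW // (lt_trans q0q).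
have /andP[w0 w0'] : expR ((- ((1 - q0) * beta) - d) * M n) <= tilted_mean q0 (E n) (m n)
     <= expR ((- ((1 - q0) * beta) + d) * M n) by near: n; apply: NT.
set mu := Em _ _ in mu12 *.
have ln4 := ln4_le2 R; have ln2 := ln2_le1 R.
have P0 : 0 <= Pm (m n) (fun S => (edges_in (E n) S)%:R <= eta * mu) :> R by rewrite divr_ge0.
apply/andP; split.
- have SP := tilted_mean_split (m n) (E n) (q0 * mu) (eta * mu) q00 (ltW q0q) (ltW qe) q1.
  have G1 : ln 4 <= (- (eta * beta * (ln (1 - th) + th)) - d * (2 - eta * ln (1 - th))) * M n.
    apply: (le_trans ln4).
    have -> : - (eta * beta * (ln (1 - th) + th)) - d * (2 - eta * ln (1 - th)) = g1 - d * A1.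
      by rewrite /g1 /A1 /l1; ring.
    have := ler_wpM2r (ltW M0) d1'; move: Mg1; lra.
  have G2 : ln 4 <= (eta * th * beta - q0 * beta * ln (q / q0) - d * (2 + q0 * ln (q / q0))) * M n.
    apply: (le_trans ln4).
    have -> : eta * th * beta - q0 * beta * ln (q / q0) - d * (2 + q0 * ln (q / q0)) = g2 - d * A2.
      by rewrite /g2 /A2 /om; ring.
    have := ler_wpM2r (ltW M0) d2'; move: Mg2; lra.
  have := lower_tail_bound eta0 eta1 th0 t1 (ltW d0) db M0 mu12 w1 w2' w0' SP P0 G1 G2.
  apply: le_trans; rewrite ler_expR.
  have h1 := ler_wpM2r (ltW M0) t2'; have h2 := ler_wpM2r (ltW M0) d3'.
  rewrite -/A3; move: h1 h2 Me ln2.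
  set x := beta * eta * th * _; set y := d * A3; set z := beta * _; set l2 := ln 2; lra.
- have e01 : 0 < eta <= 1 by rewrite eta0 ltW.
  have Pub := Pm_le_tilted_mean (m n) (E n) (eta * mu) e01.
  apply: (le_trans Pub); apply: (le_trans (ler_wpM2r (expR_ge0 _) w2')).
  rewrite -expRD ler_expR.
  have [_ mu2] := andP mu12.
  have h1 : - (eta * mu * ln eta) <= (beta + d) * M n * (eta * (- ln eta)).
    rewrite (_ : - (eta * mu * ln eta) = mu * (eta * - ln eta)); last by rewrite mulrN [eta * mu]mulrC -mulrA mulrN.
    by rewrite ler_wpM2r // mulr_ge0 ?(ltW eta0) // oppr_ge0 ltW.
  apply: le_trans (_ : (- ((1 - eta) * beta) + d) * M n + (beta + d) * M n * (eta * (- ln eta)) <= _).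
    by rewrite lerD2l.
  have -> : (- ((1 - eta) * beta) + d) * M n + (beta + d) * M n * (eta * - ln eta) =
     (- (beta * (1 - eta + eta * ln eta)) + d * A3) * M n by rewrite /A3; ring.
  rewrite ler_wpM2r ?(ltW M0) // lerD2l; apply: (le_trans d3').
  by rewrite ler_pdivrMr // ler_peMr ?(ltW e0) // ler1n.
Unshelve. all: by end_near.
Qed.
End LowerTail.

Unset Implicit Arguments.

(** As [ln] takes the value 0 at nonpositive arguments, eventual positivity of the probabilities
    accompanies each limit. *)
Theorem mainTheorem7 (R : realType) (k : nat) (b : R)
  (N : nat -> nat) (E : forall n, {set {set 'I_(N n)}}) (m : nat -> nat) :
  (2 <= k)%N -> 0 < b ->
  @asymp_tree_like R k N E -> @approx_regular R N E ->
  (* m ~ b |V_n| Delta^{-1/(k-1)} *)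
  (fun n => ((m n)%:R : R) /
     (b * (N n)%:R * (maxdeg (E n))%:R `^ (- (1 / (k%:R - 1)))))
     @ \oo --> (1 : R) ->
  (forall eta : R, 0 <= eta < 1 ->
     (k%:R - 1) * b ^+ k.-1 * (1 - eta) < 1 ->
     let P := fun n =>
       Pm (m n) (fun S => (edges_in (E n) S)%:R
                          <= eta * Em (m n) (edges_in (E n))) in
     (\forall n \near \oo, 0 < P n) /\
     (fun n => (maxdeg (E n))%:R `^ (1 / (k%:R - 1)) / (N n)%:R * ln (P n))
       @ \oo --> (- (b ^+ k * (1 - eta + xlogx eta) / k%:R))) /\
  (b < (k%:R - 1) `^ (- (1 / (k%:R - 1))) ->
     let P := fun n => Pm (m n) (fun S => edges_in (E n) S == 0%N) in
     (\forall n \near \oo, 0 < P n) /\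
     (fun n => (maxdeg (E n))%:R `^ (1 / (k%:R - 1)) / (N n)%:R * ln (P n))
       @ \oo --> (- (b ^+ k / k%:R))).
Proof.
move=> k2 b0 HT HR Hm.
have K1 : k%:R - 1 = k.-1%:R :> R := natr_pred R k2.
have K0 : 0 < k.-1%:R :> R := predk_gt0 R k2.
split=> [eta /andP[eta0 eta1] Hb P|Hb P].
  rewrite K1 in Hb.
  have -> : (fun n => (maxdeg (E n))%:R `^ (1 / (k%:R - 1)) / (N n)%:R * ln (P n)) =
      (fun n => ((N n)%:R * (maxdeg (E n))%:R `^ (- (1 / (k%:R - 1))))^-1 * ln (P n)).
    by apply/funext => n; rewrite scale_eq.
  move: eta0; rewrite le_eqVlt => /predU1P[eta0|eta0].
    have EP n : P n = Pm (m n) (fun S => edges_in (E n) S == 0%N).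
      rewrite /P -eta0 mul0r !PmE; congr (_ / _); apply: eq_bigr => S _.
      by rewrite lern0.
    rewrite -eta0 subr0 mulr1 in Hb.
    have [H1 H2] := rate_zero k2 b0 HT HR Hm Hb.
    split; first by apply: filterS H1 => n; rewrite EP.
    rewrite /xlogx -eta0 eqxx subr0 addr0 mulr1.
    by under eq_fun do rewrite EP.
  have [H1 H2] := rate_pos k2 b0 HT HR Hm eta0 eta1 Hb.
  split=> //; rewrite /xlogx gt_eqF //.
  by rewrite mulrAC.
have -> : (fun n => (maxdeg (E n))%:R `^ (1 / (k%:R - 1)) / (N n)%:R * ln (P n)) =
    (fun n => ((N n)%:R * (maxdeg (E n))%:R `^ (- (1 / (k%:R - 1))))^-1 * ln (P n)).
  by apply/funext => n; rewrite scale_eq.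
apply: (rate_zero k2 b0 HT HR Hm); rewrite K1 in Hb.
(* Raised to the power [k - 1], the bound on [b] becomes [(k - 1) b^(k-1) < 1], the contraction
   condition at [q = 0]. *)
have bk : b ^+ k.-1 < (k.-1%:R `^ (- (1 / k.-1%:R))) ^+ k.-1.
  by rewrite ltr_pXn2r ?nnegrE ?powR_ge0 ?(ltW b0) //; case: (k) k2 => [|[]].
have E2 : (k.-1%:R `^ (- (1 / k.-1%:R))) ^+ k.-1 = k.-1%:R^-1 :> R.
  rewrite -powR_mulrn ?powR_ge0 // -powRrM mulNr mul1r mulVf ?gt_eqF //.
  by rewrite powR_inv1 // ltW.
by rewrite E2 -[X in _ < X]div1r ltr_pdivlMr // mulrC in bk.
Qed.
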